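(* Let $Y$ be a Lévy process in $\mathbb{R}^d$ with generating triplet $(A,N,b)$ and with $h(0^+)=\infty$. Each of the following (mutually equivalent) conditions (C1)–(C4) implies (CIm). (C1) The density $p(t,x)$ of $Y_t$ exists and there are $T_1\in(0,\infty]$, $c_1>0$ such that $\sup_{x\in\mathbb{R}^d}p(t,x)\le c_1[h^{-1}(1/t)]^{-d}$ for all $0<t<T_1$. (C2) There are $T_2\in(0,\infty]$, $c_2>0$ such that $\int_{\mathbb{R}^d}e^{-t\,\mathrm{Re}[\Psi(z)]}dz\le c_2[h^{-1}(1/t)]^{-d}$ for all $0<t<T_2$. (C3) There are $T_3\in(0,\infty]$, $c_3\in(0,1]$, $\alpha_3\in(0,2]$ such that $c_3\Psi^*(|x|)\le \mathrm{Re}[\Psi(x)]$ for all $|x|>1/T_3$, and $\Psi^*(\lambda r)\ge c_3\lambda^{\alpha_3}\Psi^*(r)$ for all $\lambda\ge1$, $r>1/T_3$. (C4) There are $T_4\in(0,\infty]$, $c_4\in[1,\infty)$ such that $\Psi^*(|x|)\le c_4\big(\langle x,Ax\rangle+\int_{|\langle x,z\rangle|<1}|\langle x,z\rangle|^2N(dz)\big)$ for all $|x|>1/T_4$. (CIm) The density $p(t,x)$ of $Y_t$ exists and there are $T\in(0,\infty]$, $c\in[1,\infty)$ such that for every $0<t<T$ there exists $x_t\in\mathbb{R}^d$ with $|x_t|\le c\,h^{-1}(1/t)$ such that for every $|y|\le(1/c)h^{-1}(1/t)$, $$p\big(t,\,y+x_t+t\,b_{[h^{-1}(1/t)]}\big)\ge(1/c)\,[h^{-1}(1/t)]^{-d}.$$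 Moreover, (C3) with constants $T_3,c_3,\alpha_3$ implies (CIm) with a constant $c$ depending only on $d,\alpha_3,c_3$ and with $T=1/h(T_3/c)$. If $T_3<\infty$ in (C3), then (CIm) holds for every $T>0$ with a constant $c$ depending only on $d,\alpha_3,c_3,T_3,T,h$.
   Context: $Y=(Y_t)_{t\ge0}$ is a Lévy process in $\mathbb{R}^d$, $d\in\mathbb{N}$, with generating triplet $(A,N,b)$: $A$ is a symmetric non-negative definite $d\times d$ matrix, $b\in\mathbb{R}^d$, and $N$ is a Lévy measure (Borel measure with $N(\{0\})=0$, $\int(1\wedge|z|^2)N(dz)<\infty$). The characteristic exponent $\Psi$ is given by $\mathbb{E}e^{i\langle x,Y_t\rangle}=e^{-t\Psi(x)}$, $$\Psi(x)=\langle x,Ax\rangle-i\langle x,b\rangle-\int_{\mathbb{R}^d}\big(e^{i\langle x,z\rangle}-1-i\langle x,z\rangle\mathbf{1}_{|z|<1}\big)N(dz).$$ For $r>0$, $h(r)=r^{-2}\|A\|+\int_{\mathbb{R}^d}\big(1\wedge\frac{|x|^2}{r^2}\big)N(dx)$, $\Psi^*(r)=\sup_{|z|\le r}\mathrm{Re}[\Psi(z)]$, and $$b_r=b+\int_{\mathbb{R}^d}z\big(\mathbf{1}_{|z|<r}-\mathbf{1}_{|z|<1}\big)N(dz);$$ $b_{[h^{-1}(1/t)]}$ means $b_r$ with $r=h^{-1}(1/t)$. Standing assumption: $h(0^+)=\infty$; then $h$ is a continuous strictly decreasing bijection of $(0,\infty)$ onto $(0,\infty)$ with inverse $h^{-1}$.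 Conventions: $1/\infty=0$, $h(\infty)=0$, $1/0=\infty$. $p(t,\cdot)$ is the density of the law of $Y_t$ with respect to Lebesgue measure (if $e^{-t\Psi}$ is integrable, it is the continuous one given by Fourier inversion). *)

(* Defs.v *)
From HB Require Import structures.
From mathcomp Require Import all_boot all_order all_algebra.
From mathcomp Require Import complex.
From mathcomp Require Import all_classical all_reals all_analysis.
From mathcomp Require Import measurable_realfun.

Set Implicit Arguments.
Unset Strict Implicit.
Unset Printing Implicit Defensive.

Import Order.TTheory GRing.Theory Num.Theory.
Import numFieldNormedType.Exports.

Local Open Scope classical_set_scope.
Local Open Scope ring_scope.
Local Open Scope complex_scope.

(* 'rV[R]_d with its Borel sigma-algebra.  [Rvec R d] is convertible to
   'rV[R]_d, from which it takes its algebraic and topological structure. *)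
Definition Rvec (R : realType) (d : nat) :=
  g_sigma_algebraType (@open 'rV[R]_d).

(* Lebesgue measure on R^d, as the d-fold product of the one-dimensional one. *)
Section lebesgue_tuple.
Context {R : realType}.
Local Notation tup n := (n.-tuple (measurableTypeR R)).

Definition cons_tup n (p : measurableTypeR R * tup n) : tup n.+1 :=
  [tuple of p.1 :: p.2].

Lemma measurable_cons_tup n : measurable_fun setT (@cons_tup n).
Proof.
by apply: measurable_cons; [exact: measurable_fst|exact: measurable_snd].
Qed.

HB.instance Definition _ n :=
  @isMeasurableFun.Build _ _ _ _ (@cons_tup n) (@measurable_cons_tup n).

Section step.
Variables (n : nat) (m : {sigma_finite_measure set (tup n) -> \bar R}).

Definition lebesgue_tuple_step : set (tup n.+1) -> \bar R :=
  pushforward (lebesgue_measure \x m)%E (@cons_tup n).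

Let step0 : lebesgue_tuple_step set0 = 0%E.
Proof. exact: measure0. Qed.

Let step_ge0 A : (0 <= lebesgue_tuple_step A)%E.
Proof. exact: measure_ge0. Qed.

Let step_sigma_additive : semi_sigma_additive lebesgue_tuple_step.
Proof. exact: measure_semi_sigma_additive. Qed.

HB.instance Definition _ := isMeasure.Build _ _ _ lebesgue_tuple_step
  step0 step_ge0 step_sigma_additive.

Let step_sigma_finite : sigma_finite setT lebesgue_tuple_step.
Proof.
have /sigma_finiteP[F [FT ndF Foo]] := sigma_finiteT (@lebesgue_measure R).
have /sigma_finiteP[G [GT ndG Goo]] := sigma_finiteT m.
pose g (t : tup n.+1) : measurableTypeR R * tup n :=
  (thead t, [tuple of behead t]).
have mg : measurable_fun setT g.
  by apply/measurable_fun_pairP; split;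
    [exact: measurable_tnth|exact: measurable_behead].
have gK p : g (cons_tup p) = p.
  by case: p => x t; congr pair; apply: val_inj.
exists (fun k => g @^-1` (F k `*` G k)).
  rewrite -preimage_bigcup (_ : \bigcup_k _ = setT) ?preimage_setT//.
  apply/seteqP; split => // -[x y] _.
  have [i _ Fi] : (\bigcup_i F i) x by rewrite -FT.
  have [j _ Gj] : (\bigcup_i G i) y by rewrite -GT.
  exists (maxn i j) => //; split => /=.
    by move: x Fi; exact/subsetPset/ndF/leq_maxl.
  by move: y Gj; exact/subsetPset/ndG/leq_maxr.
move=> k; have [mF Fk] := Foo k; have [mG Gk] := Goo k; split.
  by rewrite -[X in measurable X]setTI; apply: mg => //; exact: measurableX.
rewrite /lebesgue_tuple_step /pushforward.
rewrite (_ : _ @^-1` _ = F k `*` G k); last first.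
  apply/seteqP; split=> x; last by move=> FGx; rewrite /preimage/mkset gK.
  by move=> FGx; rewrite -[x]gK.
by rewrite product_measure1E// lte_mul_pinfty// ge0_fin_numE.
Qed.

HB.instance Definition _ :=
  @Measure_isSigmaFinite.Build _ _ _ lebesgue_tuple_step step_sigma_finite.

End step.

Fixpoint lebesgue_tuple n : {sigma_finite_measure set (tup n) -> \bar R} :=
  match n with
  | 0 => @dirac _ (tup 0) [tuple] R
  | n'.+1 => lebesgue_tuple_step (lebesgue_tuple n')
  end.

Definition row_of_tuple d (t : tup d) : Rvec R d := \row_i tnth t i.

Lemma measurable_row_of_tuple d : measurable_fun setT (@row_of_tuple d).
Proof.
apply: (@measurability _ _ (tup d) (Rvec R d) setT (@row_of_tuple d)
  (@open 'rV[R]_d)) => // _ [U oU <-].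
rewrite setTI.
pose q (p : 'rV[rat]_d * nat) : 'rV[R]_d := map_mx ratr p.1.
have -> : U = \bigcup_(p in [set p | ball (q p) p.2.+1%:R^-1 `<=` U])
    ball (q p) p.2.+1%:R^-1.
  apply/seteqP; split => [x Ux|x [p pU]]; last exact: pU.
  have /nbhs_ballP[e /= e0 xeU] : nbhs x U by exact: open_nbhs_nbhs.
  have [n ne] : exists n, n.+1%:R^-1 < e / 2.
    have e20 : 0 < e / 2 by rewrite divr_gt0.
    have /= [n _ /(_ n (leqnn n))] := near_infty_natSinv_lt (PosNum e20).
    by exists n.
  have /choice[f fx] (i : 'I_d) : exists r : rat,
      ball (x 0 i) n.+1%:R^-1 (ratr r).
    have n0 : 0 < n.+1%:R^-1 :> R by rewrite invr_gt0.
    have ne0 : ball (x 0 i) n.+1%:R^-1 !=set0 by exists (x 0 i); exact: ballxx.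
    have [z [xr [r _ rE]]] := dense_rat ne0 (ball_open (x 0 i) _).
    by exists r; rewrite rE.
  have qx : ball (q (\row_i f i, n)) n.+1%:R^-1 x.
    split; first by rewrite invr_gt0.
    by move=> i j; rewrite !mxE ord1; apply/ball_sym/fx.
  exists (\row_i f i, n) => //= y qy; apply: xeU.
  apply: (@le_ball _ _ _ (n.+1%:R^-1 + n.+1%:R^-1)).
    by rewrite [leRHS]splitr lerD// ltW.
  exact: ball_triangle (ball_sym qx) qy.
rewrite preimage_bigcup bigcup_mkcond.
apply: countable_bigcupT_measurable => [|p]; first exact: countableP.
case: ifPn => [_|_]; last exact: measurable0.
rewrite (_ : _ @^-1` _ = \bigcap_(i : 'I_d)
    (fun t => tnth t i) @^-1` ball (q p 0 i) p.2.+1%:R^-1); last first.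
  apply/seteqP; split => t /=.
    by move=> [_ tp] i _ /=; have := tp 0 i; rewrite !mxE.
  move=> tp; split; first by rewrite invr_gt0.
  by move=> i j; rewrite ord1 !mxE; have := tp j I; rewrite /= !mxE.
apply: fin_bigcap_measurable => // i _.
rewrite -[X in measurable X]setTI; apply: measurable_tnth => //.
exact: measurable_ball.
Qed.

Definition lebesgue_vec d : set (Rvec R d) -> \bar R :=
  pushforward (lebesgue_tuple d) (@row_of_tuple d).

Section lebesgue_vec_measure.
Variable d : nat.

HB.instance Definition _ :=
  @isMeasurableFun.Build _ _ _ _ (@row_of_tuple d) (@measurable_row_of_tuple d).

Let lebesgue_vec0 : @lebesgue_vec d set0 = 0%E.
Proof. exact: measure0. Qed.

Let lebesgue_vec_ge0 A : (0 <= @lebesgue_vec d A)%E.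
Proof. exact: measure_ge0. Qed.

Let lebesgue_vec_sigma_additive : semi_sigma_additive (@lebesgue_vec d).
Proof. exact: measure_semi_sigma_additive. Qed.

HB.instance Definition _ := isMeasure.Build _ _ _ (@lebesgue_vec d)
  lebesgue_vec0 lebesgue_vec_ge0 lebesgue_vec_sigma_additive.

End lebesgue_vec_measure.

End lebesgue_tuple.
Arguments lebesgue_vec {R d}.

Section euclidean.
Context {R : realType} {d : nat}.
Implicit Types (x y : 'rV[R]_d) (A : 'M[R]_d).

Definition dotv x y : R := \sum_(i < d) x 0 i * y 0 i.

(* Euclidean norm; the library's norm on 'rV[R]_d is the sup norm. *)
Definition enorm x : R := Num.sqrt (dotv x x).

(* The vector A x, for vectors represented as rows. *)
Definition matvec A x : 'rV[R]_d := x *m A^T.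

Definition opnorm A : R :=
  sup [set enorm (matvec A x) | x in [set x | enorm x <= 1]].

End euclidean.

Section complex_valued.
Context {R : realType}.

Definition cexp (z : R[i]) : R[i] :=
  (expR (complex.Re z) * cos (complex.Im z))
    +i* (expR (complex.Re z) * sin (complex.Im z)).

Context {disp : measure_display} {T : measurableType disp}.
Implicit Types (mu : {measure set T -> \bar R}) (f : T -> R[i]).

Definition cintegrable mu f : Prop :=
  mu.-integrable setT (fun x => (complex.Re (f x))%:E) /\
  mu.-integrable setT (fun x => (complex.Im (f x))%:E).

Definition cintegral mu f : R[i] :=
  (\int[mu]_x complex.Re (f x)) +i* (\int[mu]_x complex.Im (f x)).

End complex_valued.

Section triplet.
Context {R : realType} {d : nat}.
Variables (A : 'M[R]_d) (N : {measure set (Rvec R d) -> \bar R}) (b : 'rV[R]_d).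

Definition levy_measure : Prop :=
  N [set (0 : 'rV[R]_d)] = 0%E /\
  (\int[N]_z (Num.min 1 (enorm z ^+ 2))%:E < +oo)%E.

Definition levy_triplet : Prop :=
  [/\ A^T = A, forall x : 'rV[R]_d, 0 <= dotv x (matvec A x) & levy_measure].

Definition Psi (x : 'rV[R]_d) : R[i] :=
  (dotv x (matvec A x))%:C - 'i%C * (dotv x b)%:C
  - cintegral N (fun z => cexp ('i%C * (dotv x z)%:C) - 1
                          - 'i%C * (dotv x z * (enorm z < 1)%R%:R)%:C).

Definition Psi_star (r : R) : R :=
  sup [set complex.Re (Psi z) | z in [set z | enorm z <= r]].

Definition levy_h (r : R) : R :=
  r ^- 2 * opnorm A + \int[N]_x Num.min 1 (enorm x ^+ 2 / r ^+ 2).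

Definition levy_h_ereal (r : \bar R) : \bar R :=
  if r is s%:E then (levy_h s)%:E else 0%E.

Definition levy_h_unbounded : Prop := levy_h r @[r --> 0^'+] --> +oo.

(* The inverse of the bijection [levy_h] of (0, oo), when h(0+) = oo. *)
Definition levy_h_inv (u : R) : R := xget 0 [set r | 0 < r /\ levy_h r = u].

(* b_r *)
Definition drift (r : R) : 'rV[R]_d :=
  \row_i (b 0 i + \int[N]_z ((z : 'rV[R]_d) 0 i
                              * ((enorm z < r)%R%:R - (enorm z < 1)%R%:R))).

End triplet.

Section process.
Context {R : realType} {d : nat} {disp : measure_display}.
Context {Omega : measurableType disp} (P : probability Omega R).
(* Only the values of [Y] at nonnegative times are used. *)
Variable Y : R -> {RV P >-> Rvec R d}.

Definition increment (s t : R) (w : Omega) : 'rV[R]_d :=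
  (Y t w : 'rV[R]_d) - (Y s w : 'rV[R]_d).

Record levy_process : Prop := LevyProcess {
  levy_start : {ae P, forall w, Y 0 w = (0 : 'rV[R]_d)} ;
  levy_independent_increments :
    forall (n : nat) (s : nat -> R) (B : nat -> set (Rvec R d)),
      0 <= s 0%N -> (forall i, (i < n)%N -> s i < s i.+1) ->
      (forall i, (i < n)%N -> measurable (B i)) ->
      P (\bigcap_(i < n) (increment (s i) (s i.+1) @^-1` B i)) =
      (\prod_(i < n) P (increment (s i) (s i.+1) @^-1` B i))%E ;
  levy_stationary_increments :
    forall (s t : R) (B : set (Rvec R d)), 0 <= s -> 0 <= t -> measurable B ->
      P (increment s (s + t) @^-1` B) = P (Y t @^-1` B) ;
  levy_stochastic_continuity :
    forall (t e : R), 0 <= t -> 0 < e ->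
      P [set w | e < enorm (increment t s w)]
        @[s --> within [set s | 0 <= s] (nbhs t)] --> 0%E ;
  levy_cadlag : {ae P, forall w,
    (forall t : R, 0 <= t ->
       (Y s w : 'rV[R]_d) @[s --> t^'+] --> (Y t w : 'rV[R]_d)) /\
    (forall t : R, 0 < t -> cvg ((Y s w : 'rV[R]_d) @[s --> t^'-]))} }.

Variables (A : 'M[R]_d) (N : {measure set (Rvec R d) -> \bar R}) (b : 'rV[R]_d).

Definition generating_triplet : Prop :=
  levy_triplet A N /\
  forall (t : R) (x : 'rV[R]_d), 0 <= t ->
    cintegral P (fun w => cexp ('i%C * (dotv x (Y t w))%:C)) =
    cexp (- (t%:C * Psi A N b x)).

(* [p] is a density of the law of [Y t]; it is the one given by Fourier
   inversion (hence continuous) when e^{-t Psi} is integrable. *)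
Definition is_density (t : R) (p : 'rV[R]_d -> R) : Prop :=
  [/\ measurable_fun setT (p : Rvec R d -> R),
      forall x, 0 <= p x,
      forall B : set (Rvec R d), measurable B ->
        P (Y t @^-1` B) = (\int[lebesgue_vec]_(x in B) (p x)%:E)%E &
      cintegrable lebesgue_vec
          (fun z => cexp (- (t%:C * Psi A N b z))) ->
      forall x, (p x)%:C = ((2 * pi) ^- d)%:C *
        cintegral lebesgue_vec
          (fun z => cexp (- ('i%C * (dotv x z)%:C))
                    * cexp (- (t%:C * Psi A N b z)))].

Definition is_transition_density (p : R -> 'rV[R]_d -> R) : Prop :=
  forall t, 0 < t -> is_density t (p t).

Local Notation scale t := (levy_h_inv A N (t^-1)).

Definition cond_C1 : Prop :=
  exists2 p, is_transition_density p &
  exists (T1 : \bar R) (c1 : R), [/\ (0 < T1)%E, 0 < c1 &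
    forall t : R, 0 < t -> (t%:E < T1)%E ->
      (ereal_sup [set (p t x)%:E | x in setT] <= (c1 * scale t ^- d)%:E)%E].

Definition cond_C2 : Prop :=
  exists (T2 : \bar R) (c2 : R), [/\ (0 < T2)%E, 0 < c2 &
    forall t : R, 0 < t -> (t%:E < T2)%E ->
      (\int[lebesgue_vec]_(z in [set: Rvec R d])
         (expR (- t * complex.Re (Psi A N b z)))%:E
       <= (c2 * scale t ^- d)%:E)%E].

Definition cond_C3_with (T3 : \bar R) (c3 alpha3 : R) : Prop :=
  [/\ (0 < T3)%E, 0 < c3 <= 1, 0 < alpha3 <= 2,
      forall x : 'rV[R]_d, (T3^-1 < (enorm x)%:E)%E ->
        c3 * Psi_star A N b (enorm x) <= complex.Re (Psi A N b x) &
      forall lambda r : R, 1 <= lambda -> (T3^-1 < r%:E)%E ->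
        c3 * lambda `^ alpha3 * Psi_star A N b r
          <= Psi_star A N b (lambda * r)].

Definition cond_C3 : Prop :=
  exists (T3 : \bar R) (c3 alpha3 : R), cond_C3_with T3 c3 alpha3.

Definition cond_C4 : Prop :=
  exists (T4 : \bar R) (c4 : R), [/\ (0 < T4)%E, 1 <= c4 &
    forall x : 'rV[R]_d, (T4^-1 < (enorm x)%:E)%E ->
      Psi_star A N b (enorm x) <=
      c4 * (dotv x (matvec A x)
            + \int[N]_(z in [set z | `|dotv x z| < 1]) (`|dotv x z| ^+ 2))].

Definition cond_CIm_with (T : \bar R) (c : R) : Prop :=
  exists2 p, is_transition_density p &
  [/\ (0 < T)%E, 1 <= c &
    forall t : R, 0 < t -> (t%:E < T)%E ->
      exists2 xt : 'rV[R]_d, enorm xt <= c * scale t &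
      forall y : 'rV[R]_d, enorm y <= c^-1 * scale t ->
        c^-1 * scale t ^- d <= p t (y + xt + t *: drift N b (scale t))].

Definition cond_CIm : Prop :=
  exists (T : \bar R) (c : R), cond_CIm_with T c.

End process.

(* Main.v *)
From HB Require Import structures.
Require Import Defs.
From mathcomp Require Import all_boot all_order all_algebra.
From mathcomp Require Import complex.
From mathcomp Require Import all_classical all_reals all_analysis.
From mathcomp Require Import measurable_realfun.
From mathcomp Require Import ring lra.

(** Write psi = Re Psi and r = h^{-1}(1/t). Averaging 1 - cos(s v) over s with
    weight e^{-|s|} gives 2 v^2/(1 + v^2); applied to the Lévy measure this
    makes h(1/s) and Psi*(s) comparable up to constants depending on d only,
    so (C3) yields psi(z) >= c (r|z|)^alpha / t for |z| >= 1/r and hence the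
    moment bound \int (1 + r|z|) e^{-t psi(z)} dz <= B r^{-d}. Fourier
    inversion then provides a density p(t, .) bounded by B r^{-d} with
    Lipschitz constant at most B r^{-d-1}. The same averaging, applied to the
    law of Y_t, shows that Y_t lies in the box of half-side M r around t
    b_{Mr} with probability at least 1/2 as soon as t h(M r) is small, which
    (C3) ensures for some M. Therefore p(t, .) exceeds a multiple of r^{-d} at
    some point of this box and, by the Lipschitz bound, on a ball of radius
    comparable to r; moreover t |b_{Mr} - b_r| is at most of order r.

    In the other direction, |E e^{i<z, Y_t>}|^2 is the characteristic function
    of a symmetrization, so that a bounded density bounds \int e^{-2 t psi},
    and a bound r^{-d} on \int e^{-k t psi} forces (C3): if psi(x) were much
    smaller than Psi*(|x|), or if Psi* did not double between s and l s, then
    e^{-k t psi} would be bounded below on a set of too large a volume. *)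

Set Implicit Arguments.
Unset Strict Implicit.
Unset Printing Implicit Defensive.

Import Order.TTheory GRing.Theory Num.Theory.
Import numFieldNormedType.Exports.

Local Open Scope classical_set_scope.
Local Open Scope ring_scope.

(** The weight e^{-|s|} is chosen because its cosine transform is rational, a multiple of the Cauchy
    kernel, with an explicit antiderivative. The same computation damps the inversion integral and
    makes its approximations nonnegative, turns averages of Re Psi along a ray into truncated second
    moments of the jumps, and turns characteristic functions into tail bounds.

    The order of the quantifiers shapes the constants: they have to be fixed before the process, the
    triplet and T3, hence the closed formulas in d, c3 and alpha3. A density is required at every t
    > 0 while (C3) controls small times only; the gap closes because e^{-t Re Psi} decreases in t.
    For finite T3 and a prescribed T, (C3) itself is propagated to larger scales.

    (C4) concerns the one-dimensional jumps <x, z> rather than a supremum over directions. It is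
    linked to (C3) through the moment of <x, z> truncated at 1, which under x -> lam x grows only by
    the jumps that are not yet truncated. *)

Notation rintegrable mu f := (mu.-integrable setT (EFin \o f)).

(** * Real-valued integrals and elementary kernels *)

Section real_integrals.
Context {dsp} {T : measurableType dsp} {R : realType}.
Variable mu : {measure set T -> \bar R}.
Implicit Types f g : T -> R.

Lemma rintegrable_measurable f : rintegrable mu f -> measurable_fun setT f.
Proof. by move=> /(measurable_int mu)/measurable_EFinP. Qed.

Lemma le_rintegrable f g : measurable_fun setT f ->
  (forall x, `|f x| <= g x) -> rintegrable mu g -> rintegrable mu f.
Proof.
move=> mf fg; apply: le_integrable => //; first exact/measurable_EFinP.
by move=> x _ /=; rewrite lee_fin (le_trans (fg x))// ler_norm.
Qed.

Lemma ge0_rintegrable f : measurable_fun setT f -> (forall x, 0 <= f x) ->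
  (\int[mu]_x (f x)%:E < +oo)%E -> rintegrable mu f.
Proof.
move=> mf f0 fy; apply/integrableP; split; first exact/measurable_EFinP.
by under eq_integral do rewrite gee0_abs ?lee_fin//.
Qed.

Lemma EFin_Rintegral f : rintegrable mu f ->
  (\int[mu]_x f x)%:E = (\int[mu]_x (f x)%:E)%E.
Proof. by move=> fi; rewrite fineK//; exact: (integrable_fin_num _ fi). Qed.

Lemma rintegrableD f g : rintegrable mu f -> rintegrable mu g ->
  rintegrable mu (fun x => f x + g x).
Proof.
by move=> fi gi; apply: eq_integrable (integrableD _ fi gi).
Qed.

Lemma rintegrableB f g : rintegrable mu f -> rintegrable mu g ->
  rintegrable mu (fun x => f x - g x).
Proof.
by move=> fi gi; apply: eq_integrable (integrableB _ fi gi).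
Qed.

Lemma rintegrableZ k f : rintegrable mu f -> rintegrable mu (fun x => k * f x).
Proof.
by move=> fi; apply: eq_integrable (integrableZl _ _ fi).
Qed.

Lemma dominated_Rintegral (f_ : nat -> T -> R) f g :
  (forall n, measurable_fun setT (f_ n)) ->
  (forall x, f_ n x @[n --> \oo] --> f x) ->
  (forall n x, `|f_ n x| <= g x) -> rintegrable mu g ->
  \int[mu]_x f_ n x @[n --> \oo] --> \int[mu]_x f x.
Proof.
move=> mf_ f_f f_g gi.
have mf : measurable_fun setT f by apply: measurable_fun_cvg => // x _; exact: f_f.
have [||||fi _ H] := @dominated_convergence _ _ _ mu setT measurableT
   (fun n => EFin \o f_ n) (EFin \o f) (EFin \o g) _ _ _ gi _.
- by move=> n; exact/measurable_EFinP.
- exact/measurable_EFinP.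
- apply: aeW => x _; apply: cvg_EFin; [exact: nearW|exact: f_f].
- by apply: aeW => x n _ /=; rewrite lee_fin.
apply: fine_cvg.
by rewrite EFin_Rintegral//; exact: H.
Qed.

End real_integrals.

(** * Fubini's theorem for integrands dominated by a product *)

Section real_fubini.
Context {d1 d2} {T1 : measurableType d1} {T2 : measurableType d2} {R : realType}.
Variables (m1 : {sigma_finite_measure set T1 -> \bar R})
          (m2 : {sigma_finite_measure set T2 -> \bar R}).
Variables (f : T1 * T2 -> R) (g : T1 -> R) (k : T2 -> R).
Hypotheses (mf : measurable_fun setT f) (ig : rintegrable m1 g)
           (ik : rintegrable m2 k).
Hypothesis fgk : forall x y, `|f (x, y)| <= g x * k y.

Let g0 x : 0 <= `|g x|. Proof. by []. Qed.

Lemma dominated_rintegrable1 x : rintegrable m2 (fun y => f (x, y)).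
Proof.
apply: (le_rintegrable (g := fun y => g x * k y)).
- exact: measurableT_comp mf (measurable_pair1 _).
- by move=> y; exact: fgk.
- exact: rintegrableZ.
Qed.

Lemma dominated_rintegrable2 y : rintegrable m1 (fun x => f (x, y)).
Proof.
apply: (le_rintegrable (g := fun x => k y * g x)).
- exact: measurableT_comp mf (measurable_pair2 _).
- by move=> x; rewrite mulrC; exact: fgk.
- exact: rintegrableZ.
Qed.

Lemma dominated_integrable_prod : (m1 \x m2)%E.-integrable setT (EFin \o f).
Proof.
apply/integrable12ltyP; first exact/measurable_EFinP.
apply: (@le_lt_trans _ _ (\int[m1]_x ((`|g x|)%:E * \int[m2]_y (`|k y|)%:E))%E).
  apply: ge0_le_integral => //.
  - by move=> x _; exact: integral_ge0.
  - apply: (measurable_fun_fubini_tonelli_F (fun z => `|(f z)%:E|%E)) => //.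
    by apply: measurableT_comp => //; exact/measurable_EFinP.
  - apply: emeasurable_funM => //.
    apply/measurable_EFinP; apply: measurableT_comp => //.
    exact: rintegrable_measurable ig.
  - move=> x _; rewrite -ge0_integralZl//; last first.
      by apply/measurable_EFinP; apply: measurableT_comp => //; exact: rintegrable_measurable ik.
    apply: ge0_le_integral => //.
    + by apply: measurableT_comp => //; apply/measurable_EFinP; exact: measurableT_comp mf (measurable_pair1 _).
    + apply/measurable_EFinP; apply: measurable_funM => //.
      by apply: measurableT_comp => //; exact: rintegrable_measurable ik.
    + by move=> y _ /=; rewrite lee_fin (le_trans (fgk _ _))// -normrM ler_norm.
rewrite ge0_integralZr//.
- apply: lte_mul_pinfty.
  + exact: integral_ge0.
  + by rewrite ge0_fin_numE ?integral_ge0//; case/integrableP: ig.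
  + by case/integrableP: ik.
- by apply/measurable_EFinP; apply: measurableT_comp => //; exact: rintegrable_measurable ig.
- exact: integral_ge0.
Qed.

Let inner1 x : (\int[m2]_y f (x, y))%:E = (\int[m2]_y (f (x, y))%:E)%E.
Proof. by rewrite EFin_Rintegral//; exact: dominated_rintegrable1. Qed.

Let inner2 y : (\int[m1]_x f (x, y))%:E = (\int[m1]_x (f (x, y))%:E)%E.
Proof. by rewrite EFin_Rintegral//; exact: dominated_rintegrable2. Qed.

Lemma rintegrable_inner1 : rintegrable m1 (fun x => \int[m2]_y f (x, y)).
Proof.
apply: eq_integrable (integrable_fubini_F dominated_integrable_prod) => //.
by move=> x _ /=; rewrite inner1.
Qed.

Lemma rintegrable_inner2 : rintegrable m2 (fun y => \int[m1]_x f (x, y)).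
Proof.
have : rintegrable m2 (fun y => k y * \int[m1]_x g x).
  by under eq_fun do rewrite mulrC; exact: rintegrableZ.
apply: le_rintegrable.
  apply/measurable_EFinP; apply: eq_measurable_fun (measurable_fubini_G dominated_integrable_prod).
  by move=> y _ /=; rewrite inner2.
move=> y; have fi := dominated_rintegrable2 y.
apply: le_trans (le_normr_Rintegral _ fi) _ => //.
rewrite -RintegralZl//; apply: le_Rintegral => //.
- exact: integrable_norm.
- exact: rintegrableZ.
- by move=> x _; rewrite mulrC.
Qed.

Lemma Rfubini1 :
  \int[m1]_x \int[m2]_y f (x, y) = fine (\int[(m1 \x m2)%E]_z (f z)%:E)%E.
Proof.
congr fine; rewrite -(integral12_prod_meas1 dominated_integrable_prod).
by apply: eq_integral => x _; rewrite inner1.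
Qed.

Lemma Rfubini2 :
  \int[m2]_y \int[m1]_x f (x, y) = fine (\int[(m1 \x m2)%E]_z (f z)%:E)%E.
Proof.
congr fine; rewrite -(integral21_prod_meas1 dominated_integrable_prod).
by apply: eq_integral => x _; rewrite inner2.
Qed.

Lemma Rfubini :
  \int[m1]_x \int[m2]_y f (x, y) = \int[m2]_y \int[m1]_x f (x, y).
Proof. by rewrite Rfubini1 Rfubini2. Qed.

End real_fubini.

(** * Trigonometric inequalities *)

Section trigonometric_inequalities.
Context {R : realType}.
Implicit Types u v : R.

Lemma normr_sin_le u : `|sin u| <= `|u|.
Proof.
wlog u0 : u / 0 <= u => [H|].
  have [/H//|/ltW u0] := leP 0 u.
  by rewrite -normrN -sinN -(normrN u); apply: H; rewrite oppr_ge0.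
have [|c _] := @MVT_segment R sin cos 0 u u0 (fun x _ => is_derive_sin x).
  by apply: continuous_subspaceT; exact: continuous_sin.
rewrite sin0 !subr0 => ->.
by rewrite normrM ler_piMl// cos_max.
Qed.

Lemma onemcosE u : 1 - cos u = 2 * sin (u / 2) ^+ 2.
Proof.
have -> : cos u = cos ((u / 2) *+ 2) by congr cos; rewrite -mulr_natr; field.
by rewrite cos_mulr2n cos2sin2; ring.
Qed.

Lemma onemcos_ge0 u : 0 <= 1 - cos u.
Proof. by rewrite subr_ge0 cos_le1. Qed.

Lemma onemcos_le2 u : 1 - cos u <= 2.
Proof. by have := cos_geN1 u; lra. Qed.

Lemma onemcos_le_sqr u : 1 - cos u <= u ^+ 2 / 2.
Proof.
rewrite onemcosE; have := normr_sin_le (u / 2).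
rewrite -(ler_pXn2r (n := 2))// ?nnegrE// !real_normK ?num_real//.
by rewrite !expr2; lra.
Qed.

Lemma onemcos_le_norm u : 1 - cos u <= `|u|.
Proof.
have [u2|/ltW u2] := leP 2 `|u|; first exact: le_trans (onemcos_le2 u) u2.
apply: le_trans (onemcos_le_sqr u) _.
have := normr_ge0 u; rewrite -[u ^+ 2]real_normK ?num_real// => u0.
by rewrite expr2; nra.
Qed.

(** By the mean value theorem sin u - u = (cos c - 1) u with c between 0 and u, and 1 - cos c <=
    |c|. The quadratic order is what a Lévy measure integrates near 0. *)
Lemma normr_sinB_le u : `|sin u - u| <= u ^+ 2.
Proof.
wlog u0 : u / 0 <= u => [H|].
  have [/H//|/ltW u0] := leP 0 u.
  by have := H (- u); rewrite oppr_ge0 => /(_ u0); rewrite sinN sqrrN -opprD normrN.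
have [|c] := @MVT_segment R (fun x => sin x - x) (fun x => cos x - 1) 0 u u0.
  apply: continuous_subspaceT => x; apply: cvgB; last exact: cvg_id.
  exact: continuous_sin.
rewrite in_itv/= => /andP[c0 cu].
rewrite sin0 !subr0 => ->; rewrite normrM expr2 (ger0_norm u0) ler_wpM2r//.
rewrite -normrN opprB ger0_norm ?onemcos_ge0//.
by rewrite (le_trans (onemcos_le_norm c))// ger0_norm.
Qed.

Lemma onemcos_ge_sqr u : `|u| <= 1 -> u ^+ 2 / 8 <= 1 - cos u.
Proof.
move=> u1; rewrite onemcosE.
(* With v = u / 2 and |v| <= 1/2, the bound |sin v - v| <= v^2 gives |sin v| >= |v| - v^2 >= |v| /
   2. *)
suff : `|u / 4| <= `|sin (u / 2)|.
  rewrite -(ler_pXn2r (n := 2))// ?nnegrE// !real_normK ?num_real//.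
  by rewrite !expr2; lra.
have -> : u / 4 = u / 2 / 2 by field.
have : `|u / 2| <= 1 / 2 by rewrite normrM [X in _ * X]ger0_norm// ler_pM2r.
set v := u / 2 => v1.
have : `|v| <= `|sin v| + `|sin v - v|.
  by rewrite -{1}(subKr (sin v) v) (le_trans (ler_normB _ _)).
have := normr_sinB_le v; rewrite -[v ^+ 2]real_normK ?num_real// expr2.
rewrite [`|v / 2|]normrM [`|2^-1|]ger0_norm//.
by have := normr_ge0 v; nra.
Qed.

Lemma normr_sinMn n u : `|sin (n%:R * u)| <= n%:R * `|sin u|.
Proof.
elim: n => [|n ih]; first by rewrite !mul0r sin0 normr0.
rewrite -natr1 mulrDl mul1r sinD mulrDl mul1r (le_trans (ler_normD _ _))//.
rewrite !normrM lerD//.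
  by rewrite (le_trans _ ih)// ler_piMr// cos_max.
by rewrite ler_piMl// cos_max.
Qed.

(** Since 1 - cos u = 2 sin(u/2)^2, this is the square of [normr_sinMn]. Integrated against [N], it
    yields the quadratic growth of Re Psi along integer multiples. *)
Lemma onemcosMn n u : 1 - cos (n%:R * u) <= n%:R ^+ 2 * (1 - cos u).
Proof.
rewrite !onemcosE [leRHS]mulrCA ler_pM2l// -exprMn -mulrA.
rewrite -[leLHS]real_normK ?num_real// -[leRHS]real_normK ?num_real//.
rewrite ler_pXn2r ?nnegrE// (le_trans (normr_sinMn _ _))//.
by rewrite normrM ger0_norm.
Qed.

(** The addition formula for sin and (p + q)^2 <= 2 p^2 + 2 q^2. Integrated against [N], it makes Re
    Psi subadditive up to a factor 2. *)
Lemma onemcosD u v : 1 - cos (u + v) <= 2 * (1 - cos u) + 2 * (1 - cos v).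
Proof.
rewrite !onemcosE (mulrDl u v) sinD.
set a := sin (u / 2); set b := sin (v / 2).
set c := cos (v / 2); set d := cos (u / 2).
have c1 : c ^+ 2 <= 1 by rewrite cos2sin2 gerBl sqr_ge0.
have d1 : d ^+ 2 <= 1 by rewrite cos2sin2 gerBl sqr_ge0.
have : (a * c + d * b) ^+ 2 <= 2 * (a * c) ^+ 2 + 2 * (d * b) ^+ 2.
  by have := sqr_ge0 (a * c - d * b); rewrite !expr2; lra.
rewrite !exprMn.
have : a ^+ 2 * c ^+ 2 <= a ^+ 2 by rewrite ler_piMr// sqr_ge0.
have : d ^+ 2 * b ^+ 2 <= b ^+ 2 by rewrite ler_piMl// sqr_ge0.
lra.
Qed.

(** A chord of the unit circle is no longer than its arc: (cos u - cos v)^2 + (sin u - sin v)^2 = 2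
    (1 - cos (u - v)) <= (u - v)^2. *)
Lemma normr_cosB_le (u v : R) : `|cos u - cos v| <= `|u - v|.
Proof.
rewrite -(@ler_pXn2r _ 2) ?nnegrE// !real_normK ?num_real//.
have := onemcos_le_sqr (u - v); rewrite cosB.
have := cos2Dsin2 u; have := cos2Dsin2 v; have := sqr_ge0 (sin u - sin v); nra.
Qed.

End trigonometric_inequalities.

(** * The weight e^{-e|s|} and its transform, the Cauchy kernel *)

Section laplace_cauchy.
Context {R : realType}.
Local Notation mu := (@lebesgue_measure R).
Implicit Types (e y al s : R).

Lemma ge0_integral_fold (f : R -> R) : (forall x, 0 <= f x) -> continuous f ->
  (\int[mu]_x (f x)%:E = \int[mu]_(x in `[0%R, +oo[) (f x + f (- x))%:E)%E.
Proof.
move=> f0 cf.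
have mf : measurable_fun [set: R] f by exact: continuous_measurable_fun.
have mfN : measurable_fun [set: R] (fun x => f (- x)).
  by apply: measurableT_comp mf _; exact: oppr_measurable.
rewrite -(setUv `[0, +oo[%classic) ge0_integral_setU//=; last 4 first.
- exact: measurableC.
- by apply/measurable_EFinP; rewrite setUv.
- by move=> x _; rewrite lee_fin.
- exact/disj_setPCl.
under [RHS]eq_integral do rewrite EFinD.
rewrite ge0_integralD//; last 4 first.
- by move=> x _; rewrite lee_fin.
- exact/measurable_EFinP/measurable_funTS.
- by move=> x _; rewrite lee_fin.
- exact/measurable_EFinP/measurable_funTS.
congr (_ + _)%E; rewrite setCitvr.
rewrite integral_itv_bndo_bndc; last exact/measurable_EFinP/measurable_funTS.
rewrite -{1}oppr0 ge0_integration_by_substitutionNy//.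
exact: continuous_subspaceT.
Qed.

(** An antiderivative in s of the integrand of [laplace_cos_raw] folded onto the half-line, where
    the sin al contributions of s and -s cancel. *)
Let F e y al s : R := - 2 * expR (- (e * s)) / e
  + 2 * cos al * expR (- (e * s)) * (y * sin (y * s) - e * cos (y * s)) / (e ^+ 2 + y ^+ 2).

Let F_derive e y al s : 0 < e -> is_derive s 1 (F e y al)
  (expR (- (e * s)) * (2 + 2 * cos al * cos (y * s))).
Proof.
move=> e0; rewrite /F.
apply: is_derive_eq.
rewrite /GRing.scale /=.
have ne : e != 0 by rewrite gt_eqF.
have n2 : e ^+ 2 + y ^+ 2 != 0.
  by rewrite gt_eqF// ltr_wpDr ?sqr_ge0// exprn_gt0.
field.
by rewrite ne n2.
Qed.

Let F_cvg e y al : 0 < e -> F e y al s @[s --> +oo] --> 0.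
Proof.
move=> e0.
have e2 : 0 < e ^+ 2 + y ^+ 2 by rewrite ltr_wpDr ?sqr_ge0// exprn_gt0.
pose C := 2 / e + 2 * (`|y| + e) / (e ^+ 2 + y ^+ 2).
have eoo : e * s @[s --> +oo] --> +oo%R.
  by apply: gt0_cvgMry => //; exact: cvg_id.
have Ec : C * expR (- (e * s)) @[s --> +oo] --> 0.
  rewrite -(mulr0 C); apply: cvgM; first exact: cvg_cst.
  exact: (cvg_comp _ _ eoo (@cvgr_expR R)).
apply/norm_cvg0P; apply: (squeeze_cvgr _ (cvg_cst 0) Ec).
apply: nearW => s; rewrite normr_ge0/=.
rewrite /F (le_trans (ler_normD _ _))// /C [leRHS]mulrDl lerD//.
  rewrite !normrM normrN [`|2|]ger0_norm// [`|e^-1|]ger0_norm ?invr_ge0 ?(ltW e0)//.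
  by rewrite [`|expR _|]ger0_norm ?expR_ge0// mulrAC.
rewrite !normrM [`|2|]ger0_norm// [`|expR _|]ger0_norm ?expR_ge0//.
rewrite [`|_^-1|]ger0_norm ?invr_ge0 ?(ltW e2)//.
have c1 := cos_max al.
have : `|y * sin (y * s) - e * cos (y * s)| <= `|y| + e.
  rewrite (le_trans (ler_normB _ _))// !normrM lerD//.
    by rewrite ler_piMr// sin_max.
  by rewrite (ger0_norm (ltW e0)) ler_piMr ?(ltW e0)// cos_max.
move: (normr_ge0 (y * sin (y * s) - e * cos (y * s))); set N := `| _ - _ | => N0 Nle.
have cN : `|cos al| * N <= `|y| + e by rewrite (le_trans _ Nle)// ler_piMl.
have p0 : 0 <= 2 * expR (- (e * s)) / (e ^+ 2 + y ^+ 2).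
  by rewrite !mulr_ge0 ?expR_ge0// invr_ge0 ltW.
by have := ler_wpM2r p0 cN; lra.
Qed.

(** The added 1 makes the integrand nonnegative, so that the fundamental theorem of calculus on the
    half-line applies before any integrability is known; [Rintegral_laplace_cos] subtracts it
    again. *)
Let laplace_cos_raw e y al : 0 < e ->
  (\int[mu]_s (expR (- (e * `|s|)) * (1 + cos (al + y * s)))%:E
   = (2 / e + cos al * (2 * e / (e ^+ 2 + y ^+ 2)))%:E)%E.
Proof.
move=> e0; rewrite ge0_integral_fold; last 2 first.
- by move=> s; rewrite mulr_ge0 ?expR_ge0//; have := cos_geN1 (al + y * s); lra.
- move=> s; apply: cvgM.
    apply: continuous_comp; last exact: continuous_expR.
    by apply: cvgN; apply: cvgM; [exact: cvg_cst|exact: norm_continuous].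
  apply: cvgD; first exact: cvg_cst.
  apply: continuous_comp; last exact: continuous_cos.
  by apply: cvgD; [exact: cvg_cst|apply: cvgM; [exact: cvg_cst|exact: cvg_id]].
transitivity (\int[mu]_(s in `[0%R, +oo[)
    (expR (- (e * s)) * (2 + 2 * cos al * cos (y * s)))%:E)%E.
  apply: eq_integral => s; rewrite inE/= in_itv/= andbT => s0; congr EFin.
  by rewrite normrN ger0_norm// mulrN cosD cosB; ring.
have cF s : {for s, continuous (F e y al)}.
  apply: differentiable_continuous; apply/derivable1_diffP.
  by have := F_derive y al s e0 => H; exact: ex_derive.
have cf : continuous (fun s => expR (- (e * s)) * (2 + 2 * cos al * cos (y * s))).
  move=> s; apply: cvgM.
    apply: continuous_comp; last exact: continuous_expR.
    by apply: cvgN; apply: cvgM; [exact: cvg_cst|exact: cvg_id].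
  apply: cvgD; first exact: cvg_cst.
  apply: cvgM; first exact: cvg_cst.
  apply: continuous_comp; last exact: continuous_cos.
  by apply: cvgM; [exact: cvg_cst|exact: cvg_id].
rewrite (@ge0_continuous_FTC2y _ _ (F e y al) 0 0).
- have n2 : e ^+ 2 + y ^+ 2 != 0.
    by rewrite gt_eqF// ltr_wpDr ?sqr_ge0// exprn_gt0.
  congr EFin; rewrite /F !mulr0 oppr0 expR0 sin0 cos0; field.
  by rewrite ?n2 ?(gt_eqF e0).
- move=> s _; apply: mulr_ge0; first exact: expR_ge0.
  have : `|cos al * cos (y * s)| <= 1.
    by rewrite normrM mulr_ile1// cos_max.
  by rewrite ler_norml => /andP[]; lra.
- exact: continuous_subspaceT.
- exact: F_cvg.
- by move=> s _; have H := F_derive y al s e0; exact: ex_derive.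
- exact/cvg_at_right_filter/cF.
- by move=> s _; rewrite derive1E; have H := F_derive y al s e0; rewrite derive_val.
Qed.

Lemma measurable_cos : measurable_fun setT (@cos R).
Proof. by apply: continuous_measurable_fun; exact: continuous_cos. Qed.

Lemma measurable_sin : measurable_fun setT (@sin R).
Proof. by apply: continuous_measurable_fun; exact: continuous_sin. Qed.

Lemma measurable_laplace e : measurable_fun [set: R] (fun s => expR (- (e * `|s|))).
Proof.
apply: measurableT_comp => //; apply: measurable_funN.
by apply: measurable_funM => //; exact: normr_measurable.
Qed.

Let integral_laplace e : 0 < e ->
  (\int[mu]_s (expR (- (e * `|s|)))%:E = (2 / e)%:E)%E.
Proof.
(* With y = 0 and phase pi / 2 the cosine vanishes identically and only the weight is left. *)
move=> e0; have := laplace_cos_raw 0 (pi / 2) e0.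
rewrite cos_pihalf mul0r addr0 => <-; apply: eq_integral => s _.
by rewrite mul0r addr0 cos_pihalf addr0 mulr1.
Qed.

Lemma rintegrable_laplace e : 0 < e ->
  rintegrable mu (fun s => expR (- (e * `|s|))).
Proof.
move=> e0; apply: ge0_rintegrable.
- exact: measurable_laplace.
- by move=> s; exact: expR_ge0.
- by rewrite integral_laplace// ltry.
Qed.

Lemma Rintegral_laplace e : 0 < e -> \int[mu]_s expR (- (e * `|s|)) = 2 / e.
Proof. by move=> e0; rewrite /Rintegral integral_laplace. Qed.

Lemma measurable_cos_affine al y :
  measurable_fun [set: R] (fun s => cos (al + y * s)).
Proof.
apply: measurableT_comp; first exact: measurable_cos.
by apply: measurable_funD => //; exact: measurable_funM.
Qed.

Lemma rintegrable_laplace_cos e y al : 0 < e ->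
  rintegrable mu (fun s => expR (- (e * `|s|)) * cos (al + y * s)).
Proof.
move=> e0; apply: le_rintegrable (rintegrable_laplace e0).
  by apply: measurable_funM; [exact: measurable_laplace|exact: measurable_cos_affine].
by move=> s; rewrite normrM ger0_norm ?expR_ge0// ler_piMr ?expR_ge0// cos_max.
Qed.

Lemma Rintegral_laplace_cos e y al : 0 < e ->
  \int[mu]_s (expR (- (e * `|s|)) * cos (al + y * s))
  = cos al * (2 * e / (e ^+ 2 + y ^+ 2)).
Proof.
move=> e0; have H := laplace_cos_raw y al e0.
have := RintegralD measurableT (rintegrable_laplace e0) (rintegrable_laplace_cos y al e0).
rewrite Rintegral_laplace// {1}/Rintegral.
have -> : (\int[mu]_s (expR (- (e * `|s|)) + expR (- (e * `|s|)) * cos (al + y * s))%:E)%E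
  = (\int[mu]_s (expR (- (e * `|s|)) * (1 + cos (al + y * s)))%:E)%E.
  by apply: eq_integral => s _; rewrite mulrDr mulr1.
by rewrite H/= => /addrI <-.
Qed.

(** The square is the growth of Re Psi along a ray, see [re_psiZ]. From e^x >= 1 + x^2 / 2 at x =
    |s| / 2; spending half of the exponential on it leaves 16 * 2 / (1/2) = 64 in
    [Rintegral_laplace_sqr]. *)
Lemma sqr_onepnorm_le s : (1 + `|s|) ^+ 2 <= 16 * expR (1 / 2 * `|s|).
Proof.
have := expR_ge1Dxn 1 (x := 1 / 2 * `|s|).
rewrite mulr_ge0// => /(_ isT).
have -> : 2`!%:R = 2 :> R by [].
by have := sqr_ge0 (`|s| - 1); rewrite !expr2; lra.
Qed.

Lemma rintegrable_laplace_sqr :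
  rintegrable mu (fun s => (1 + `|s|) ^+ 2 * expR (- (1 * `|s|))).
Proof.
have /(rintegrableZ 16) : rintegrable mu (fun s => expR (- ((1/2) * `|s|))).
  exact: rintegrable_laplace.
apply: le_rintegrable.
  apply: measurable_funM; last exact: measurable_laplace.
  by apply: measurable_funX; apply: measurable_funD => //; exact: normr_measurable.
move=> s; rewrite ger0_norm ?mulr_ge0 ?sqr_ge0 ?expR_ge0//.
rewrite (_ : - (1 / 2 * `|s|) = 1 / 2 * `|s| + - (1 * `|s|)); last by field.
by rewrite expRD mulrA ler_wpM2r ?expR_ge0 ?sqr_onepnorm_le.
Qed.

Lemma Rintegral_laplace_sqr :
  \int[mu]_s ((1 + `|s|) ^+ 2 * expR (- (1 * `|s|))) <= 64.
Proof.
have H : rintegrable mu (fun s => expR (- ((1/2) * `|s|))) by exact: rintegrable_laplace.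
apply: (@le_trans _ _ (\int[mu]_s (16 * expR (- ((1/2) * `|s|))))).
  apply: le_Rintegral => //; [exact: rintegrable_laplace_sqr|exact: rintegrableZ|].
  move=> s _.
  rewrite (_ : - (1 / 2 * `|s|) = 1 / 2 * `|s| + - (1 * `|s|)); last by field.
  by rewrite expRD mulrA ler_wpM2r ?expR_ge0 ?sqr_onepnorm_le.
by rewrite RintegralZl// Rintegral_laplace//; lra.
Qed.

Definition cauchy e x : R := e / (e ^+ 2 + x ^+ 2) / pi.

Lemma cauchy_ge0 e x : 0 < e -> 0 <= cauchy e x.
Proof.
by move=> e0; rewrite !mulr_ge0 ?invr_ge0 ?pi_ge0 ?(ltW e0)// addr_ge0 ?sqr_ge0.
Qed.

Lemma continuous_cauchyB e c : 0 < e -> continuous (fun s => cauchy e (s - c)).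
Proof.
move=> e0 s; apply: cvgM; last exact: cvg_cst.
apply: cvgM; first exact: cvg_cst.
apply: cvgV; first by rewrite gt_eqF// ltr_wpDr ?sqr_ge0// exprn_gt0.
apply: cvgD; first exact: cvg_cst.
by apply: cvgM; apply: cvgB; [exact: cvg_id|exact: cvg_cst|exact: cvg_id|exact: cvg_cst].
Qed.

Lemma measurable_cauchyB e c : 0 < e -> measurable_fun [set: R] (fun s => cauchy e (s - c)).
Proof. by move=> e0; apply: continuous_measurable_fun; exact: continuous_cauchyB. Qed.

Lemma is_derive_atan_scaled e c s : 0 < e ->
  is_derive s 1 (fun s => atan ((s - c) / e) / pi) (cauchy e (s - c)).
Proof.
move=> e0; have p0 := pi_gt0 R.
have n2 : e ^+ 2 + (s - c) ^+ 2 != 0.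
  by rewrite gt_eqF// ltr_wpDr ?sqr_ge0// exprn_gt0.
have n3 : 1 + ((s - c) / e) ^+ 2 != 0 by rewrite gt_eqF// ltr_wpDr ?sqr_ge0.
apply: is_derive_eq; rewrite /GRing.scale /= /cauchy.
move: p0; generalize (pi : R) => p p0; field.
by rewrite n2 !gt_eqF//= ltr_wpDr ?sqr_ge0// exprn_gt0.
Qed.

Lemma continuous_atan_scaled e c : 0 < e ->
  continuous (fun s : R => atan ((s - c) / e) / pi).
Proof.
move=> e0 s; apply: differentiable_continuous; apply/derivable1_diffP.
by have H := is_derive_atan_scaled c s e0; exact: ex_derive.
Qed.

Lemma integral_cauchy_itv e c a b : 0 < e -> a < b ->
  (\int[mu]_(s in `[a, b]) (cauchy e (s - c))%:E
   = (atan ((b - c) / e) / pi - atan ((a - c) / e) / pi)%:E)%E.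
Proof.
move=> e0 ab.
rewrite (@continuous_FTC2 _ _ (fun s => atan ((s - c) / e) / pi))//.
- by apply: continuous_subspaceT; exact: continuous_cauchyB.
- split.
  + by move=> s _; have H := is_derive_atan_scaled c s e0; exact: ex_derive.
  + exact/cvg_at_right_filter/continuous_atan_scaled.
  + exact/cvg_at_left_filter/continuous_atan_scaled.
- by move=> s _; rewrite derive1E; have H := is_derive_atan_scaled c s e0; rewrite derive_val.
Qed.

Lemma integral_cauchyB e c : 0 < e ->
  (\int[mu]_s (cauchy e (s - c))%:E = 1)%E.
Proof.
move=> e0; rewrite ge0_integral_fold; last 2 first.
- by move=> s; exact: cauchy_ge0.
- exact: continuous_cauchyB.
have cN s : cauchy e (- s - c) = cauchy e (s - - c).
  by rewrite /cauchy; congr (_ / (_ + _) / _); ring.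
under eq_integral do rewrite cN.
have ey k : (s - k) / e @[s --> +oo] --> +oo%R.
  apply: gt0_cvgMly; first by rewrite invr_gt0.
  by apply: cvg_addrr.
rewrite (@ge0_continuous_FTC2y _ _
  (fun s => atan ((s - c) / e) / pi + atan ((s - - c) / e) / pi) 0 1).
- by rewrite !sub0r opprK mulNr atanN mulNr addNr sube0.
- by move=> s _; rewrite addr_ge0// cauchy_ge0.
- by apply: continuous_subspaceT => s; apply: cvgD; exact: continuous_cauchyB.
- have -> : 1 = pi / 2 / pi + pi / 2 / pi :> R.
    by move: (pi_gt0 R); generalize (pi : R) => p p0; field; rewrite gt_eqF.
  by apply: cvgD; apply: cvgM; [exact: (cvg_comp _ _ (ey c) (@cvgy_atan R))|exact: cvg_cst|exact: (cvg_comp _ _ (ey (- c)) (@cvgy_atan R))|exact: cvg_cst].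
- move=> s _; have H1 := is_derive_atan_scaled c s e0.
  have H2 := is_derive_atan_scaled (- c) s e0.
  exact: ex_derive.
- by apply: cvg_at_right_filter; apply: cvgD; exact: continuous_atan_scaled.
- move=> s _; rewrite derive1E; have H1 := is_derive_atan_scaled c s e0.
  by have H2 := is_derive_atan_scaled (- c) s e0; rewrite derive_val.
Qed.

End laplace_cauchy.

(** * Euclidean structure and Lebesgue measure on R^d *)

Section measurable_Rvec.
Context {R : realType} {d : nat}.
Implicit Types x y : 'rV[R]_d.

Lemma continuous_measurable_Rvec (f : 'rV[R]_d -> R) : continuous f ->
  measurable_fun setT (f : Rvec R d -> R).
Proof.
move=> cf.
apply: (measurability _ (RGenOInfty.measurableE R)) => // _ [_ [x ->] <-].
rewrite setTI; apply: sub_sigma_algebra.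
by move/continuousP : cf; apply; exact: interval_open.
Qed.

Lemma measurable_coord i : measurable_fun setT (fun z : Rvec R d => (z : 'rV[R]_d) 0 i).
Proof.
by apply: (continuous_measurable_Rvec (f := fun z => z 0 i)); exact: coord_continuous.
Qed.

Lemma measurable_dotv x : measurable_fun setT (dotv x : Rvec R d -> R).
Proof.
apply: measurable_sum => i; apply: measurable_funM => //; exact: measurable_coord.
Qed.

Lemma measurable_enorm : measurable_fun setT (@enorm R d : Rvec R d -> R).
Proof.
apply: (measurableT_comp (f := @Num.sqrt R)); last first.
  by apply: measurable_sum => i; apply: measurable_funM; exact: measurable_coord.
by apply: continuous_measurable_fun; exact: sqrt_continuous.
Qed.

End measurable_Rvec.

Section euclidean_theory.
Context {R : realType} {d : nat}.
Implicit Types (x y z : 'rV[R]_d) (a : R).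

Lemma dotvC x y : dotv x y = dotv y x.
Proof. by apply: eq_bigr => i _; rewrite mulrC. Qed.

Lemma dotvDl x y z : dotv (x + y) z = dotv x z + dotv y z.
Proof. by rewrite -big_split; apply: eq_bigr => i _; rewrite mxE mulrDl. Qed.

Lemma dotvZl a x y : dotv (a *: x) y = a * dotv x y.
Proof. by rewrite mulr_sumr; apply: eq_bigr => i _; rewrite mxE mulrA. Qed.

Lemma dotvDr x y z : dotv x (y + z) = dotv x y + dotv x z.
Proof. by rewrite dotvC dotvDl !(dotvC x). Qed.

Lemma dotvZr a x y : dotv x (a *: y) = a * dotv x y.
Proof. by rewrite dotvC dotvZl dotvC. Qed.

Lemma dotvNr x y : dotv x (- y) = - dotv x y.
Proof. by rewrite -scaleN1r dotvZr mulN1r. Qed.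

Lemma dotvBr x y z : dotv x (y - z) = dotv x y - dotv x z.
Proof. by rewrite dotvDr dotvNr. Qed.

Lemma dotv0l x : dotv 0 x = 0.
Proof. by rewrite -(scale0r 0) dotvZl mul0r. Qed.

Lemma dotv_delta i x : dotv (delta_mx 0 i) x = x 0 i.
Proof.
rewrite /dotv (bigD1 i)//= mxE !eqxx mul1r big1 ?addr0// => j ji.
by rewrite mxE eqxx (negbTE ji) mul0r.
Qed.

Lemma dotvv_ge0 x : 0 <= dotv x x.
Proof. by apply: sumr_ge0 => i _; rewrite -expr2 sqr_ge0. Qed.

Lemma enorm_ge0 x : 0 <= enorm x. Proof. exact: sqrtr_ge0. Qed.

Lemma enorm_sqr x : enorm x ^+ 2 = dotv x x.
Proof. by rewrite sqr_sqrtr ?dotvv_ge0. Qed.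

Lemma enormZ a x : enorm (a *: x) = `|a| * enorm x.
Proof.
by rewrite /enorm dotvZl dotvZr mulrA -expr2 sqrtrM ?sqr_ge0// sqrtr_sqr.
Qed.

Lemma coord_le_enorm x i : `|x 0 i| <= enorm x.
Proof.
rewrite -sqrtr_sqr ler_wsqrtr// /dotv (bigD1 i)//= -expr2 lerDl.
by apply: sumr_ge0 => j _; rewrite -expr2 sqr_ge0.
Qed.

Lemma enorm_gt0 x : (0 < enorm x) = (x != 0).
Proof.
rewrite lt_neqAle enorm_ge0 andbT eq_sym; congr (~~ _); apply/eqP/eqP => [x0|->].
  apply/rowP => i; rewrite mxE; apply/eqP; rewrite -normr_le0 -x0.
  exact: coord_le_enorm.
by rewrite /enorm dotv0l sqrtr0.
Qed.

Lemma dotv_le_enorm x y : `|dotv x y| <= enorm x * enorm y.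
Proof.
have [->|x0] := eqVneq x 0; first by rewrite dotv0l normr0 mulr_ge0 ?enorm_ge0.
have xx : 0 < dotv x x by rewrite -enorm_sqr exprn_gt0 ?enorm_gt0.
rewrite -(ler_pXn2r (n := 2))// ?nnegrE// ?mulr_ge0 ?enorm_ge0//.
rewrite real_normK ?num_real// exprMn !enorm_sqr.
(* Cauchy-Schwarz from the squared norm of |x|^2 y - <x, y> x. *)
have := dotvv_ge0 (dotv x x *: y - dotv x y *: x).
have -> : dotv (dotv x x *: y - dotv x y *: x) (dotv x x *: y - dotv x y *: x) =
    dotv x x * (dotv x x * dotv y y - dotv x y ^+ 2).
  by rewrite -scaleNr dotvDl !dotvDr !dotvZl !dotvZr (dotvC y x); ring.
by rewrite pmulr_rge0// subr_ge0.
Qed.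

End euclidean_theory.

Lemma enorm_le_coords (R : realType) d (x : 'rV[R]_d) (a : R) : (forall i, `|x 0 i| <= a) -> enorm x <= d%:R * a.
Proof.
case: d x => [|n] x xa.
  by rewrite mul0r /enorm /dotv big_ord0 sqrtr0.
have a0 : 0 <= a by rewrite (le_trans _ (xa ord0)).
rewrite -(ler_pXn2r (n := 2))// ?nnegrE ?enorm_ge0// ?mulr_ge0//.
rewrite enorm_sqr exprMn (@le_trans _ _ (\sum_(i < n.+1) a ^+ 2))//.
  apply: ler_sum => i _; rewrite -expr2 -real_normK ?num_real//.
  by rewrite ler_pXn2r ?nnegrE.
rewrite sumr_const card_ord -[leLHS]mulr_natl ler_wpM2r ?sqr_ge0//.
by rewrite expr2 ler_peMr// ler1n.
Qed.

(** * Integration over tuples, one coordinate at a time *)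

Section tuple_integrals.
Context {R : realType}.
Local Notation mu := (@lebesgue_measure R).
Local Notation tup n := (n.-tuple (measurableTypeR R)).

Section cons_step.
Variables (n : nat) (f : tup n.+1 -> R) (g : R -> R) (k : tup n -> R).
Hypotheses (mf : measurable_fun setT f) (ig : rintegrable mu g)
  (ik : rintegrable (lebesgue_tuple n) k).
Hypothesis fgk : forall x t, `|f (cons_tup (x, t))| <= g x * k t.

Let mfc : measurable_fun setT (f \o @cons_tup R n).
Proof. exact: measurableT_comp mf (@measurable_cons_tup R n). Qed.

Let ifc : (mu \x lebesgue_tuple n)%E.-integrable setT (EFin \o (f \o @cons_tup R n)).
Proof. exact: dominated_integrable_prod mfc ig ik fgk. Qed.

Lemma rintegrable_cons_tup : rintegrable (lebesgue_tuple n.+1) f.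
Proof.
apply: (integrable_pushforward (measurable_cons_tup (n := n)) (f := EFin \o f)) => //.
exact/measurable_EFinP.
Qed.

Lemma Rintegral_cons_tup : \int[lebesgue_tuple n.+1]_t f t =
  \int[mu]_x \int[lebesgue_tuple n]_t f (cons_tup (x, t)).
Proof.
rewrite (Rfubini1 (f := f \o @cons_tup R n) mfc ig ik fgk).
congr fine.
apply: (integral_pushforward (measurable_cons_tup (n := n)) (f := EFin \o f)) => //.
exact/measurable_EFinP.
Qed.

End cons_step.

Lemma measurable_prod_tnth n (f : 'I_n -> R -> R) :
  (forall i, measurable_fun setT (f i)) ->
  measurable_fun setT (fun t : tup n => \prod_i f i (tnth t i)).
Proof.
move=> mf; apply: measurable_prod => i _.
by apply: (measurableT_comp (mf i)); exact: measurable_tnth.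
Qed.

Lemma prod_cons_tup n (f : 'I_n.+1 -> R -> R) x (t : tup n) :
  \prod_i f i (tnth (cons_tup (x, t)) i) =
  f ord0 x * \prod_i f (lift ord0 i) (tnth t i).
Proof.
rewrite big_ord_recl tnth0; congr (_ * _); apply: eq_bigr => i _.
by rewrite tnthS.
Qed.

Lemma lebesgue_tuple0T : lebesgue_tuple 0 [set: tup 0] = 1%E.
Proof. exact: diracT. Qed.

Lemma Rintegral_cst_tuple0 (k : R) : \int[lebesgue_tuple 0]_t k = k.
Proof.
rewrite Rintegral_cst//; transitivity (k * fine (1%E : \bar R)); last exact: mulr1.
by congr (k * fine _); exact: lebesgue_tuple0T.
Qed.

Lemma rintegrable_prod n (f : 'I_n -> R -> R) :
  (forall i, rintegrable mu (f i)) ->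
  rintegrable (lebesgue_tuple n) (fun t : tup n => \prod_i f i (tnth t i)).
Proof.
elim: n f => [|n ih] f fi.
  under eq_fun do rewrite big_ord0.
  exact: finite_measure_integrable_cst.
apply: (@rintegrable_cons_tup _ _ (fun x => `|f ord0 x|)
  (fun t => `|\prod_i f (lift ord0 i) (tnth t i)|)).
- by apply: measurable_prod_tnth => i; exact: rintegrable_measurable (fi i).
- exact: integrable_norm.
- by apply: integrable_norm => //; apply: (ih (fun i => f (lift ord0 i))) => i; exact: fi.
- by move=> x t; rewrite prod_cons_tup normrM.
Qed.

Lemma Rintegral_prod n (f : 'I_n -> R -> R) :
  (forall i, rintegrable mu (f i)) ->
  \int[lebesgue_tuple n]_t \prod_i f i (tnth t i) = \prod_i \int[mu]_x f i x.
Proof.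
elim: n f => [|n ih] f fi.
  rewrite big_ord0; under eq_Rintegral do rewrite big_ord0.
  exact: Rintegral_cst_tuple0.
rewrite (@Rintegral_cons_tup _ _ (fun x => `|f ord0 x|)
  (fun t => `|\prod_i f (lift ord0 i) (tnth t i)|)); last 4 first.
- by apply: measurable_prod_tnth => i; exact: rintegrable_measurable (fi i).
- exact: integrable_norm.
- apply: integrable_norm => //; exact: (@rintegrable_prod n (fun i => f (lift ord0 i))).
- by move=> x t; rewrite prod_cons_tup normrM.
rewrite big_ord_recl -ih// -RintegralZr//; apply: eq_Rintegral => x _.
rewrite -RintegralZl//; last exact: (@rintegrable_prod n (fun i => f (lift ord0 i))).
by apply: eq_Rintegral => t _; rewrite prod_cons_tup.
Qed.

Definition laplace_weight n (e : R) (t : tup n) : R :=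
  \prod_i expR (- (e * `|tnth t i|)).

Lemma laplace_weight_ge0 n e (t : tup n) : 0 <= laplace_weight e t.
Proof. by apply: prodr_ge0 => i _; exact: expR_ge0. Qed.

Lemma laplace_weight_le1 n e (t : tup n) : 0 <= e -> laplace_weight e t <= 1.
Proof.
move=> e0; have -> : 1 = \prod_(i < n) (1 : R) by rewrite big1.
by apply: ler_prod => i _; rewrite expR_ge0 expR_le1 oppr_le0 mulr_ge0.
Qed.

Lemma measurable_laplace_weight n (e : R) : measurable_fun setT (@laplace_weight n e).
Proof.
by apply: (measurable_prod_tnth (f := fun _ x => expR (- (e * `|x|)))) => i; exact: measurable_laplace.
Qed.

Lemma rintegrable_laplace_weight n (e : R) : 0 < e ->
  rintegrable (lebesgue_tuple n) (@laplace_weight n e).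
Proof.
move=> e0; apply: (rintegrable_prod (f := fun _ x => expR (- (e * `|x|)))) => i.
exact: rintegrable_laplace.
Qed.

Lemma measurable_cos_sum n (y : 'I_n -> R) al :
  measurable_fun setT (fun t : tup n => cos (al + \sum_i y i * tnth t i)).
Proof.
apply: measurableT_comp; first exact: measurable_cos.
apply: measurable_funD => //; apply: measurable_sum => i.
by apply: measurable_funM => //; exact: measurable_tnth.
Qed.

(** The phase [al] is arbitrary so that the induction closes: the contribution of the head
    coordinate is absorbed into the phase of the tail. *)
Lemma Rintegral_laplace_weight_cos n (e : R) (y : 'I_n -> R) al : 0 < e ->
  \int[lebesgue_tuple n]_t (laplace_weight e t * cos (al + \sum_i y i * tnth t i))
  = cos al * \prod_i (2 * e / (e ^+ 2 + y i ^+ 2)).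
Proof.
move=> e0; elim: n y al => [|n ih] y al.
  rewrite big_ord0 mulr1.
  under eq_Rintegral do rewrite /laplace_weight !big_ord0 addr0 mul1r.
  exact: Rintegral_cst_tuple0.
have cE x (t : tup n) : \sum_i y i * tnth (cons_tup (x, t)) i =
    y ord0 * x + \sum_i y (lift ord0 i) * tnth t i.
  rewrite big_ord_recl tnth0; congr (_ + _); apply: eq_bigr => i _.
  by rewrite tnthS.
have wE x (t : tup n) : laplace_weight e (cons_tup (x, t)) = expR (- (e * `|x|)) * laplace_weight e t.
  by rewrite /laplace_weight (prod_cons_tup (fun _ x => expR (- (e * `|x|)))).
rewrite (@Rintegral_cons_tup _ _ (fun x => expR (- (e * `|x|))) (@laplace_weight n e)); last 4 first.
- by apply: measurable_funM; [exact: measurable_laplace_weight|exact: measurable_cos_sum].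
- exact: rintegrable_laplace.
- exact: rintegrable_laplace_weight.
- move=> x t; rewrite normrM wE ger0_norm ?mulr_ge0 ?expR_ge0 ?laplace_weight_ge0//.
  by rewrite ler_piMr ?mulr_ge0 ?expR_ge0 ?laplace_weight_ge0// cos_max.
rewrite big_ord_recl mulrA -Rintegral_laplace_cos// -RintegralZr//; last exact: rintegrable_laplace_cos.
apply: eq_Rintegral => x _; rewrite -mulrA -ih -RintegralZl//; last first.
  apply: le_rintegrable (rintegrable_laplace_weight _ e0).
    by apply: measurable_funM; [exact: measurable_laplace_weight|exact: measurable_cos_sum].
  by move=> t; rewrite normrM ger0_norm ?laplace_weight_ge0// ler_piMr ?laplace_weight_ge0// cos_max.
by apply: eq_Rintegral => t _; rewrite wE cE addrA mulrA.
Qed.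

End tuple_integrals.

(** * Boxes, and measures determined by their values on boxes *)

Section lebesgue_vec_theory.
Context {R : realType} {d : nat}.
Local Notation mu := (@lebesgue_measure R).
Local Notation tup n := (n.-tuple (measurableTypeR R)).
Local Notation lvec := (@lebesgue_vec R d).
Local Notation ltup := (@lebesgue_tuple R d).
Local Notation row := (@row_of_tuple R d).
Implicit Types f : Rvec R d -> R.

Lemma ge0_integral_vec f : measurable_fun setT f -> (forall x, 0 <= f x) ->
  (\int[lvec]_x (f x)%:E = \int[ltup]_t (f (row t))%:E)%E.
Proof.
move=> mf f0.
apply: (ge0_integral_pushforward (measurable_row_of_tuple (d := d)) ltup measurableT (f := EFin \o f)).
  exact/measurable_EFinP.
by move=> x _; rewrite lee_fin.
Qed.

Lemma Rintegral_vec f : measurable_fun setT f -> rintegrable ltup (f \o row) ->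
  \int[lvec]_x f x = \int[ltup]_t f (row t).
Proof.
move=> mf fi; congr fine.
apply: (integral_pushforward (measurable_row_of_tuple (d := d)) (f := EFin \o f)) => //.
exact/measurable_EFinP.
Qed.

Definition box (a b : 'I_d -> R) : set (Rvec R d) :=
  [set x | forall i, a i < (x : 'rV[R]_d) 0 i < b i].

Lemma measurable_box a b : measurable (box a b).
Proof.
rewrite (_ : box a b = \bigcap_(i in [set: 'I_d])
   ((fun x : Rvec R d => (x : 'rV[R]_d) 0 i) @^-1` `]a i, b i[)); last first.
  apply/seteqP; split => [x xab i _|x xab i]; first by rewrite /= in_itv/=; exact: xab.
  by have := xab i I; rewrite /= in_itv.
apply: fin_bigcap_measurable => // i _.
by rewrite -[X in measurable X]setTI; apply: measurable_coord.
Qed.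

Lemma indic_box a b (t : tup d) :
  (\1_(box a b) (row t) : R) = \prod_i \1_(`]a i, b i[%classic) (tnth t i).
Proof.
rewrite indicE; have [tab|tab] := boolP (_ \in _).
  rewrite big1// => i _; rewrite indicE mem_set//=.
  by move: tab; rewrite inE => /(_ i); rewrite mxE in_itv.
apply/esym/eqP; rewrite prodf_seq_eq0; apply/hasP.
apply: contrapT => H; case/negP : tab; rewrite inE => i; rewrite mxE.
have [//|ti] := boolP (a i < tnth t i < b i); exfalso; apply: H.
exists i; first by rewrite mem_index_enum.
by rewrite /= indicE memNset//= in_itv/=; exact/negP.
Qed.

Lemma integral_box_prod (a b : 'I_d -> R) (g : 'I_d -> R -> R) :
  (forall i, measurable_fun setT (g i)) -> (forall i x, 0 <= g i x) ->
  (forall i, rintegrable mu (fun x => \1_(`]a i, b i[%classic) x * g i x)) ->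
  (\int[lvec]_(x in box a b) (\prod_i g i ((x : 'rV[R]_d) 0 i))%:E =
   (\prod_i \int[mu]_x (\1_(`]a i, b i[%classic) x * g i x))%:E)%E.
Proof.
move=> mg g0 ig.
rewrite integral_mkcond.
transitivity (\int[lvec]_x (\1_(box a b) x * \prod_i g i ((x : 'rV[R]_d) 0 i))%:E)%E.
  apply: eq_integral => x _; rewrite /patch indicE.
  by case: ifPn => _; rewrite ?mul1r ?mul0r.
rewrite ge0_integral_vec; last 2 first.
- apply: measurable_funM; first by apply: measurable_indic; exact: measurable_box.
  apply: measurable_prod => i _.
  by apply: (measurableT_comp (mg i)); exact: measurable_coord.
- by move=> x; rewrite mulr_ge0// prodr_ge0.
have E (t : tup d) : \1_(box a b) (row t) * \prod_i g i ((row t : 'rV[R]_d) 0 i) =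
    \prod_i (\1_(`]a i, b i[%classic) (tnth t i) * g i (tnth t i)).
  by rewrite indic_box -big_split; apply: eq_bigr => i _; rewrite mxE.
rewrite -Rintegral_prod// EFin_Rintegral//; last first.
  exact: (rintegrable_prod (f := fun i x => \1_(`]a i, b i[%classic) x * g i x)).
by apply: eq_integral => t _; rewrite E.
Qed.

Lemma lebesgue_vec_box a b : (forall i, a i <= b i) ->
  (lvec (box a b) = (\prod_i (b i - a i))%:E)%E.
Proof.
move=> ab.
have := @integral_box_prod a b (fun _ _ => 1).
have -> : (\int[lvec]_(x in box a b) (\prod_(i < d) 1)%:E = lvec (box a b))%E.
  by under eq_integral do rewrite big1//; rewrite integral_cst ?mul1e//; exact: measurable_box.
move=> ->//; last first.
  move=> i; have := @integrable_indic_itv R (a i) (b i) false true.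
  by apply: eq_integrable => // x _; rewrite /= mulr1.
congr EFin; apply: eq_bigr => i _.
under eq_Rintegral do rewrite mulr1.
rewrite /Rintegral integral_indic// setIT.
transitivity (fine (if ((a i)%:E < (b i)%:E)%E then ((b i)%:E - (a i)%:E)%E else 0%E)).
  by congr fine; exact: (@lebesgue_measure_itv R `]a i, b i[).
rewrite lte_fin.
have := ab i; rewrite le_eqVlt => /predU1P[->|abi]; first by rewrite ltxx subrr.
by rewrite abi.
Qed.

Section density_measure.
Variable f : Rvec R d -> R.
Hypotheses (mf : measurable_fun setT f) (f0 : forall x, 0 <= f x).

(** The proofs of measurability and nonnegativity are arguments, so that a measure structure can be
    attached to the applied term. *)
Definition density_measure of measurable_fun setT f & (forall x, 0 <= f x) :=
  fun B : set (Rvec R d) => (\int[lvec]_(x in B) (f x)%:E)%E.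

Local Notation nu := (density_measure mf f0).

Let nu0 : nu set0 = 0%E. Proof. by rewrite /density_measure integral_set0. Qed.

Let nu_ge0 B : (0 <= nu B)%E.
Proof. by apply: integral_ge0 => x _; rewrite lee_fin. Qed.

Let nu_semi_sigma_additive : semi_sigma_additive nu.
Proof.
apply: semi_sigma_additive_nng_induced; first exact/measurable_EFinP.
by move=> x; rewrite lee_fin.
Qed.

HB.instance Definition _ := isMeasure.Build _ _ _ nu
  nu0 nu_ge0 nu_semi_sigma_additive.

End density_measure.

Definition boxes : set (set (Rvec R d)) := [set B | exists a b, B = box a b].

Lemma setI_closed_boxes : setI_closed boxes.
Proof.
move=> _ _ [a [b ->]] [a' [b' ->]].
exists (fun i => Num.max (a i) (a' i)), (fun i => Num.min (b i) (b' i)).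
apply/seteqP; split => [x [xab xab'] i|x xab].
  have /andP[? ?] := xab i; have /andP[? ?] := xab' i.
  by rewrite gt_max lt_min; apply/andP; split; apply/andP.
by split => i; have := xab i; rewrite gt_max lt_min => /andP[/andP[? ?] /andP[? ?]]; apply/andP.
Qed.

Lemma boxes_cover : \bigcup_k box (fun=> - k%:R) (fun=> k%:R) = setT.
Proof.
apply/seteqP; split => // x _.
have [k xk] : exists k : nat, enorm (x : 'rV[R]_d) < k%:R.
  by exists (Num.truncn (enorm (x : 'rV[R]_d))).+1; exact: truncnS_gt.
exists k => // i; rewrite -ltr_norml.
by rewrite (le_lt_trans (coord_le_enorm _ i)).
Qed.

(** The identity of R^d factors through tuples: coordinates are measurable for the sigma-algebra
    generated by the boxes, and [row_of_tuple] is Borel measurable. *)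
Lemma Rvec_measurable_boxes (B : set (Rvec R d)) :
  measurable B -> <<s boxes >> B.
Proof.
move=> mB; pose BT := g_sigma_algebraType boxes.
pose tuple_of (x : BT) : tup d := [tuple (x : 'rV[R]_d) 0 i | i < d].
have mtuple : measurable_fun setT tuple_of.
  apply/measurable_fun_tnthP => i.
  apply: (measurability _ (RGenOInfty.measurableE R)) => // _ [_ [r ->] <-].
  rewrite setTI.
  (* A half-space x_i > r is a countable union of bounded boxes. *)
  rewrite (_ : _ @^-1` _ = \bigcup_k
      (box (fun j => if j == i then r else - k%:R) (fun=> k%:R) : set BT)); last first.
    apply/seteqP; split => [x|x [k _ /(_ i)]]; rewrite /= tnth_mktuple in_itv/= andbT.
      move=> rx.
      have [k xk] : exists k : nat, enorm (x : 'rV[R]_d) < k%:R.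
        by exists (Num.truncn (enorm (x : 'rV[R]_d))).+1; exact: truncnS_gt.
      exists k => // j.
      have : `|(x : 'rV[R]_d) 0 j| < k%:R by rewrite (le_lt_trans (coord_le_enorm _ j)).
      rewrite ltr_norml => /andP[h1 ->]; rewrite andbT.
      by case: eqP => // ->.
    by rewrite eqxx => /andP[].
  apply: bigcupT_measurable => k; apply: sub_sigma_algebra.
  by do 2 eexists.
have mid : measurable_fun setT (row \o tuple_of).
  by apply: measurableT_comp mtuple; exact: measurable_row_of_tuple.
have := mid measurableT B mB; rewrite setTI.
rewrite (_ : _ @^-1` _ = B)//; apply/seteqP; split => x /=;
  by rewrite (_ : row _ = x)//; apply/rowP => i; rewrite !mxE tnth_mktuple.
Qed.

Lemma measure_unique_boxes (m1 m2 : {measure set (Rvec R d) -> \bar R}) :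
  (forall a b, m1 (box a b) = m2 (box a b)) ->
  (forall a b, m1 (box a b) < +oo)%E ->
  forall B, measurable B -> m1 B = m2 B.
Proof.
move=> m12 m1oo B /Rvec_measurable_boxes.
apply: (g_sigma_algebra_measure_unique boxes _ (fun k => box (fun=> - k%:R) (fun=> k%:R))).
- by move=> _ [a [b ->]]; exact: measurable_box.
- by move=> k; do 2 eexists.
- exact: boxes_cover.
- exact: setI_closed_boxes.
- by move=> _ [a [b ->]].
- by move=> k.
Qed.

End lebesgue_vec_theory.

(** * Fourier inversion for probability laws *)

Section fourier_inversion.
Context {R : realType} {d : nat} {disp : measure_display}.
Context {Omega : measurableType disp} (P : probability Omega R).
Variable X : {RV P >-> Rvec R d}.
Local Notation mu := (@lebesgue_measure R).
Local Notation tup n := (n.-tuple (measurableTypeR R)).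
Local Notation lvec := (@lebesgue_vec R d).
Local Notation ltup := (@lebesgue_tuple R d).
Local Notation row := (@row_of_tuple R d).
Implicit Types (e al : R) (x : Rvec R d) (t : tup d) (w : Omega).

Let Xc i w : R := (X w : 'rV[R]_d) 0 i.

Let measurable_Xc i : measurable_fun setT (Xc i).
Proof. by apply: (measurableT_comp (measurable_coord i)). Qed.

Definition shift_dot x t w : R := dotv ((X w : 'rV[R]_d) - x) (row t).

Lemma shift_dotE x t w : shift_dot x t w = \sum_i (Xc i w - (x : 'rV[R]_d) 0 i) * tnth t i.
Proof. by apply: eq_bigr => i _; rewrite !mxE. Qed.

Lemma measurable_shift_dot x :
  measurable_fun setT (fun wt : Omega * tup d => shift_dot x wt.2 wt.1).
Proof.
under eq_fun do rewrite shift_dotE.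
apply: measurable_sum => i; apply: measurable_funM.
  apply: measurable_funB => //.
  by apply: (measurableT_comp (measurable_Xc i)).
by apply: (measurableT_comp (measurable_tnth i)).
Qed.

(** The real part of E e^{i (al + <t, X - x>)}. The phases 0 and -pi/2 give the real and imaginary
    parts of the characteristic function of X - x, so that complex integrals are avoided until the
    final formula. *)
Definition cosE al x t : R := \int[P]_w cos (al + shift_dot x t w).

Let cst1_integrable : rintegrable P (fun=> 1).
Proof. exact: finite_measure_integrable_cst. Qed.

Let measurable_weighted_cos e al x : measurable_fun setT
  (fun wt : Omega * tup d => laplace_weight e wt.2 * cos (al + shift_dot x wt.2 wt.1)).
Proof.
apply: measurable_funM.
  by apply: (measurableT_comp (measurable_laplace_weight e)).
apply: (measurableT_comp (@measurable_cos R)).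
by apply: measurable_funD => //; exact: measurable_shift_dot.
Qed.

Let weighted_cos_bound e al x w t :
  `|laplace_weight e t * cos (al + shift_dot x t w)| <= 1 * laplace_weight e t.
Proof.
rewrite normrM ger0_norm ?laplace_weight_ge0// mulrC ler_wpM2r ?laplace_weight_ge0//.
exact: cos_max.
Qed.

Lemma rintegrable_cos al x t : rintegrable P (fun w => cos (al + shift_dot x t w)).
Proof.
apply: le_rintegrable cst1_integrable => [|w]; last exact: cos_max.
apply: (measurableT_comp (@measurable_cos R)); apply: measurable_funD => //.
exact: (measurableT_comp (measurable_shift_dot x) (measurable_pair2 t)).
Qed.

Let Rintegral_weighted e al x t :
  \int[P]_w (laplace_weight e t * cos (al + shift_dot x t w)) =
  laplace_weight e t * cosE al x t.
Proof. by rewrite RintegralZl//; exact: rintegrable_cos. Qed.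

Lemma measurable_cosE al x : measurable_fun setT (cosE al x).
Proof.
(* Lebesgue measure is infinite, so Fubini's theorem is applied to the weighted integrand; the
   weight is positive everywhere and is divided out afterwards. *)
have H := rintegrable_measurable (rintegrable_inner2 (measurable_weighted_cos 1 al x)
  cst1_integrable (rintegrable_laplace_weight d ltr01) (weighted_cos_bound 1 al x)).
have w_gt0 t : 0 < laplace_weight 1 t by apply: prodr_gt0 => i _; exact: expR_gt0.
have -> : cosE al x = (fun t => (expR (1 * \sum_i `|tnth t i|)) *
   \int[P]_w (laplace_weight 1 t * cos (al + shift_dot x t w))).
  apply/funext => t; rewrite Rintegral_weighted mulrA.
  rewrite (_ : expR _ * _ = 1) ?mul1r//.
  rewrite /laplace_weight -expR_sum -expRD -big_split/= big1 ?expR0// => i _.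
  by rewrite mul1r subrr.
apply: measurable_funM => //; apply: measurableT_comp => //.
apply: measurable_funM => //; apply: measurable_sum => i.
by apply: measurableT_comp; [exact: normr_measurable|exact: measurable_tnth].
Qed.

Lemma cauchy_le e (u : R) : 0 < e -> cauchy e u <= e^-1 / pi.
Proof.
move=> e0; rewrite ler_wpM2r ?invr_ge0 ?pi_ge0//.
have e2 : 0 < e ^+ 2 by rewrite exprn_gt0.
rewrite ler_pdivrMr ?ltr_wpDr ?sqr_ge0// mulrDr expr2 mulKf ?gt_eqF//.
by rewrite lerDl mulr_ge0 ?sqr_ge0// invr_ge0 ltW.
Qed.

Let measurable_cauchy_diff e : 0 < e -> measurable_fun setT
  (fun xw : Rvec R d * Omega => \prod_i cauchy e (Xc i xw.2 - (xw.1 : 'rV[R]_d) 0 i)).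
Proof.
move=> e0; apply: measurable_prod => i _.
have -> : (fun xw : Rvec R d * Omega => cauchy e (Xc i xw.2 - (xw.1 : 'rV[R]_d) 0 i)) =
  (fun s => cauchy e (s - 0)) \o
  (fun xw : Rvec R d * Omega => Xc i xw.2 - (xw.1 : 'rV[R]_d) 0 i).
  by apply/funext => xw /=; rewrite subr0.
apply: measurableT_comp; first exact: measurable_cauchyB.
apply: measurable_funB.
  by apply: (measurableT_comp (measurable_Xc i)).
by apply: (measurableT_comp (measurable_coord i)).
Qed.

Let prod_cauchy_ge0 e x w : 0 < e ->
  0 <= \prod_i cauchy e (Xc i w - (x : 'rV[R]_d) 0 i).
Proof. by move=> e0; apply: prodr_ge0 => i _; exact: cauchy_ge0. Qed.

Lemma rintegrable_cauchy e x : 0 < e ->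
  rintegrable P (fun w => \prod_i cauchy e (Xc i w - (x : 'rV[R]_d) 0 i)).
Proof.
move=> e0; have := rintegrableZ ((e^-1 / pi) ^+ d) cst1_integrable.
apply: le_rintegrable.
  exact: (measurableT_comp (measurable_cauchy_diff e0) (measurable_pair1 x)).
move=> w; rewrite ger0_norm ?prod_cauchy_ge0// mulr1.
rewrite -[in X in _ <= X](card_ord d) -prodr_const.
by apply: ler_prod => i _; rewrite cauchy_ge0// cauchy_le.
Qed.

(* Damping the inversion integral by e^{-e|t|} amounts to convolving the law
   with a Cauchy law, which makes the truncated integrals nonnegative. *)
Lemma laplace_smoothing e al x : 0 < e ->
  \int[ltup]_t (laplace_weight e t * cosE al x t) =
  (2 * pi) ^+ d * (cos al * \int[P]_w \prod_i cauchy e (Xc i w - (x : 'rV[R]_d) 0 i)).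
Proof.
move=> e0.
under eq_Rintegral do rewrite -Rintegral_weighted.
rewrite -(Rfubini (measurable_weighted_cos e al x) cst1_integrable
  (rintegrable_laplace_weight d e0) (weighted_cos_bound e al x)) /=.
have E w : \int[ltup]_t (laplace_weight e t * cos (al + shift_dot x t w)) =
   (2 * pi) ^+ d * cos al * \prod_i cauchy e (Xc i w - (x : 'rV[R]_d) 0 i).
  under eq_Rintegral do rewrite shift_dotE.
  rewrite Rintegral_laplace_weight_cos// [in RHS]mulrAC mulrC; congr (_ * _).
  rewrite -[in (2 * pi) ^+ d](card_ord d) -prodr_const -big_split/=.
  apply: eq_bigr => i _; rewrite /cauchy.
  have n2 : e ^+ 2 + (Xc i w - x 0 i) ^+ 2 != 0.
    by rewrite gt_eqF// ltr_wpDr ?sqr_ge0// exprn_gt0.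
  move: (pi_gt0 R); generalize (pi : R) => p p0; field.
  by rewrite n2 gt_eqF.
under eq_Rintegral do rewrite E -mulrA.
rewrite RintegralZl ?RintegralZl//; first exact: rintegrable_cauchy.
by apply: rintegrableZ; exact: rintegrable_cauchy.
Qed.

Variable m : tup d -> R.
Hypothesis m_integrable : rintegrable ltup m.
Hypothesis cosE_le : forall al x t, `|cosE al x t| <= m t.

Lemma rintegrable_cosE al x : rintegrable ltup (cosE al x).
Proof. by apply: le_rintegrable m_integrable => //; exact: measurable_cosE. Qed.

Lemma laplace_weightE e t : laplace_weight e t = expR (- (e * \sum_i `|tnth t i|)).
Proof. by rewrite /laplace_weight -expR_sum sumrN mulr_sumr. Qed.

Let eps n : R := n.+1%:R^-1.
Let eps_gt0 n : 0 < eps n. Proof. by rewrite invr_gt0. Qed.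

Lemma cvg_laplace_weight t : laplace_weight (eps n) t @[n --> \oo] --> (1 : R).
Proof.
under eq_fun do rewrite laplace_weightE.
have H0 : eps n * \sum_i `|tnth t i| @[n --> \oo] --> (0 : R).
  have := cvgMr_tmp (b := \sum_i `|tnth t i|) (@cvg_harmonic R).
  by rewrite mul0r; apply.
have H : - (eps n * \sum_i `|tnth t i|) @[n --> \oo] --> - (0 : R) by exact: cvgN H0.
have := cvg_comp _ _ H (@continuous_expR R (- 0)).
by rewrite oppr0 expR0; apply.
Qed.

Lemma cvg_laplace_smoothing al x :
  \int[ltup]_t (laplace_weight (eps n) t * cosE al x t) @[n --> \oo] -->
  \int[ltup]_t cosE al x t.
Proof.
apply: (dominated_Rintegral (g := m)) => //.
- move=> n; apply: measurable_funM; first exact: measurable_laplace_weight.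
  exact: measurable_cosE.
- move=> t; rewrite -[X in _ --> X]mul1r; apply: cvgM; last exact: cvg_cst.
  exact: cvg_laplace_weight.
- move=> n t; rewrite normrM -[leRHS]mul1r ler_pM//.
  by rewrite ger0_norm ?laplace_weight_ge0// laplace_weight_le1// ltW.
Qed.

(** The Fourier inversion formula with its real part only; the imaginary part vanishes by
    [Rintegral_sinE_eq0]. *)
Definition pdens x : R := (2 * pi) ^- d * \int[ltup]_t cosE 0 x t.

Definition approx_pdens n x : R := \int[P]_w \prod_i cauchy (eps n) (Xc i w - (x : 'rV[R]_d) 0 i).

Let twopi_gt0 : 0 < (2 * pi) ^+ d :> R.
Proof. by rewrite exprn_gt0// mulr_gt0// pi_gt0. Qed.

Lemma approx_pdens_cvg x : approx_pdens n x @[n --> \oo] --> pdens x.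
Proof.
have -> : approx_pdens^~ x = (fun n => (2 * pi) ^- d *
    \int[ltup]_t (laplace_weight (eps n) t * cosE 0 x t)).
  apply/funext => n; rewrite laplace_smoothing// cos0 mul1r mulKf//.
  by rewrite gt_eqF.
by apply: cvgMl_tmp; exact: cvg_laplace_smoothing.
Qed.

Lemma approx_pdens_ge0 n x : 0 <= approx_pdens n x.
Proof. by apply: Rintegral_ge0 => w _; exact: prod_cauchy_ge0. Qed.

(** The sign is invisible in the oscillating integral; it is inherited from the damped versions,
    which are expectations of Cauchy densities. *)
Lemma pdens_ge0 x : 0 <= pdens x.
Proof.
apply: (cvgr_to_ge (@approx_pdens_cvg x)); apply: nearW => n.
exact: approx_pdens_ge0.
Qed.

(** Every damped integral carries the factor cos (pi / 2) = 0, so the limit without damping is 0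
    too. *)
Lemma Rintegral_sinE_eq0 x : \int[ltup]_t cosE (- (pi / 2)) x t = 0.
Proof.
have /cvg_lim <-// := @cvg_laplace_smoothing (- (pi / 2)) x.
under eq_fun do rewrite laplace_smoothing// cosN cos_pihalf mul0r mulr0.
exact: lim_cst.
Qed.

Lemma measurable_approx_pdens n : measurable_fun setT (approx_pdens n).
Proof.
apply/measurable_EFinP.
apply: (eq_measurable_fun (fun x => \int[P]_w (\prod_i cauchy (eps n) (Xc i w - (x : 'rV[R]_d) 0 i))%:E)%E).
  by move=> x _ /=; rewrite EFin_Rintegral//; exact: rintegrable_cauchy.
have H := @measurable_fun_fubini_tonelli_F _ _ _ _ _ P
  (fun z : Rvec R d * Omega => (\prod_i cauchy (eps n) (Xc i z.2 - (z.1 : 'rV[R]_d) 0 i))%:E).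
apply: H => [|z]; last by rewrite lee_fin prod_cauchy_ge0.
by apply/measurable_EFinP; exact: measurable_cauchy_diff.
Qed.

Lemma measurable_pdens : measurable_fun setT pdens.
Proof.
by apply: (measurable_fun_cvg measurable_approx_pdens) => x _; exact: approx_pdens_cvg.
Qed.

Lemma pdens_le x : pdens x <= (2 * pi) ^- d * \int[ltup]_t m t.
Proof.
rewrite ler_pM2l ?invr_gt0//; apply: le_Rintegral => //.
  exact: rintegrable_cosE.
by move=> t _; rewrite (le_trans (ler_norm _)).
Qed.

Lemma approx_pdens_le n x : approx_pdens n x <= (2 * pi) ^- d * \int[ltup]_t m t.
Proof.
have := laplace_smoothing 0 x (eps_gt0 n).
rewrite cos0 mul1r => /(congr1 (fun r => (2 * pi) ^- d * r)).
rewrite mulKf ?gt_eqF// -/(approx_pdens n x) => <-.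
rewrite ler_pM2l ?invr_gt0//; apply: le_Rintegral => //.
  apply: le_rintegrable m_integrable.
    apply: measurable_funM; [exact: measurable_laplace_weight|exact: measurable_cosE].
  move=> t; rewrite normrM -[leRHS]mul1r ler_pM//.
  by rewrite ger0_norm ?laplace_weight_ge0// laplace_weight_le1// ltW.
move=> t _; rewrite (le_trans (ler_norm _))// normrM -[leRHS]mul1r ler_pM//.
by rewrite ger0_norm ?laplace_weight_ge0// laplace_weight_le1// ltW.
Qed.

End fourier_inversion.

(** * Cauchy mass of an interval as the scale tends to 0 *)

Section cauchy_interval.
Context {R : realType}.
Local Notation mu := (@lebesgue_measure R).
Implicit Types e a b c : R.

Lemma cauchyN e (x : R) : cauchy e (- x) = cauchy e x.
Proof. by rewrite /cauchy sqrrN. Qed.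

Lemma integral_indic_cauchy e a b c : 0 < e -> a < b ->
  (\int[mu]_x (\1_(`]a, b[%classic) x * cauchy e (c - x))%:E =
  (atan ((b - c) / e) / pi - atan ((a - c) / e) / pi)%:E)%E.
Proof.
move=> e0 ab; rewrite -integral_cauchy_itv//.
have mc : measurable_fun [set: R] (fun x => cauchy e (x - c)) by exact: measurable_cauchyB.
rewrite -integral_itv_obnd_cbnd; last exact/measurable_EFinP/measurable_funTS.
rewrite -integral_itv_bndo_bndc; last exact/measurable_EFinP/measurable_funTS.
rewrite [RHS]integral_mkcond; apply: eq_integral => x _.
rewrite /patch indicE -[c - x]opprB cauchyN.
by case: ifPn => _; rewrite ?mul1r ?mul0r.
Qed.

Lemma measurable_indic_cauchy e a b c : 0 < e ->
  measurable_fun [set: R] (fun x => \1_(`]a, b[%classic) x * cauchy e (c - x)).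
Proof.
move=> e0; apply: measurable_funM; first by apply: measurable_indic.
under eq_fun do rewrite -[c - _]opprB cauchyN.
exact: measurable_cauchyB.
Qed.

Lemma rintegrable_indic_cauchy e a b c : 0 < e -> a < b ->
  rintegrable mu (fun x => \1_(`]a, b[%classic) x * cauchy e (c - x)).
Proof.
move=> e0 ab; apply: ge0_rintegrable.
- exact: measurable_indic_cauchy.
- by move=> x; rewrite mulr_ge0// cauchy_ge0.
- by rewrite integral_indic_cauchy// ltry.
Qed.

(** The Cauchy distribution function, shifted by 1/2, tends to that of a point mass. The value
    [Num.sg 0 = 0] means that an endpoint of an interval counts for one half. *)
Lemma atan_scaled_cvg c : atan (c / n.+1%:R^-1) / pi @[n --> \oo] --> Num.sg c / 2.
Proof.
have pi0 := pi_gt0 R.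
have H (c0 : R) : 0 < c0 -> atan (c0 / n.+1%:R^-1) / pi @[n --> \oo] --> (1 / 2 : R).
  move=> c0_gt0.
  have Sy : (n.+1%:R : R) @[n --> \oo] --> +oo%R.
    apply/cvgrnyP/cvgnyPge => k; near=> n.
    by rewrite ltnW// ltnS; near: n; exact: nbhs_infty_ge.
  have -> : 1 / 2 = pi / 2 / pi :> R.
    by move: pi0; generalize (pi : R) => p p0; field; rewrite gt_eqF.
  apply: cvgMr_tmp.
  have : (fun n => c0 * n.+1%:R) n @[n --> \oo] --> +oo%R.
    by apply: (cvg_comp _ _ Sy); apply: gt0_cvgMry => //; exact: cvg_id.
  move=> K; have := cvg_comp _ _ K (@cvgy_atan R).
  by apply: cvg_trans; apply: near_eq_cvg; apply: nearW => n /=; rewrite invrK.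
have [c0|c0|->] := ltrgt0P c.
- by rewrite gtr0_sg//; exact: H.
- rewrite ltr0_sg// mulNr.
  have : - (atan (- c / n.+1%:R^-1) / pi) @[n --> \oo] --> - (1 / 2 : R).
    by apply: cvgN; apply: H; rewrite oppr_gt0.
  apply: cvg_trans; apply: near_eq_cvg; apply: nearW => n /=.
  by rewrite mulNr atanN mulNr opprK.
- rewrite sgr0 mul0r; under eq_fun do rewrite mul0r atan0 mul0r.
  exact: cvg_cst.
Unshelve. all: by end_near. Qed.

End cauchy_interval.

(** * The inversion integral is a density of the law *)

Section box_probability.
Context {R : realType} {d : nat} {disp : measure_display}.
Context {Omega : measurableType disp} (P : probability Omega R).
Variable X : {RV P >-> Rvec R d}.
Local Notation mu := (@lebesgue_measure R).
Local Notation tup n := (n.-tuple (measurableTypeR R)).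
Local Notation lvec := (@lebesgue_vec R d).
Local Notation ltup := (@lebesgue_tuple R d).
Local Notation row := (@row_of_tuple R d).
Implicit Types (e al : R) (x : Rvec R d) (t : tup d) (w : Omega).

Let Xc i w : R := (X w : 'rV[R]_d) 0 i.

Let measurable_Xc i : measurable_fun setT (Xc i).
Proof. by apply: (measurableT_comp (measurable_coord i)). Qed.

Let eps n : R := n.+1%:R^-1.
Let eps_gt0 n : 0 < eps n. Proof. by rewrite invr_gt0. Qed.

Let atan_box n (a b : 'I_d -> R) w : R :=
  \prod_i (atan ((b i - Xc i w) / eps n) / pi - atan ((a i - Xc i w) / eps n) / pi).

(** By Tonelli's theorem the location of the kernel is integrated over the box for each w
    separately, which gives the mass that a product of Cauchy laws centred at X w puts on the
    box. *)
Lemma integral_box_approx_pdens n (a b : 'I_d -> R) : (forall i, a i < b i) ->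
  (\int[lvec]_(x in box a b) (approx_pdens X n x)%:E = \int[P]_w (atan_box n a b w)%:E)%E.
Proof.
move=> ab.
pose f (tw : tup d * Omega) : R := \1_(box a b) (row tw.1) *
   \prod_i cauchy (eps n) (Xc i tw.2 - tnth tw.1 i).
have f0 z : 0 <= f z by rewrite mulr_ge0// prodr_ge0// => i _; exact: cauchy_ge0.
have mf : measurable_fun setT f.
  apply: measurable_funM.
    have mrow : measurable_fun setT (fun t : tup d => \1_(box a b) (row t) : R).
      have mb : measurable_fun setT (\1_(box a b) : Rvec R d -> R).
        by apply: measurable_indic; exact: measurable_box.
      exact: (measurableT_comp mb (@measurable_row_of_tuple R d)).
    by apply: (measurableT_comp mrow); exact: measurable_fst.
  apply: measurable_prod => i _.
  have -> : (fun tw : tup d * Omega => cauchy (eps n) (Xc i tw.2 - tnth tw.1 i)) =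
    (fun s => cauchy (eps n) (s - 0)) \o (fun tw : tup d * Omega => Xc i tw.2 - tnth tw.1 i).
    by apply/funext => tw /=; rewrite subr0.
  apply: measurableT_comp; first exact: measurable_cauchyB.
  apply: measurable_funB.
    by apply: (measurableT_comp (measurable_Xc i)).
  by apply: (measurableT_comp (measurable_tnth i)).
rewrite integral_mkcond.
transitivity (\int[lvec]_x (\1_(box a b) x * approx_pdens X n x)%:E)%E.
  apply: eq_integral => x _; rewrite /patch indicE.
  by case: ifPn => _; rewrite ?mul1r ?mul0r.
rewrite ge0_integral_vec; last 2 first.
- apply: measurable_funM; last exact: measurable_approx_pdens.
  by apply: measurable_indic; exact: measurable_box.
- by move=> x; rewrite mulr_ge0// approx_pdens_ge0.
transitivity (\int[ltup]_t \int[P]_w (f (t, w))%:E)%E.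
  apply: eq_integral => t _; rewrite /f/= EFinM EFin_Rintegral; last first.
    exact: rintegrable_cauchy.
  rewrite -ge0_integralZl//.
  - by apply: eq_integral => w _; rewrite EFinM; under eq_bigr do rewrite mxE.
  - apply/measurable_EFinP; apply: rintegrable_measurable.
    exact: rintegrable_cauchy.
  - by move=> w _; rewrite lee_fin prodr_ge0// => i _; exact: cauchy_ge0.
rewrite (fubini_tonelli (EFin \o f))/=; [|exact/measurable_EFinP|by move=> z; rewrite lee_fin].
apply: eq_integral => w _.
pose h i s := \1_(`]a i, b i[%classic) s * cauchy (eps n) (Xc i w - s).
have hi i : rintegrable mu (h i) by exact: rintegrable_indic_cauchy.
transitivity (\int[ltup]_t (\prod_i h i (tnth t i))%:E)%E.
  by apply: eq_integral => t _; rewrite /f /= indic_box -big_split.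
rewrite -EFin_Rintegral ?Rintegral_prod//; last exact: rintegrable_prod.
congr EFin; apply: eq_bigr => i _.
by rewrite /Rintegral integral_indic_cauchy.
Qed.

Let measurable_atan_box n a b : measurable_fun setT (atan_box n a b).
Proof.
apply: measurable_prod => i _.
have ma (c : R) : measurable_fun setT (fun w => atan ((c - Xc i w) / eps n) / pi).
  apply: measurable_funM => //.
  apply: (measurableT_comp (f := @atan R)).
    by apply: continuous_measurable_fun => x; exact: continuous_atan.
  by apply: measurable_funM => //; apply: measurable_funB.
exact: measurable_funB.
Qed.

Let atan_box_ge0_le1 n (a b : 'I_d -> R) w : (forall i, a i < b i) -> 0 <= atan_box n a b w <= 1.
Proof.
move=> ab; have pi0 := pi_gt0 R.
have H i : 0 <= atan ((b i - Xc i w) / eps n) / pi - atan ((a i - Xc i w) / eps n) / pi <= 1.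
  have h1 := atan_ltpi2 ((b i - Xc i w) / eps n).
  have h2 := atan_gtNpi2 ((a i - Xc i w) / eps n).
  have h3 : atan ((a i - Xc i w) / eps n) <= atan ((b i - Xc i w) / eps n).
    by apply: le_atan; rewrite ler_pM2r ?invr_gt0// lerB// ltW.
  rewrite -mulrBl divr_ge0 ?subr_ge0 ?(ltW pi0)//= ler_pdivrMr// mul1r.
  lra.
apply/andP; split; first by apply: prodr_ge0 => i _; case/andP: (H i).
rewrite (_ : 1 = \prod_(i < d) 1); last by rewrite big1.
by apply: ler_prod => i _; exact: H.
Qed.

(* Limit of the Cauchy probabilities of the box: the value is 1 inside the
   box, 0 outside its closure and fractional on its boundary. *)
Definition box_weight (a b : 'I_d -> R) w : R :=
  \prod_i (Num.sg (b i - Xc i w) / 2 - Num.sg (a i - Xc i w) / 2).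

Let cvg_atan_box a b w : atan_box n a b w @[n --> \oo] --> box_weight a b w.
Proof.
apply: cvg_big => [|i _]; first exact: mul_continuous.
by apply: cvgB; exact: atan_scaled_cvg.
Qed.

Let measurable_box_weight a b : measurable_fun setT (box_weight a b).
Proof.
by apply: (measurable_fun_cvg (fun n => measurable_atan_box n a b)) => w _; exact: cvg_atan_box.
Qed.

Let box_weight_ge0_le1 a b w : (forall i, a i < b i) -> 0 <= box_weight a b w <= 1.
Proof.
move=> ab; apply/andP; split.
  apply: (cvgr_to_ge (@cvg_atan_box a b w)); apply: nearW => n.
  by have /andP[] := atan_box_ge0_le1 n w ab.
apply: (cvgr_to_le (@cvg_atan_box a b w)); apply: nearW => n.
by have /andP[] := atan_box_ge0_le1 n w ab.
Qed.

Let rintegrable_box_weight a b : (forall i, a i < b i) -> rintegrable P (box_weight a b).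
Proof.
move=> ab; have /(le_rintegrable _ _) : rintegrable P (fun=> 1) by exact: finite_measure_integrable_cst.
apply=> // w; have /andP[h0 h1] := box_weight_ge0_le1 w ab.
by rewrite ger0_norm.
Qed.

Variable m : tup d -> R.
Hypothesis m_integrable : rintegrable ltup m.
Hypothesis cosE_le : forall al x t, `|cosE X al x t| <= m t.

Let C : R := (2 * pi) ^- d * \int[ltup]_t m t.

Let rintegrable_indic_box a b : (forall i, a i < b i) ->
  rintegrable lvec (fun x => C * \1_(box a b) x).
Proof.
move=> ab; apply: rintegrableZ; have mb := measurable_box a b.
apply: ge0_rintegrable => //; rewrite integral_indic// setIT.
apply: (@le_lt_trans _ _ (\prod_i (b i - a i))%:E); last exact: ltry.
by rewrite -lebesgue_vec_box// => i; exact: ltW.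
Qed.

Let indic_pdens_bound a b (g : Rvec R d -> R) : (forall x, 0 <= g x <= C) ->
  forall x, `|\1_(box a b) x * g x| <= C * \1_(box a b) x.
Proof.
move=> gC x; have /andP[g0 g1] := gC x.
by rewrite normrM !ger0_norm// mulrC ler_wpM2r.
Qed.

Let approx_bound n x : 0 <= approx_pdens X n x <= C.
Proof.
by rewrite approx_pdens_ge0/=; exact: (approx_pdens_le m_integrable cosE_le).
Qed.

Let pdens_bound x : 0 <= pdens X x <= C.
Proof.
rewrite (pdens_ge0 m_integrable cosE_le)/=.
exact: (pdens_le m_integrable cosE_le).
Qed.

Let measurable_indic_box a b : measurable_fun setT (\1_(box a b) : Rvec R d -> R).
Proof. by apply: measurable_indic; exact: measurable_box. Qed.

Let mpdens : measurable_fun setT (pdens X).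
Proof. exact: (measurable_pdens m_integrable cosE_le). Qed.

(** Both sides of [integral_box_approx_pdens] converge by dominated convergence: on the left a
    uniform bound on the approximations holds on a box of finite volume, on the right the integrands
    lie in [0, 1]. *)
Lemma integral_box_pdens (a b : 'I_d -> R) : (forall i, a i < b i) ->
  (\int[lvec]_(x in box a b) (pdens X x)%:E = \int[P]_w (box_weight a b w)%:E)%E.
Proof.
move=> ab.
have boxE (g : Rvec R d -> R) : (\int[lvec]_(x in box a b) (g x)%:E =
    \int[lvec]_x (\1_(box a b) x * g x)%:E)%E.
  rewrite integral_mkcond; apply: eq_integral => x _; rewrite /patch indicE.
  by case: ifPn => _; rewrite ?mul1r ?mul0r.
have ipdens : rintegrable lvec (fun x => \1_(box a b) x * pdens X x).
  apply: le_rintegrable (rintegrable_indic_box ab); first exact: measurable_funM.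
  by apply: indic_pdens_bound => x; exact: pdens_bound.
rewrite boxE -!EFin_Rintegral//; last exact: rintegrable_box_weight.
congr EFin.
have L : \int[lvec]_x (\1_(box a b) x * approx_pdens X n x) @[n --> \oo] -->
    \int[lvec]_x (\1_(box a b) x * pdens X x).
  apply: (dominated_Rintegral (g := fun x => C * \1_(box a b) x)) => //.
  - by move=> n; apply: measurable_funM => //; exact: measurable_approx_pdens.
  - move=> x; apply: cvgMl_tmp; exact: (approx_pdens_cvg m_integrable cosE_le).
  - by move=> n; apply: indic_pdens_bound => x; exact: approx_bound.
  - exact: rintegrable_indic_box.
have M : \int[P]_w atan_box n a b w @[n --> \oo] --> \int[P]_w box_weight a b w.
  apply: (dominated_Rintegral (g := fun=> 1)) => //.
  - move=> n w; have /andP[h0 h1] := atan_box_ge0_le1 n w ab.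
    by rewrite ger0_norm.
  - exact: finite_measure_integrable_cst.
apply: (cvg_unique _ L) => //.
rewrite (_ : (fun n => _) = (fun n => \int[P]_w atan_box n a b w))//.
apply/funext => n; congr fine.
by rewrite -boxE integral_box_approx_pdens.
Qed.

Local Notation nu := (density_measure mpdens (pdens_ge0 m_integrable cosE_le)).

Let nuE B : nu B = (\int[lvec]_(x in B) (pdens X x)%:E)%E. Proof. by []. Qed.

Let box0 (a b : 'I_d -> R) i : b i <= a i -> box a b = set0.
Proof.
move=> ba; rewrite -subset0 => x /(_ i)/andP[ax xb].
by have := lt_trans ax xb; rewrite ltNge ba.
Qed.

Let box_cases (a b : 'I_d -> R) : (forall i, a i < b i) \/ box a b = set0.
Proof.
have [ab|/existsNP[i /negP]] := pselect (forall i, a i < b i); first by left.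
by rewrite -leNgt => ba; right; exact: (@box0 _ _ i).
Qed.

Let shrink_cover (a b : 'I_d -> R) :
  \bigcup_n box (fun i => a i + eps n) (fun i => b i - eps n) = box a b.
Proof.
have eps_cvg (r : R) : 0 < r -> exists n, eps n < r.
  move=> r0; have [n _ /(_ n (leqnn n))] := near_infty_natSinv_lt (PosNum r0).
  by exists n.
apply/seteqP; split => [x [n _ xab] i|x xab].
  have /andP[h1 h2] := xab i; have := eps_gt0 n => e0.
  by apply/andP; split; lra.
have /choice[N HN] (i : 'I_d) : exists n, eps n < Num.min ((x : 'rV[R]_d) 0 i - a i) (b i - (x : 'rV[R]_d) 0 i).
  by apply: eps_cvg; rewrite lt_min !subr_gt0; exact: xab.
exists (\max_i N i) => // i.
have : eps (\max_i N i) <= eps (N i).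
  by rewrite lef_pV2 ?posrE// ler_nat ltnS; exact: leq_bigmax.
have := HN i; rewrite lt_min => /andP[h1 h2] h3.
by apply/andP; split; lra.
Qed.

Let indic_X (B : set (Rvec R d)) : measurable B ->
  (\int[P]_w (\1_B (X w))%:E = P (X @^-1` B))%E.
Proof.
move=> mB; rewrite -[in RHS](setIT (X @^-1` B)) -integral_indic//.
by rewrite -[X in measurable X]setTI; exact: measurable_funPT.
Qed.

Let box_prob_le (a b : 'I_d -> R) : (forall i, a i < b i) -> (P (X @^-1` box a b) <= nu (box a b))%E.
Proof.
move=> ab; have mb := measurable_box a b.
rewrite nuE integral_box_pdens// -indic_X//; apply: ge0_le_integral => //.
- by apply/measurable_EFinP; apply: (measurableT_comp (measurable_indic_box a b)).
- exact/measurable_EFinP.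
- move=> w _; rewrite lee_fin indicE; have [Xab|Xab] := boolP (_ \in _); last first.
    by have /andP[] := box_weight_ge0_le1 w ab.
  rewrite /box_weight big1// => i _.
  move: Xab; rewrite inE => /(_ i)/andP[h1 h2].
  by rewrite gtr0_sg ?subr_gt0// ltr0_sg ?subr_lt0//; lra.
Qed.

Let shrink_prob_ge (a b : 'I_d -> R) n : (nu (box (fun i => a i + eps n)%R (fun i => b i - eps n)%R)
  <= P (X @^-1` box a b))%E.
Proof.
have [ab|->] := box_cases (fun i => a i + eps n) (fun i => b i - eps n); last first.
  by rewrite nuE integral_set0.
have mb := measurable_box a b.
rewrite nuE integral_box_pdens// -indic_X//; apply: ge0_le_integral => //.
- by move=> w _; rewrite lee_fin; have /andP[] := box_weight_ge0_le1 w ab.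
- exact/measurable_EFinP.
- by apply/measurable_EFinP; apply: (measurableT_comp (measurable_indic_box a b)).
- move=> w _; rewrite lee_fin indicE; have [Xab|Xab] := boolP (_ \in _).
    by have /andP[] := box_weight_ge0_le1 w ab.
  (* Off the box, some coordinate of X w lies strictly beyond one side of the shrunken box; the two
     signs then agree and that factor vanishes. *)
  rewrite le_eqVlt; apply/orP; left; rewrite /box_weight prodf_seq_eq0.
  apply: contrapT => H; case/negP : Xab; rewrite inE => i.
  have [//|ti] := boolP (a i < (X w : 'rV[R]_d) 0 i < b i); exfalso; apply: H.
  apply/hasP; exists i; first by rewrite mem_index_enum.
  have e0 := eps_gt0 n; have abi := ab i.
  move: ti; rewrite negb_and -!leNgt => /orP[h|h].
    by rewrite !gtr0_sg ?subrr// /Xc; lra.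
  by rewrite !ltr0_sg ?subrr// /Xc; lra.
Qed.

(** The boundary of a box could carry mass of the law, where [box_weight] is fractional. The box is
    therefore squeezed: its probability is at most its [pdens] mass and at least that of each
    shrunken box, and the shrunken boxes exhaust the open box. *)
Theorem pdens_law (B : set (Rvec R d)) : measurable B ->
  (P (X @^-1` B) = \int[lvec]_(x in B) (pdens X x)%:E)%E.
Proof.
move=> mB; rewrite -nuE -[LHS]/(distribution P X B).
apply: measure_unique_boxes => // a b; last first.
  by rewrite (le_lt_trans (probability_le1 _ _)) ?ltry//; exact: measurable_box.
have [ab|->] := box_cases a b; last by rewrite !measure0.
apply/eqP; rewrite eq_le; apply/andP; split; first exact: box_prob_le.
have : nu (box (fun i => a i + eps n) (fun i => b i - eps n)) @[n --> \oo] --> nu (box a b).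
  rewrite -shrink_cover; apply: nondecreasing_cvg_mu.
  - by move=> n; exact: measurable_box.
  - by apply: bigcupT_measurable => n; exact: measurable_box.
  - move=> n k nk; apply/subsetPset => x xab i; have /andP[h1 h2] := xab i.
    have : eps k <= eps n by rewrite lef_pV2 ?posrE// ler_nat ltnS.
    by move=> h3; apply/andP; split; lra.
move=> H; apply: (lee_cvg_to H (cvg_cst (distribution P X (box a b)))).
by apply: nearW => n; exact: shrink_prob_ge.
Qed.

End box_probability.

Lemma Rintegral_cst_probability {R : realType} {disp} {Omega : measurableType disp}
  (P : probability Omega R) (k : R) : \int[P]_w k = k.
Proof.
rewrite Rintegral_cst//; transitivity (k * fine (1%E : \bar R)); last exact: mulr1.
by congr (k * fine _); exact: probability_setT.
Qed.

(** * A bounded density bounds the integral of the squared characteristic function *)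

Section plancherel_inequality.
Context {R : realType} {d : nat} {disp : measure_display}.
Context {Omega : measurableType disp} (P : probability Omega R).
Variable X : {RV P >-> Rvec R d}.
Local Notation mu := (@lebesgue_measure R).
Local Notation tup n := (n.-tuple (measurableTypeR R)).
Local Notation lvec := (@lebesgue_vec R d).
Local Notation ltup := (@lebesgue_tuple R d).
Local Notation row := (@row_of_tuple R d).
Implicit Types (e al : R) (x : Rvec R d) (t : tup d) (w : Omega).

Let Xc i w : R := (X w : 'rV[R]_d) 0 i.

(* |E e^{i<t, X>}|^2, the characteristic function of X - X' for an independent
   copy X'. *)
Definition charfun_sqr t : R := cosE X 0 0 t ^+ 2 + cosE X (- (pi / 2)) 0 t ^+ 2.

Lemma charfun_sqr_ge0 t : 0 <= charfun_sqr t.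
Proof. by rewrite addr_ge0 ?sqr_ge0. Qed.

Lemma measurable_charfun_sqr : measurable_fun setT charfun_sqr.
Proof. by apply: measurable_funD; apply: measurable_funX; exact: measurable_cosE. Qed.

Let shift_dotB x t w : shift_dot X x t w = shift_dot X 0 t w - dotv (x : 'rV[R]_d) (row t).
Proof. by rewrite /shift_dot subr0 -scaleN1r dotvDl dotvZl mulN1r. Qed.

Lemma cosE_shift al x t :
  cosE X al x t = cos (al - dotv (x : 'rV[R]_d) (row t)) * cosE X 0 0 t
                - sin (al - dotv (x : 'rV[R]_d) (row t)) * cosE X (- (pi / 2)) 0 t.
Proof.
set c := al - _.
rewrite /cosE -!RintegralZl//; [|exact: rintegrable_cos|exact: rintegrable_cos].
rewrite -RintegralB//; last 2 first.
- by apply: rintegrableZ; exact: rintegrable_cos.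
- by apply: rintegrableZ; exact: rintegrable_cos.
apply: eq_Rintegral => w _.
rewrite (shift_dotB x) (_ : al + _ = c + shift_dot X 0 t w); last by rewrite /c; ring.
by rewrite add0r cosD [- _ + _]addrC cosBpihalf; ring.
Qed.

(** The independent copy is produced by averaging the location x of [cosE] over the law of X,
    instead of passing to a product space. *)
Lemma charfun_sqrE t : charfun_sqr t = \int[P]_w cosE X 0 (X w) t.
Proof.
have E w : cosE X 0 (X w) t = cosE X 0 0 t * cos (0 + shift_dot X 0 t w)
    + cosE X (- (pi / 2)) 0 t * cos (- (pi / 2) + shift_dot X 0 t w).
  rewrite cosE_shift !add0r addrC [- (_ / _) + _]addrC cosBpihalf.
  rewrite (_ : dotv (X w : 'rV[R]_d) (row t) = shift_dot X 0 t w); last by rewrite /shift_dot subr0.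
  by rewrite sinN cosN; ring.
under eq_Rintegral do rewrite E.
have ic al := rintegrable_cos X al 0 t.
rewrite RintegralD//; [|exact: rintegrableZ|exact: rintegrableZ].
by rewrite !RintegralZl//= /charfun_sqr !expr2.
Qed.

Variables (p : Rvec R d -> R) (K : R).
Hypotheses (mp : measurable_fun setT p) (p0 : forall x, 0 <= p x)
  (pK : forall x, p x <= K).
Hypothesis p_law : forall B : set (Rvec R d), measurable B ->
  (P (X @^-1` B) = \int[lvec]_(x in B) (p x)%:E)%E.

Let K0 : 0 <= K. Proof. exact: le_trans (p0 0) (pK 0). Qed.

Let cauchy_kernel e x (y : Rvec R d) : R :=
  \prod_i cauchy e ((y : 'rV[R]_d) 0 i - (x : 'rV[R]_d) 0 i).

Let cauchy_kernel_ge0 e x y : 0 < e -> 0 <= cauchy_kernel e x y.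
Proof. by move=> e0; apply: prodr_ge0 => i _; exact: cauchy_ge0. Qed.

Let measurable_cauchy_kernel e x : 0 < e -> measurable_fun setT (cauchy_kernel e x).
Proof.
move=> e0; apply: measurable_prod => i _.
by apply: (measurableT_comp (measurable_cauchyB ((x : 'rV[R]_d) 0 i) e0) (measurable_coord i)).
Qed.

Let integral_cauchy_kernel e x : 0 < e -> (\int[lvec]_y (cauchy_kernel e x y)%:E = 1)%E.
Proof.
move=> e0; rewrite ge0_integral_vec; last 2 first.
- exact: measurable_cauchy_kernel.
- by move=> y; exact: cauchy_kernel_ge0.
pose f i s := cauchy e (s - (x : 'rV[R]_d) 0 i).
have fi i : rintegrable mu (f i).
  apply: ge0_rintegrable; first exact: measurable_cauchyB.
  - by move=> s; exact: cauchy_ge0.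
  - by rewrite integral_cauchyB// ltry.
transitivity (\int[ltup]_t (\prod_i f i (tnth t i))%:E)%E.
  by apply: eq_integral => t _; congr EFin; apply: eq_bigr => i _; rewrite mxE.
rewrite -EFin_Rintegral ?Rintegral_prod//; last exact: rintegrable_prod.
by rewrite big1// => i _; rewrite /Rintegral integral_cauchyB.
Qed.

Lemma expectation_cauchy_le e x : 0 < e ->
  \int[P]_w \prod_i cauchy e (Xc i w - (x : 'rV[R]_d) 0 i) <= K.
Proof.
move=> e0; rewrite -lee_fin EFin_Rintegral; last exact: rintegrable_cauchy.
have -> : (\int[P]_w (\prod_i cauchy e (Xc i w - (x : 'rV[R]_d) 0 i))%:E =
    \int[distribution P X]_y (cauchy_kernel e x y)%:E)%E.
  rewrite ge0_integral_distribution//.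
  - by apply/measurable_EFinP; exact: measurable_cauchy_kernel.
  - by move=> y; rewrite lee_fin cauchy_kernel_ge0.
(* The law of X is dominated by K times Lebesgue measure, and the Cauchy kernel has total mass 1. *)
apply: (@le_trans _ _ (\int[mscale (NngNum K0) lvec]_y (cauchy_kernel e x y)%:E)%E).
  apply: ge0_le_measure_integral => //.
  - move=> B mB; rewrite /mscale/= [leLHS]/(distribution P X B) /distribution /pushforward p_law//.
    apply: (@le_trans _ _ (\int[lvec]_(x in B) (cst K%:E x))%E); last by rewrite integral_cst.
    apply: ge0_le_integral => //.
    + by move=> y _; rewrite lee_fin.
    + by apply/measurable_EFinP; exact: measurable_funTS.
    + by move=> y _; rewrite lee_fin.
  - by move=> y; rewrite lee_fin cauchy_kernel_ge0.
  - by apply/measurable_EFinP; exact: measurable_cauchy_kernel.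
rewrite ge0_integral_mscale//.
- by rewrite integral_cauchy_kernel// mule1.
- by apply/measurable_EFinP; exact: measurable_cauchy_kernel.
- by move=> y _; rewrite lee_fin cauchy_kernel_ge0.
Qed.

Let cosE_le1 al x t : `|cosE X al x t| <= 1.
Proof.
apply: le_trans (le_normr_Rintegral measurableT (rintegrable_cos X al x t)) _.
apply: (@le_trans _ _ (\int[P]_w 1)).
  apply: le_Rintegral => //.
  - by apply: integrable_norm => //; exact: rintegrable_cos.
  - exact: finite_measure_integrable_cst.
  - by move=> w _; exact: cos_max.
by rewrite Rintegral_cst_probability.
Qed.

Let measurable_cosE_joint :
  measurable_fun setT (fun wt : Omega * tup d => cosE X 0 (X wt.1) wt.2).
Proof.
have ms : measurable_fun setT (fun wt : Omega * tup d => 0 - dotv (X wt.1 : 'rV[R]_d) (row wt.2)).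
  apply: measurable_funB => //; apply: measurable_sum => i.
  apply: measurable_funM.
    by apply: (measurableT_comp (measurableT_comp (measurable_coord i) (measurable_funPT X))).
  under eq_fun do rewrite mxE.
  by apply: (measurableT_comp (measurable_tnth i)).
have mc al : measurable_fun setT (fun wt : Omega * tup d => cosE X al 0 wt.2).
  by apply: (measurableT_comp (measurable_cosE X al 0)).
under eq_fun do rewrite cosE_shift.
apply: measurable_funB; apply: measurable_funM => //.
- exact: (measurableT_comp (@measurable_cos R) ms).
- exact: (measurableT_comp (@measurable_sin R) ms).
Qed.

Lemma Rintegral_weighted_charfun_sqr_le e : 0 < e ->
  \int[ltup]_t (laplace_weight e t * charfun_sqr t) <= (2 * pi) ^+ d * K.
Proof.
move=> e0.
have cst1 : rintegrable P (fun=> 1) by exact: finite_measure_integrable_cst.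
pose f (wt : Omega * tup d) := laplace_weight e wt.2 * cosE X 0 (X wt.1) wt.2.
have mf : measurable_fun setT f.
  apply: measurable_funM => //.
  by apply: (measurableT_comp (measurable_laplace_weight e)).
have fb w t : `|f (w, t)| <= 1 * laplace_weight e t.
  rewrite /f/= normrM (ger0_norm (laplace_weight_ge0 _ _)) mulrC.
  by rewrite ler_wpM2r ?laplace_weight_ge0.
have ci t : rintegrable P (fun w => cosE X 0 (X w) t).
  apply: le_rintegrable cst1 => //.
  exact: (measurableT_comp measurable_cosE_joint (measurable_pair2 t)).
have -> : \int[ltup]_t (laplace_weight e t * charfun_sqr t) =
    \int[ltup]_t \int[P]_w f (w, t).
  by apply: eq_Rintegral => t _; rewrite charfun_sqrE -RintegralZl.
rewrite -(Rfubini mf cst1 (rintegrable_laplace_weight d e0) fb) /f/=.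
apply: (@le_trans _ _ (\int[P]_w ((2 * pi) ^+ d * K))).
  apply: le_Rintegral => //.
  - exact: (rintegrable_inner1 mf cst1 (rintegrable_laplace_weight d e0) fb).
  - exact: finite_measure_integrable_cst.
  - move=> w _; rewrite laplace_smoothing// cos0 mul1r ler_pM2l ?exprn_gt0 ?mulr_gt0 ?pi_gt0//.
    exact: expectation_cauchy_le.
by rewrite Rintegral_cst_probability.
Qed.

(** The damped integrals are bounded uniformly by smoothing at the random location X w. The damping
    is removed by monotone convergence, because integrability of the limit is part of what is being
    proved. *)
Lemma integral_charfun_sqr_le :
  (\int[ltup]_t (charfun_sqr t)%:E <= ((2 * pi) ^+ d * K)%:E)%E.
Proof.
pose eps n : R := n.+1%:R^-1.
have eps_gt0 n : 0 < eps n by rewrite invr_gt0.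
have H : (\int[ltup]_t (laplace_weight (eps n) t * charfun_sqr t)%:E @[n --> \oo] -->
    \int[ltup]_t (charfun_sqr t)%:E)%E.
  have -> : (\int[ltup]_t (charfun_sqr t)%:E =
    \int[ltup]_t limn (fun n => (laplace_weight (eps n) t * charfun_sqr t)%:E))%E.
    apply: eq_integral => t _; apply/esym/cvg_lim => //.
    apply: cvg_EFin; first exact: nearW.
    rewrite -[X in _ --> X]mul1r; apply: cvgMr_tmp; exact: cvg_laplace_weight.
  apply: cvg_monotone_convergence => //.
  - move=> n; apply/measurable_EFinP; apply: measurable_funM.
      exact: measurable_laplace_weight.
    exact: measurable_charfun_sqr.
  - by move=> n t _; rewrite lee_fin mulr_ge0 ?laplace_weight_ge0 ?charfun_sqr_ge0.
  - move=> t _ n k nk; rewrite lee_fin ler_wpM2r ?charfun_sqr_ge0// !laplace_weightE.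
    rewrite ler_expR lerN2 ler_wpM2r ?sumr_ge0//.
    by rewrite lef_pV2 ?posrE// ler_nat ltnS.
apply: (lee_cvg_to H (cvg_cst _)); apply: nearW => n.
rewrite -EFin_Rintegral; first by rewrite lee_fin Rintegral_weighted_charfun_sqr_le.
have := rintegrableZ 2 (rintegrable_laplace_weight d (eps_gt0 n)).
apply: le_rintegrable.
  apply: measurable_funM; first exact: measurable_laplace_weight.
  exact: measurable_charfun_sqr.
move=> t; rewrite ger0_norm ?mulr_ge0 ?laplace_weight_ge0 ?charfun_sqr_ge0//.
rewrite mulrC ler_wpM2r ?laplace_weight_ge0// /charfun_sqr.
have sq1 al : cosE X al 0 t ^+ 2 <= 1.
  by rewrite -real_normK ?num_real// expr_le1.
by have := sq1 0; have := sq1 (- (pi / 2)); lra.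
Qed.

End plancherel_inequality.

(** * The functions h, Psi and Psi* *)

Section operator_norm.
Context {R : realType} {d : nat}.
Implicit Types (A : 'M[R]_d) (x y : 'rV[R]_d).

Lemma matvecE A x i : matvec A x 0 i = \sum_j x 0 j * A i j.
Proof. by rewrite /matvec mxE; apply: eq_bigr => j _; rewrite mxE. Qed.

Lemma matvecZ A a x : matvec A (a *: x) = a *: matvec A x.
Proof. by rewrite /matvec -scalemxAl. Qed.

Lemma matvecD A x y : matvec A (x + y) = matvec A x + matvec A y.
Proof. by rewrite /matvec mulmxDl. Qed.

Lemma enorm_matvec_le A x (a : R) : (forall i j, `|A i j| <= a) ->
  enorm x <= 1 -> enorm (matvec A x) <= d%:R * (d%:R * a).
Proof.
move=> Aa x1; apply: enorm_le_coords => i; rewrite matvecE.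
rewrite (le_trans (ler_norm_sum _ _ _))//.
apply: (@le_trans _ _ (\sum_(j < d) a)).
  apply: ler_sum => j _; rewrite normrM -[leRHS]mul1r ler_pM//.
  exact: le_trans (coord_le_enorm _ _) x1.
by rewrite sumr_const card_ord mulr_natl.
Qed.

Let bounded_entries A : exists a : R, forall i j, `|A i j| <= a.
Proof.
exists (\sum_i \sum_j `|A i j|) => i j.
rewrite (bigD1 i)//= (bigD1 j)//= -addrA lerDl addr_ge0//.
  by apply: sumr_ge0.
by apply: sumr_ge0 => k _; apply: sumr_ge0.
Qed.

Let has_sup_opnorm A :
  has_sup [set enorm (matvec A x) | x in [set x | enorm x <= 1]].
Proof.
split.
  by exists (enorm (matvec A 0)); exists 0 => //=; rewrite /enorm dotv0l sqrtr0.
have [a Aa] := bounded_entries A.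
by exists (d%:R * (d%:R * a)) => _ [x /= x1 <-]; exact: enorm_matvec_le.
Qed.

Lemma enorm_matvec A x : enorm (matvec A x) <= opnorm A * enorm x.
Proof.
have [->|x0] := eqVneq x 0.
  by rewrite -(scale0r 0) matvecZ !enormZ normr0 !mul0r mulr0.
have x1 : 0 < enorm x by rewrite enorm_gt0.
rewrite -ler_pdivrMr//.
have -> : enorm (matvec A x) / enorm x = enorm (matvec A ((enorm x)^-1 *: x)).
  by rewrite matvecZ enormZ ger0_norm ?invr_ge0 ?enorm_ge0// mulrC.
apply: ub_le_sup; first by have [] := has_sup_opnorm A.
exists ((enorm x)^-1 *: x) => //=.
by rewrite enormZ ger0_norm ?invr_ge0 ?enorm_ge0// mulVf ?gt_eqF.
Qed.

Lemma opnorm_ge0 A : 0 <= opnorm A.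
Proof.
apply: (@le_trans _ _ (enorm (matvec A 0))); first exact: enorm_ge0.
apply: ub_le_sup; first by have [] := has_sup_opnorm A.
by exists 0 => //=; rewrite /enorm dotv0l sqrtr0.
Qed.

Lemma quadratic_form_le A x : dotv x (matvec A x) <= opnorm A * enorm x ^+ 2.
Proof.
rewrite (le_trans (ler_norm _))// (le_trans (dotv_le_enorm _ _))//.
by have := ler_wpM2l (enorm_ge0 x) (enorm_matvec A x); rewrite expr2; lra.
Qed.

Section positive_semidefinite.
Variable A : 'M[R]_d.
Hypotheses (symA : A^T = A) (psdA : forall x, 0 <= dotv x (matvec A x)).

Lemma quadratic_form_delta i j : dotv (delta_mx 0 i) (matvec A (delta_mx 0 j)) = A i j.
Proof.
rewrite dotv_delta matvecE (bigD1 j)//= mxE !eqxx mul1r big1 ?addr0// => k kj.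
by rewrite mxE eqxx (negbTE kj) mul0r.
Qed.

Lemma quadratic_formD_le x y : dotv (x + y) (matvec A (x + y)) <=
  2 * dotv x (matvec A x) + 2 * dotv y (matvec A y).
Proof.
have := psdA (x - y); rewrite -scaleN1r !matvecD !matvecZ !dotvDl !dotvDr !dotvZl !dotvZr.
lra.
Qed.

(** Testing the form on e_i + e_j and e_i - e_j gives |A_ij| <= (A_ii + A_jj) / 2 <= tr A for i <>
    j. The trace is a sum of values of the form on unit vectors, hence controlled by Re Psi
    there. *)
Lemma opnorm_le_trace : opnorm A <= d%:R ^+ 2 * \tr A.
Proof.
have dg i : 0 <= A i i by rewrite -quadratic_form_delta.
have trE i j : i != j -> A i i + A j j <= \tr A.
  move=> ij; rewrite /mxtrace (bigD1 i)//= (bigD1 j) 1?eq_sym//= addrA lerDl.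
  by apply: sumr_ge0 => k _.
have Aij i j : `|A i j| <= \tr A.
  have [->|ij] := eqVneq i j.
    by rewrite ger0_norm// /mxtrace (bigD1 j)//= lerDl; apply: sumr_ge0 => k _.
  have h1 := psdA (delta_mx 0 i + delta_mx 0 j).
  have h2 := psdA (delta_mx 0 i - delta_mx 0 j).
  have Aji : A j i = A i j by rewrite -[in LHS]symA mxE.
  move: h1 h2; rewrite -scaleN1r !matvecD !matvecZ !dotvDl !dotvDr !dotvZl !dotvZr.
  rewrite !quadratic_form_delta Aji => h1 h2.
  have := trE i j ij; have := dg i; have := dg j => h3 h4 h5.
  by rewrite ler_norml; apply/andP; split; lra.
apply: ge_sup.
  by exists (enorm (matvec A 0)); exists 0 => //=; rewrite /enorm dotv0l sqrtr0.
by move=> _ [x /= x1 <-]; rewrite expr2 -mulrA; exact: enorm_matvec_le.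
Qed.

End positive_semidefinite.

End operator_norm.

(** * Truncated second moments and sigma-finiteness of a Lévy measure *)

Section levy_measure_theory.
Context {R : realType} {d : nat}.
Variable N : {measure set (Rvec R d) -> \bar R}.
Hypothesis HN : levy_measure N.
Implicit Types (z : Rvec R d) (r s : R).

Definition truncated_sqr r z : R := Num.min 1 (enorm (z : 'rV[R]_d) ^+ 2 / r ^+ 2).

Lemma truncated_sqr_ge0 r z : 0 <= truncated_sqr r z.
Proof. by rewrite le_min ler01 divr_ge0 ?sqr_ge0. Qed.

Lemma truncated_sqr_le1 r z : truncated_sqr r z <= 1.
Proof. by rewrite ge_min lexx. Qed.

Lemma truncated_sqrE r z : 0 < r ->
  truncated_sqr r z = if enorm (z : 'rV[R]_d) < r then enorm (z : 'rV[R]_d) ^+ 2 / r ^+ 2 else 1.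
Proof.
move=> r0; rewrite /truncated_sqr; case: ltP => [zr|rz].
  rewrite min_r// ler_pdivrMr ?exprn_gt0// mul1r.
  by rewrite ler_pXn2r ?nnegrE ?enorm_ge0 ?ltW.
rewrite min_l// ler_pdivlMr ?exprn_gt0// mul1r.
by rewrite ler_pXn2r ?nnegrE ?enorm_ge0 ?(ltW r0).
Qed.

Lemma measurable_truncated_sqr r : measurable_fun setT (truncated_sqr r).
Proof.
apply: measurable_minr => //; apply: measurable_funM => //.
by apply: measurable_funX; exact: measurable_enorm.
Qed.

Lemma truncated_sqr_scale r s z : 0 < r -> r <= s ->
  truncated_sqr r z <= (s / r) ^+ 2 * truncated_sqr s z.
Proof.
move=> r0 rs; have s0 := lt_le_trans r0 rs.
have sr1 : 1 <= (s / r) ^+ 2 by apply: exprn_ege1; rewrite ler_pdivlMr// mul1r.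
rewrite [truncated_sqr s z]truncated_sqrE//; case: ifPn => zs; last first.
  by rewrite mulr1 (le_trans (truncated_sqr_le1 _ _)).
have -> : (s / r) ^+ 2 * (enorm (z : 'rV[R]_d) ^+ 2 / s ^+ 2) = enorm (z : 'rV[R]_d) ^+ 2 / r ^+ 2.
  by rewrite !expr2; field; rewrite !gt_eqF.
by rewrite ge_min lexx orbT.
Qed.

Lemma truncated_sqr_anti r s z : 0 < r -> r <= s -> truncated_sqr s z <= truncated_sqr r z.
Proof.
move=> r0 rs; have s0 := lt_le_trans r0 rs.
rewrite /truncated_sqr le_min !ge_min lexx/=; apply/orP; right.
rewrite ler_wpM2l ?sqr_ge0// lef_pV2 ?posrE ?exprn_gt0//.
by rewrite ler_pXn2r ?nnegrE ?(ltW r0) ?(ltW s0).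
Qed.

Let rintegrable_truncated_sqr1 : rintegrable N (truncated_sqr 1).
Proof.
apply: ge0_rintegrable; first exact: measurable_truncated_sqr.
  by move=> z; exact: truncated_sqr_ge0.
have [_] := HN; congr (_ < _)%E; apply: eq_integral => z _.
by rewrite /truncated_sqr expr1n divr1.
Qed.

Lemma rintegrable_truncated_sqr r : 0 < r -> rintegrable N (truncated_sqr r).
Proof.
move=> r0; have [r1|/ltW r1] := leP r 1.
  have := rintegrableZ ((1 / r) ^+ 2) rintegrable_truncated_sqr1.
  apply: le_rintegrable; first exact: measurable_truncated_sqr.
  by move=> z; rewrite ger0_norm ?truncated_sqr_ge0// truncated_sqr_scale.
apply: le_rintegrable rintegrable_truncated_sqr1; first exact: measurable_truncated_sqr.
by move=> z; rewrite ger0_norm ?truncated_sqr_ge0// truncated_sqr_anti.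
Qed.

(** A copy of [N] indexed by the proof that it is a Lévy measure, to which the sigma-finite
    structure demanded by Fubini's theorem can be attached. *)
Definition levy_sigma_finite of levy_measure N : set (Rvec R d) -> \bar R := N.

Local Notation N' := (levy_sigma_finite HN).

Let N'0 : N' set0 = 0%E. Proof. exact: measure0. Qed.
Let N'_ge0 B : (0 <= N' B)%E. Proof. exact: measure_ge0. Qed.
Let N'_sigma_additive : semi_sigma_additive N'.
Proof. exact: measure_semi_sigma_additive. Qed.

HB.instance Definition _ := isMeasure.Build _ _ _ N' N'0 N'_ge0 N'_sigma_additive.

Let N'_sigma_finite : sigma_finite setT N'.
Proof.
pose Z : set (Rvec R d) := [set z | enorm (z : 'rV[R]_d) = 0].
pose G n : set (Rvec R d) := [set z | n.+1%:R^-1 <= truncated_sqr 1 z].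
have mZ : measurable Z.
  have := @measurable_enorm R d measurableT [set 0] (measurable_set1 0).
  by rewrite setTI.
have mG n : measurable (G n).
  have := @measurable_truncated_sqr 1 measurableT `[n.+1%:R^-1, +oo[%classic.
  rewrite setTI (_ : _ @^-1` _ = G n); first by apply.
  by apply/seteqP; split => z /=; rewrite in_itv/= andbT.
have Z0 : Z = [set (0 : 'rV[R]_d)].
  apply/seteqP; split => z; rewrite /Z/=; last by move=> ->; rewrite /enorm dotv0l sqrtr0.
  move=> z0.
  by apply/eqP/negPn/negP => zn0; move: zn0; rewrite -enorm_gt0 z0 ltxx.
(* The origin is a null set, and away from it [truncated_sqr 1] is positive with finite integral, so
   its superlevel sets have finite mass by Markov's inequality. *)
exists (fun n => Z `|` G n).
  apply/esym/seteqP; split => // z _.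
  have [z0|z0] := eqVneq (enorm (z : 'rV[R]_d)) 0; first by exists 0%N => //; left.
  have t0 : 0 < truncated_sqr 1 z.
    rewrite lt_min ltr01/= divr_gt0 ?exprn_gt0//.
    by rewrite lt_neqAle eq_sym z0 enorm_ge0.
  have [n _ /(_ n (leqnn n)) /= nt] := near_infty_natSinv_lt (PosNum t0).
  by exists n => //; right; exact: ltW.
move=> n; split; first exact: measurableU.
apply: (@le_lt_trans _ _ (N Z + N (G n))%E); first exact: measureU2.
rewrite Z0; have [-> _] := HN; rewrite add0e.
have c0 : 0 < n.+1%:R^-1 :> R by rewrite invr_gt0.
have : ((n.+1%:R^-1)%:E * N (G n) < +oo)%E.
  apply: (@le_lt_trans _ _ (\int[N]_z (truncated_sqr 1 z)%:E)%E); last first.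
    by rewrite -EFin_Rintegral// ltry.
  apply: (@le_trans _ _ (\int[N]_(z in G n) (truncated_sqr 1 z)%:E)%E).
    rewrite -integral_cst//.
    apply: ge0_le_integral => //; first by move=> z _; rewrite lee_fin ltW.
    by apply/measurable_EFinP/measurable_funTS; exact: measurable_truncated_sqr.
  apply: ge0_subset_integral => //.
  - by apply/measurable_EFinP; exact: measurable_truncated_sqr.
  - by move=> z _; rewrite lee_fin truncated_sqr_ge0.
rewrite !ltey; apply: contra => /eqP ->.
by rewrite gt0_muley// lte_fin.
Qed.

HB.instance Definition _ :=
  @Measure_isSigmaFinite.Build _ _ _ N' N'_sigma_finite.

End levy_measure_theory.

(** * The function h and its inverse *)

Section levy_h_theory.
Context {R : realType} {d : nat}.
Variables (A : 'M[R]_d) (N : {measure set (Rvec R d) -> \bar R}).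
Hypothesis HN : levy_measure N.
Hypothesis h_unbounded : levy_h_unbounded A N.
Local Notation h := (levy_h A N).
Implicit Types (r s u : R).

Lemma levy_hE r : h r = r ^- 2 * opnorm A + \int[N]_z truncated_sqr r z.
Proof. by []. Qed.

Lemma levy_h_ge0 r : 0 <= h r.
Proof.
rewrite levy_hE addr_ge0 ?mulr_ge0 ?opnorm_ge0 ?invr_ge0 ?sqr_ge0//.
by apply: Rintegral_ge0 => z _; exact: truncated_sqr_ge0.
Qed.

Lemma levy_h_anti r s : 0 < r -> r <= s -> h s <= h r.
Proof.
move=> r0 rs; have s0 := lt_le_trans r0 rs; rewrite !levy_hE lerD//.
  rewrite ler_wpM2r ?opnorm_ge0// lef_pV2 ?posrE ?exprn_gt0//.
  by rewrite ler_pXn2r ?nnegrE ?(ltW r0) ?(ltW s0).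
apply: le_Rintegral => //; [exact: rintegrable_truncated_sqr|exact: rintegrable_truncated_sqr|].
by move=> z _; exact: truncated_sqr_anti.
Qed.

Lemma levy_h_scale r s : 0 < r -> r <= s -> h r <= (s / r) ^+ 2 * h s.
Proof.
move=> r0 rs; have s0 := lt_le_trans r0 rs; rewrite !levy_hE mulrDr lerD//.
  rewrite mulrA ler_wpM2r ?opnorm_ge0// !expr2 le_eqVlt; apply/orP; left.
  by apply/eqP; field; rewrite !gt_eqF.
rewrite -RintegralZl//; last exact: rintegrable_truncated_sqr.
apply: le_Rintegral => //; first exact: rintegrable_truncated_sqr.
  by apply: rintegrableZ; exact: rintegrable_truncated_sqr.
by move=> z _; exact: truncated_sqr_scale.
Qed.

Lemma levy_h_gt_near0 (M : R) : exists2 r, 0 < r & M < h r.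
Proof.
have /cvgryPgt/(_ M) := h_unbounded.
move=> /nbhs_ballP[e /= e0 He].
exists (e / 2); first by rewrite divr_gt0.
apply: He => /=; last by rewrite divr_gt0.
by rewrite -ball_normE/= sub0r normrN gtr0_norm ?divr_gt0// ltr_pdivrMr// ltr_pMr// ltr1n.
Qed.

(** As a function of r^{-2}, h is concave, each integrand being min(1, |z|^2 r^{-2}). If h r = h s,
    the slope inequality with ratio [c] between the points s, r and q < r gives h q <= h r, against
    the choice of q by h(0+) = oo. *)
Lemma levy_h_lt r s : 0 < r -> r < s -> h s < h r.
Proof.
move=> r0 rs; have s0 := lt_trans r0 rs.
rewrite lt_neqAle levy_h_anti ?ltW// andbT; apply/eqP => hrs.
have [q q0 hq] := levy_h_gt_near0 (h r).
have qr : q < r.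
  by rewrite ltNge; apply/negP => rq; move: hq; rewrite ltNge levy_h_anti.
pose c := (q ^- 2 - r ^- 2) / (r ^- 2 - s ^- 2).
have d1 : 0 < r ^- 2 - s ^- 2.
  by rewrite subr_gt0 ltf_pV2 ?posrE ?exprn_gt0// ltr_pXn2r ?nnegrE ?(ltW r0) ?(ltW s0).
have d2 : 0 < q ^- 2 - r ^- 2.
  by rewrite subr_gt0 ltf_pV2 ?posrE ?exprn_gt0// ltr_pXn2r ?nnegrE ?(ltW r0) ?(ltW q0).
have c0 : 0 < c by rewrite divr_gt0.
suff : h q - h r <= c * (h r - h s).
  by rewrite hrs subrr mulr0 subr_le0 leNgt hq.
have E r1 r2 : 0 < r1 -> 0 < r2 -> h r1 - h r2 = (r1 ^- 2 - r2 ^- 2) * opnorm A +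
    \int[N]_z (truncated_sqr r1 z - truncated_sqr r2 z).
  move=> h1 h2; rewrite RintegralB//; [|exact: rintegrable_truncated_sqr..].
  by rewrite !levy_hE; ring.
have ti r1 : 0 < r1 -> rintegrable N (truncated_sqr r1) by exact: rintegrable_truncated_sqr.
rewrite !E// mulrDr -RintegralZl//; last by apply: rintegrableB; exact: ti.
rewrite lerD//; first by rewrite mulrA /c divfK ?gt_eqF.
apply: le_Rintegral => //; [by apply: rintegrableB; exact: ti| |].
  by apply: rintegrableZ; apply: rintegrableB; exact: ti.
move=> z _; rewrite !truncated_sqrE//.
have [zr|rz] := ltP (enorm (z : 'rV[R]_d)) r; last first.
  rewrite ltNge (ltW (lt_le_trans qr rz))/= subrr.
  rewrite mulr_ge0 ?(ltW c0)// subr_ge0; case: ifPn => [zs|//].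
  by rewrite ler_pdivrMr ?exprn_gt0// mul1r ler_pXn2r ?nnegrE ?enorm_ge0 ?(ltW s0) ?(ltW zs).
rewrite (lt_trans zr rs); set v := enorm _ ^+ 2.
have -> : c * (v / r ^+ 2 - v / s ^+ 2) = (c * (r ^- 2 - s ^- 2)) * v by rewrite -!mulrBr; ring.
rewrite /c divfK ?gt_eqF// mulrBl; apply: lerB; last by rewrite mulrC.
by case: ifPn => zq; [rewrite mulrC|rewrite -ler_pdivrMl ?invr_gt0 ?exprn_gt0// invrK mulr1 ler_pXn2r ?nnegrE ?enorm_ge0 ?(ltW q0)// leNgt].
Qed.

Lemma levy_h_gt0 r : 0 < r -> 0 < h r.
Proof.
move=> r0; rewrite (le_lt_trans (levy_h_ge0 (r + 1)))// levy_h_lt//.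
by rewrite ltrDl.
Qed.

Lemma levy_h_le_iff r s : 0 < r -> 0 < s -> (h r <= h s) = (s <= r).
Proof.
move=> r0 s0; apply/idP/idP => [|sr]; last exact: levy_h_anti.
by apply: contraTT; rewrite -!ltNge => rs; exact: levy_h_lt.
Qed.

Lemma levy_h_lt_iff r s : 0 < r -> 0 < s -> (h r < h s) = (s < r).
Proof. by move=> r0 s0; rewrite !ltNge levy_h_le_iff. Qed.

Lemma levy_h_cvg0 (e : R) : 0 < e -> exists2 r, 0 < r & h r <= e.
Proof.
move=> e0.
have c1 : h n.+1%:R @[n --> \oo] --> 0.
  have -> : 0 = 0 * opnorm A + \int[N]_z 0.
    by rewrite mul0r add0r /Rintegral integral0.
  apply: cvgD.
    apply: cvgMr_tmp.
    have := cvgM (@cvg_harmonic R) (@cvg_harmonic R); rewrite mul0r => H.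
    by under eq_fun do rewrite -exprVn expr2; exact: H.
  apply: (dominated_Rintegral (g := truncated_sqr 1)).
  - by move=> n; exact: measurable_truncated_sqr.
  - move=> z; apply: (@squeeze_cvgr _ _ _ _ (fun=> 0) (fun n => enorm (z : 'rV[R]_d) ^+ 2 * (n.+1%:R^-1 * n.+1%:R^-1))).
    + apply: nearW => n; rewrite truncated_sqr_ge0/= /truncated_sqr ge_min.
      by rewrite -invfM -expr2 lexx orbT.
    + exact: cvg_cst.
    + have := cvgM (@cvg_harmonic R) (@cvg_harmonic R); rewrite mul0r => H.
      by rewrite -(mulr0 (enorm (z : 'rV[R]_d) ^+ 2)); apply: cvgMl_tmp; exact: H.
  - by move=> n z; rewrite ger0_norm ?truncated_sqr_ge0// truncated_sqr_anti// ler1n.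
  - exact: rintegrable_truncated_sqr.
have /cvgr_lt/(_ e e0)[n _ Hn] := c1.
by exists n.+1%:R => //; apply/ltW/Hn => /=.
Qed.

Lemma levy_h_continuous r : 0 < r -> {for r, continuous h}.
Proof.
(* Monotonicity on one side and the scaling bound on the other give |h s - h r| <= h r |1 - (r /
   s)^2| for s near r. *)
move=> r0; pose D s := `|1 - (r / s) ^+ 2|.
have D0 : D s @[s --> r] --> 0.
  have -> : 0 = `|1 - (r / r) ^+ 2| by rewrite divff ?gt_eqF// expr1n subrr normr0.
  apply: cvg_norm; apply: cvgB; first exact: cvg_cst.
  have H : r / s @[s --> r] --> r / r.
    by apply: cvgMl_tmp; apply: cvgV; [rewrite gt_eqF|exact: cvg_id].
  by rewrite expr2; under eq_fun do rewrite expr2; exact: cvgM.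
apply: (@squeeze_cvgr _ _ _ _ (fun s => h r * (1 - D s)) (fun s => h r * (1 + D s))).
- near=> s.
  have s0 : 0 < s by near: s; exact: lt_nbhsr.
  have hr0 := levy_h_ge0 r; have hs0 := levy_h_ge0 s.
  have q0 : 0 < (r / s) ^+ 2 by rewrite exprn_gt0// divr_gt0.
  have [rs|/ltW sr] := leP r s.
    have h1 := levy_h_anti r0 rs; have h2 := levy_h_scale r0 rs.
    have q1 : (r / s) ^+ 2 <= 1.
      have rs1 : r / s <= 1 by rewrite ler_pdivrMr// mul1r.
      by rewrite exprn_ile1// ltW// divr_gt0.
    have E : (r / s) ^+ 2 * (s / r) ^+ 2 = 1.
      by rewrite -exprMn mulrA divfK ?gt_eqF// divff ?gt_eqF// expr1n.
    have := ler_wpM2l (ltW q0) h2; rewrite mulrA E mul1r => h3.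
    by rewrite /D ger0_norm ?subr_ge0//; apply/andP; split; nra.
  have h1 := levy_h_anti s0 sr; have h2 := levy_h_scale s0 sr.
  have q1 : 1 <= (r / s) ^+ 2.
    by apply: exprn_ege1; rewrite ler_pdivlMr// mul1r.
  by rewrite /D ler0_norm ?subr_le0//; apply/andP; split; nra.
- rewrite -[X in _ --> X]mulr1 -[X in _ * X]subr0.
  by apply: cvgMl_tmp; apply: cvgB => //; exact: cvg_cst.
- rewrite -[X in _ --> X]mulr1 -[X in _ * X]addr0.
  by apply: cvgMl_tmp; apply: cvgD => //; exact: cvg_cst.
Unshelve. all: by end_near. Qed.

Lemma levy_h_surj u : 0 < u -> exists2 r, 0 < r & h r = u.
Proof.
move=> u0.
have [a a0 ua] := levy_h_gt_near0 u.
have [b b0 bu] := levy_h_cvg0 u0.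
have ab : a <= b by rewrite -levy_h_le_iff// (le_trans bu)// ltW.
have [||r rab hr] := @IVT R h a b u ab.
- apply: continuous_in_subspaceT => r; rewrite inE/= in_itv/= => /andP[ar _].
  exact/levy_h_continuous/(lt_le_trans a0).
- by rewrite min_r ?max_l ?bu ?(ltW ua)// levy_h_anti.
by exists r => //; move: rab; rewrite in_itv/= => /andP[/(lt_le_trans a0)].
Qed.

Lemma levy_h_invP u : 0 < u -> 0 < levy_h_inv A N u /\ h (levy_h_inv A N u) = u.
Proof.
move=> /levy_h_surj[r r0 hr].
by have := @xgetPex _ 0 [set r | 0 < r /\ h r = u]; apply; exists r.
Qed.

Lemma levy_h_invK r : 0 < r -> levy_h_inv A N (h r) = r.
Proof.
move=> r0; have [i0 hi] := levy_h_invP (levy_h_gt0 r0).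
by apply/eqP; rewrite eq_le -(levy_h_le_iff r0 i0) -(levy_h_le_iff i0 r0) hi lexx.
Qed.

End levy_h_theory.

(** * Real and imaginary parts of the exponent, and change of truncation *)

Section exponent.
Context {R : realType} {d : nat}.
Variables (A : 'M[R]_d) (N : {measure set (Rvec R d) -> \bar R}) (b : 'rV[R]_d).
Hypothesis HT : levy_triplet A N.
Local Notation h := (levy_h A N).
Local Notation mu := (@lebesgue_measure R).
Implicit Types (x y : 'rV[R]_d) (z : Rvec R d) (r s : R).

Let HN : levy_measure N. Proof. by case: HT. Qed.
Let psdA x : 0 <= dotv x (matvec A x). Proof. by case: HT. Qed.

Lemma Re_cexpi (u : R) : complex.Re (cexp ('i%C * u%:C)%C) = cos u.
Proof. by rewrite /cexp /= !(mul0r, mulr0, mul1r, add0r, subr0, oppr0, expR0). Qed.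

Lemma Im_cexpi (u : R) : complex.Im (cexp ('i%C * u%:C)%C) = sin u.
Proof. by rewrite /cexp /= !(mul0r, mulr0, mul1r, add0r, subr0, oppr0, expR0). Qed.

Definition re_psi x : R := dotv x (matvec A x) + \int[N]_z (1 - cos (dotv x z)).

(** What is left of the imaginary part of Psi once the drift is taken at truncation level r, see
    [Im_Psi_drift]; unlike Im Psi it is controlled by h(r), see [im_psi_le]. *)
Definition im_psi r x : R :=
  - \int[N]_z (sin (dotv x z) - dotv x z * (enorm (z : 'rV[R]_d) < r)%R%:R).

Lemma onemcos_dotv_le r x z : 0 < r ->
  1 - cos (dotv x z) <= 2 * (1 + (enorm x * r) ^+ 2) * truncated_sqr r z.
Proof.
move=> r0; rewrite truncated_sqrE//; have s0 := sqr_ge0 (enorm x * r).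
case: ifPn => _; last first.
  by rewrite mulr1 (le_trans (onemcos_le2 _))//; lra.
have -> : 2 * (1 + (enorm x * r) ^+ 2) * (enorm (z : 'rV[R]_d) ^+ 2 / r ^+ 2) =
   2 * (enorm (z : 'rV[R]_d) ^+ 2 / r ^+ 2) + 2 * (enorm x * enorm (z : 'rV[R]_d)) ^+ 2.
  by rewrite !expr2; field; rewrite gt_eqF.
have h1 := onemcos_le_sqr (dotv x z).
have h2 : dotv x z ^+ 2 <= (enorm x * enorm (z : 'rV[R]_d)) ^+ 2.
  rewrite -real_normK ?num_real// ler_pXn2r ?nnegrE ?mulr_ge0 ?enorm_ge0//.
  exact: dotv_le_enorm.
have h3 : 0 <= enorm (z : 'rV[R]_d) ^+ 2 / r ^+ 2 by rewrite divr_ge0 ?sqr_ge0.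
have h4 := sqr_ge0 (dotv x z).
lra.
Qed.

Lemma measurable_onemcos_dotv x : measurable_fun setT (fun z => 1 - cos (dotv x z)).
Proof.
apply: measurable_funB => //.
exact: (measurableT_comp (@measurable_cos R) (measurable_dotv x)).
Qed.

Lemma rintegrable_onemcos_dotv x : rintegrable N (fun z => 1 - cos (dotv x z)).
Proof.
have := rintegrableZ (2 * (1 + (enorm x * 1) ^+ 2)) (rintegrable_truncated_sqr HN ltr01).
apply: le_rintegrable; first exact: measurable_onemcos_dotv.
by move=> z; rewrite ger0_norm ?onemcos_ge0// onemcos_dotv_le.
Qed.

Lemma compensated_sin_le r x z : 0 < r ->
  `|sin (dotv x z) - dotv x z * (enorm (z : 'rV[R]_d) < r)%R%:R| <=
  (1 + (enorm x * r) ^+ 2) * truncated_sqr r z.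
Proof.
move=> r0; rewrite truncated_sqrE//; have s0 := sqr_ge0 (enorm x * r).
case: ifPn => _; last first.
  by rewrite mulr1 mulr0 subr0 (le_trans (sin_max _))//; lra.
have -> : (1 + (enorm x * r) ^+ 2) * (enorm (z : 'rV[R]_d) ^+ 2 / r ^+ 2) =
   (enorm (z : 'rV[R]_d) ^+ 2 / r ^+ 2) + (enorm x * enorm (z : 'rV[R]_d)) ^+ 2.
  by rewrite !expr2; field; rewrite gt_eqF.
rewrite mulr1; have h1 := normr_sinB_le (dotv x z).
have h2 : dotv x z ^+ 2 <= (enorm x * enorm (z : 'rV[R]_d)) ^+ 2.
  rewrite -real_normK ?num_real// ler_pXn2r ?nnegrE ?mulr_ge0 ?enorm_ge0//.
  exact: dotv_le_enorm.
have h3 : 0 <= enorm (z : 'rV[R]_d) ^+ 2 / r ^+ 2 by rewrite divr_ge0 ?sqr_ge0.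
lra.
Qed.

Lemma measurable_enorm_lt r :
  measurable_fun setT (fun z => (enorm (z : 'rV[R]_d) < r)%R%:R : R).
Proof.
have mB : measurable ([set z | enorm (z : 'rV[R]_d) < r] : set (Rvec R d)).
  have := @measurable_enorm R d measurableT `]-oo, r[%classic.
  rewrite setTI (_ : _ @^-1` _ = [set z | enorm (z : 'rV[R]_d) < r]); first by apply.
  by apply/seteqP; split => z /=; rewrite in_itv.
rewrite (_ : (fun z => _) = \1_[set z : Rvec R d | enorm (z : 'rV[R]_d) < r]).
  exact: measurable_indic.
apply/funext => z; rewrite indicE.
by have [zr|/negP zr] := boolP (enorm (z : 'rV[R]_d) < r); [rewrite mem_set|rewrite memNset].
Qed.

Lemma rintegrable_compensated_sin r x : 0 < r ->
  rintegrable N (fun z => sin (dotv x z) - dotv x z * (enorm (z : 'rV[R]_d) < r)%R%:R).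
Proof.
move=> r0.
have := rintegrableZ (1 + (enorm x * r) ^+ 2) (rintegrable_truncated_sqr HN r0).
apply: le_rintegrable.
  apply: measurable_funB.
    exact: (measurableT_comp (@measurable_sin R) (measurable_dotv x)).
  by apply: measurable_funM; [exact: measurable_dotv|exact: measurable_enorm_lt].
by move=> z; exact: compensated_sin_le.
Qed.

Lemma Re_Psi x : complex.Re (Psi A N b x) = re_psi x.
Proof.
rewrite /Psi /re_psi /= !(mul0r, mulr0, subr0); congr (_ + _).
have -> : \int[N]_z (1 - cos (dotv x z)) = - \int[N]_z (-1 * (1 - cos (dotv x z))).
  by rewrite RintegralZl ?mulN1r ?opprK//; exact: rintegrable_onemcos_dotv.
congr -%R; apply: eq_Rintegral => z _.
by rewrite !(mul0r, mulr0, mul1r, add0r, subr0, oppr0, expR0); ring.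
Qed.

Lemma Im_Psi x : complex.Im (Psi A N b x) = - dotv x b + im_psi 1 x.
Proof.
rewrite /Psi /im_psi /= !(mul0r, mulr0, subr0, add0r, mul1r); congr (_ - _).
apply: eq_Rintegral => z _.
by rewrite !(mul0r, mulr0, mul1r, add0r, subr0, oppr0, expR0).
Qed.

Lemma truncation_diff_le r s z i : 0 < r -> r <= s ->
  `|(z : 'rV[R]_d) 0 i * ((enorm (z : 'rV[R]_d) < s)%R%:R - (enorm (z : 'rV[R]_d) < r)%R%:R)|
    <= s * truncated_sqr r z.
Proof.
move=> r0 rs; have s0 := lt_le_trans r0 rs; rewrite truncated_sqrE//.
case: ifPn => zr.
  rewrite (lt_le_trans zr rs) subrr mulr0 normr0.
  by rewrite mulr_ge0 ?(ltW s0)// divr_ge0 ?sqr_ge0.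
rewrite subr0 mulr1 normrM [X in _ * X]ger0_norm ?ler0n//.
case: (boolP (enorm _ < s)) => zs; last by rewrite mulr0 ltW.
by rewrite mulr1 (le_trans (coord_le_enorm _ _))// ltW.
Qed.

Lemma measurable_truncation_diff r s i : measurable_fun setT (fun z =>
  (z : 'rV[R]_d) 0 i * ((enorm (z : 'rV[R]_d) < s)%R%:R - (enorm (z : 'rV[R]_d) < r)%R%:R)).
Proof.
apply: measurable_funM; first exact: measurable_coord.
by apply: measurable_funB; exact: measurable_enorm_lt.
Qed.

Lemma rintegrable_truncation_diff r s i : 0 < r -> 0 < s -> rintegrable N (fun z =>
  (z : 'rV[R]_d) 0 i * ((enorm (z : 'rV[R]_d) < s)%R%:R - (enorm (z : 'rV[R]_d) < r)%R%:R)).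
Proof.
move=> r0 s0; have [rs|/ltW sr] := leP r s.
  have := rintegrableZ s (rintegrable_truncated_sqr HN r0).
  apply: le_rintegrable; first exact: measurable_truncation_diff.
  by move=> z; exact: truncation_diff_le.
have := rintegrableZ r (rintegrable_truncated_sqr HN s0).
apply: le_rintegrable; first exact: measurable_truncation_diff.
move=> z; rewrite -normrN -mulrN opprB; exact: truncation_diff_le.
Qed.

(** Only jumps with r <= |z| < s contribute; each is smaller than s, and [truncated_sqr r] equals 1
    on them, so their total mass is at most h r. *)
Lemma drift_diff_le r s i : 0 < r -> r <= s ->
  `|drift N b s 0 i - drift N b r 0 i| <= s * h r.
Proof.
move=> r0 rs; have s0 := lt_le_trans r0 rs.
have -> : drift N b s 0 i - drift N b r 0 i = \int[N]_z ((z : 'rV[R]_d) 0 i *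
    ((enorm (z : 'rV[R]_d) < s)%R%:R - (enorm (z : 'rV[R]_d) < r)%R%:R)).
  rewrite !mxE opprD addrACA subrr add0r -RintegralB//; last 2 first.
  - exact: rintegrable_truncation_diff.
  - exact: rintegrable_truncation_diff.
  by apply: eq_Rintegral => z _; ring.
apply: le_trans (le_normr_Rintegral measurableT (rintegrable_truncation_diff i r0 s0)) _.
apply: (@le_trans _ _ (\int[N]_z (s * truncated_sqr r z))).
  apply: le_Rintegral => //.
  - by apply: integrable_norm => //; exact: rintegrable_truncation_diff.
  - by apply: rintegrableZ; exact: rintegrable_truncated_sqr.
  - by move=> z _; exact: truncation_diff_le.
rewrite RintegralZl//; last exact: rintegrable_truncated_sqr.
rewrite ler_wpM2l ?(ltW s0)// levy_hE lerDr.
by rewrite mulr_ge0 ?opnorm_ge0// invr_ge0 sqr_ge0.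
Qed.

Lemma Im_Psi_drift r x : 0 < r ->
  complex.Im (Psi A N b x) + dotv x (drift N b r) = im_psi r x.
Proof.
move=> r0; rewrite Im_Psi.
have -> : dotv x (drift N b r) = dotv x b + \int[N]_z (dotv x z *
    ((enorm (z : 'rV[R]_d) < r)%R%:R - (enorm (z : 'rV[R]_d) < 1)%R%:R)).
  (* The drift is defined coordinatewise, so the integral of <x, z> over the shell is split into
     coordinates. *)
  have -> : \int[N]_z (dotv x z *
      ((enorm (z : 'rV[R]_d) < r)%R%:R - (enorm (z : 'rV[R]_d) < 1)%R%:R)) =
    \sum_i x 0 i * \int[N]_z ((z : 'rV[R]_d) 0 i *
      ((enorm (z : 'rV[R]_d) < r)%R%:R - (enorm (z : 'rV[R]_d) < 1)%R%:R)).
    rewrite /Rintegral.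
    have -> : (\int[N]_z (dotv x z * ((enorm (z : 'rV[R]_d) < r)%R%:R - (enorm (z : 'rV[R]_d) < 1)%R%:R))%:E
      = \int[N]_z \sum_i (x 0 i * ((z : 'rV[R]_d) 0 i *
         ((enorm (z : 'rV[R]_d) < r)%R%:R - (enorm (z : 'rV[R]_d) < 1)%R%:R)))%:E)%E.
      apply: eq_integral => z _; rewrite sumEFin; congr EFin.
      by rewrite /dotv mulr_suml; apply: eq_bigr => i _; rewrite mulrA.
    rewrite integral_sum//; last first.
      by move=> i; apply: rintegrableZ; exact: rintegrable_truncation_diff.
    have -> : (\sum_(i < d) \int[N]_z (x 0 i * ((z : 'rV[R]_d) 0 i *
         ((enorm (z : 'rV[R]_d) < r)%R%:R - (enorm (z : 'rV[R]_d) < 1)%R%:R)))%:E =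
      \sum_(i < d) (x 0 i * \int[N]_z ((z : 'rV[R]_d) 0 i *
      ((enorm (z : 'rV[R]_d) < r)%R%:R - (enorm (z : 'rV[R]_d) < 1)%R%:R)))%:E)%E.
      apply: eq_bigr => i _; rewrite -EFin_Rintegral; last first.
        by apply: rintegrableZ; exact: rintegrable_truncation_diff.
      by rewrite RintegralZl//; exact: rintegrable_truncation_diff.
    by rewrite sumEFin.
  by rewrite -big_split; apply: eq_bigr => i _; rewrite !mxE mulrDr.
have i1 := rintegrable_compensated_sin x ltr01.
have i2 := rintegrable_compensated_sin x r0.
rewrite /im_psi.
have -> : \int[N]_z (dotv x z * ((enorm (z : 'rV[R]_d) < r)%R%:R - (enorm (z : 'rV[R]_d) < 1)%R%:R))
  = \int[N]_z (sin (dotv x z) - dotv x z * (enorm (z : 'rV[R]_d) < 1)%R%:R) -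
    \int[N]_z (sin (dotv x z) - dotv x z * (enorm (z : 'rV[R]_d) < r)%R%:R).
  by rewrite -RintegralB//; apply: eq_Rintegral => z _; ring.
ring.
Qed.

Lemma re_psi_ge0 x : 0 <= re_psi x.
Proof.
rewrite addr_ge0//; apply: Rintegral_ge0 => z _; exact: onemcos_ge0.
Qed.

Lemma re_psi_le r x : 0 < r -> re_psi x <= 2 * (1 + (enorm x * r) ^+ 2) * h r.
Proof.
move=> r0; rewrite /re_psi levy_hE mulrDr lerD//.
  apply: le_trans (quadratic_form_le _ _) _.
  have -> : 2 * (1 + (enorm x * r) ^+ 2) * (r ^- 2 * opnorm A) =
    2 * (r ^- 2 * opnorm A) + 2 * (opnorm A * enorm x ^+ 2).
    by rewrite !expr2; field; rewrite gt_eqF.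
  have h1 : 0 <= opnorm A * enorm x ^+ 2 by rewrite mulr_ge0 ?opnorm_ge0 ?sqr_ge0.
  have h2 : 0 <= r ^- 2 * opnorm A by rewrite mulr_ge0 ?opnorm_ge0 ?invr_ge0 ?sqr_ge0.
  lra.
rewrite -RintegralZl//; last exact: rintegrable_truncated_sqr.
apply: le_Rintegral => //; first exact: rintegrable_onemcos_dotv.
  by apply: rintegrableZ; exact: rintegrable_truncated_sqr.
by move=> z _; exact: onemcos_dotv_le.
Qed.

Lemma im_psi_le r x : 0 < r -> `|im_psi r x| <= (1 + (enorm x * r) ^+ 2) * h r.
Proof.
move=> r0; rewrite /im_psi normrN.
apply: le_trans (le_normr_Rintegral measurableT (rintegrable_compensated_sin x r0)) _.
apply: (@le_trans _ _ (\int[N]_z ((1 + (enorm x * r) ^+ 2) * truncated_sqr r z))).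
  apply: le_Rintegral => //.
  - by apply: integrable_norm => //; exact: rintegrable_compensated_sin.
  - by apply: rintegrableZ; exact: rintegrable_truncated_sqr.
  - by move=> z _; exact: compensated_sin_le.
rewrite RintegralZl//; last exact: rintegrable_truncated_sqr.
rewrite ler_wpM2l ?addr_ge0 ?sqr_ge0// levy_hE lerDr.
by rewrite mulr_ge0 ?opnorm_ge0// invr_ge0 sqr_ge0.
Qed.

Lemma re_psiD x y : re_psi (x + y) <= 2 * re_psi x + 2 * re_psi y.
Proof.
have qD := quadratic_formD_le psdA x y.
have [ix iy] := (rintegrable_onemcos_dotv x, rintegrable_onemcos_dotv y).
have : \int[N]_z (1 - cos (dotv (x + y) z)) <=
   2 * \int[N]_z (1 - cos (dotv x z)) + 2 * \int[N]_z (1 - cos (dotv y z)).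
  rewrite -!RintegralZl// -RintegralD//; [|exact: rintegrableZ|exact: rintegrableZ].
  apply: le_Rintegral => //; first exact: rintegrable_onemcos_dotv.
    by apply: rintegrableD; exact: rintegrableZ.
  by move=> z _; rewrite dotvDl onemcosD.
rewrite /re_psi; lra.
Qed.

Lemma re_psiMn n x : re_psi (n%:R *: x) <= n%:R ^+ 2 * re_psi x.
Proof.
rewrite /re_psi mulrDr matvecZ dotvZl dotvZr mulrA -expr2 lerD2l.
have ix := rintegrable_onemcos_dotv x.
rewrite -RintegralZl//; apply: le_Rintegral => //.
- exact: rintegrable_onemcos_dotv.
- exact: rintegrableZ.
- by move=> z _; rewrite dotvZl onemcosMn.
Qed.

End exponent.

(** * Comparison of h and Psi* *)

Section psi_star.
Context {R : realType} {d : nat}.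
Variables (A : 'M[R]_d) (N : {measure set (Rvec R d) -> \bar R}) (b : 'rV[R]_d).
Hypothesis HT : levy_triplet A N.
Local Notation h := (levy_h A N).
Local Notation mu := (@lebesgue_measure R).
Local Notation psi := (re_psi A N).
Local Notation psis := (Psi_star A N b).
Implicit Types (x y : 'rV[R]_d) (z : Rvec R d) (r s u : R).

Let HN : levy_measure N. Proof. by case: HT. Qed.
Let symA : A^T = A. Proof. by case: HT. Qed.
Let psdA x : 0 <= dotv x (matvec A x). Proof. by case: HT. Qed.

Let enorm0 : enorm (0 : 'rV[R]_d) = 0.
Proof. by rewrite /enorm dotv0l sqrtr0. Qed.

Lemma re_psi_le_h s x : 0 < s -> enorm x <= s -> psi x <= 4 * h s^-1.
Proof.
move=> s0 xs; have r0 : 0 < s^-1 by rewrite invr_gt0.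
apply: le_trans (re_psi_le HT x r0) _; rewrite ler_wpM2r ?levy_h_ge0//.
have : (enorm x * s^-1) ^+ 2 <= 1.
  by rewrite exprn_ile1 ?mulr_ge0 ?enorm_ge0 ?(ltW r0)// ler_pdivrMr// mul1r.
lra.
Qed.

Lemma re_psi_le_star s x : enorm x <= s -> psi x <= psis s.
Proof.
move=> xs; apply: ub_le_sup; last by exists x => //; rewrite (Re_Psi b HT).
have s0 : 0 < s + 1 by rewrite ltr_pwDr// (le_trans (enorm_ge0 x)).
exists (4 * h (s + 1)^-1) => _ [y ys <-]; rewrite Re_Psi//.
by rewrite re_psi_le_h// (le_trans ys)// lerDl.
Qed.

Lemma psi_star_le s (M : R) : 0 <= s ->
  (forall x, enorm x <= s -> psi x <= M) -> psis s <= M.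
Proof.
move=> s0 H; apply: ge_sup.
  by exists (complex.Re (Psi A N b 0)); exists 0 => //=; rewrite enorm0.
by move=> _ [x xs <-]; rewrite Re_Psi// H.
Qed.

Lemma psi_star_ge0 s : 0 <= s -> 0 <= psis s.
Proof.
by move=> s0; apply: le_trans (re_psi_ge0 HT 0) _; apply: re_psi_le_star; rewrite enorm0.
Qed.

Lemma psi_star_mono s r : 0 <= s -> s <= r -> psis s <= psis r.
Proof.
move=> s0 sr; apply: psi_star_le => // x xs.
exact/re_psi_le_star/(le_trans xs).
Qed.

Lemma psi_star_le_h s : 0 < s -> psis s <= 4 * h s^-1.
Proof. by move=> s0; apply: psi_star_le => [|x]; [exact: ltW|exact: re_psi_le_h]. Qed.

(** Round |u| up to an integer n: then u x = n (u/n) x, the vector (u/n) x lies in the ball of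
    radius |x|, and [re_psiMn] costs n^2 <= (1 + |u|)^2. *)
Lemma re_psiZ u x : psi (u *: x) <= (1 + `|u|) ^+ 2 * psis (enorm x).
Proof.
pose n := (Num.truncn `|u|).+1.
have un : `|u| < n%:R by exact: truncnS_gt.
have nu : n%:R <= 1 + `|u| by rewrite -natr1 addrC lerD2l truncn_le.
have n0 : 0 < n%:R :> R by rewrite ltr0n.
have -> : u *: x = n%:R *: ((u / n%:R) *: x).
  by rewrite scalerA mulrCA divff ?mulr1// gt_eqF.
apply: le_trans (re_psiMn HT _ _) _.
have h1 : psi ((u / n%:R) *: x) <= psis (enorm x).
  apply: re_psi_le_star; rewrite enormZ ler_piMl ?enorm_ge0//.
  by rewrite normrM normfV (ger0_norm (ltW n0)) ler_pdivrMr// mul1r ltW.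
rewrite ler_pM ?sqr_ge0 ?re_psi_ge0//.
by rewrite ler_pXn2r ?nnegrE ?addr_ge0 ?(ltW n0).
Qed.

Lemma measurable_onemcos_scaled x :
  measurable_fun setT (fun zu : Rvec R d * measurableTypeR R => 1 - cos (zu.2 * dotv x zu.1)).
Proof.
apply: measurable_funB => //; apply: (measurableT_comp (@measurable_cos R)).
by apply: measurable_funM => //; exact: (measurableT_comp (measurable_dotv x)).
Qed.

Lemma integral_laplace_onemcos (v : R) :
  \int[mu]_u ((1 - cos (u * v)) * expR (- (1 * `|u|))) = 2 * (v ^+ 2 / (1 + v ^+ 2)).
Proof.
have E u : (1 - cos (u * v)) * expR (- (1 * `|u|)) =
   expR (- (1 * `|u|)) - expR (- (1 * `|u|)) * cos (0 + v * u).
  by rewrite add0r [v * u]mulrC; ring.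
under eq_Rintegral do rewrite E.
rewrite RintegralB//; [|exact: rintegrable_laplace|exact: rintegrable_laplace_cos].
rewrite Rintegral_laplace// Rintegral_laplace_cos// cos0 expr1n.
by field; rewrite gt_eqF// ltr_wpDr ?sqr_ge0.
Qed.

(** By Fubini's theorem the left side is the weighted average over u of the jump part of Re Psi (u
    x), and 64 is the bound for the weighted integral of the growth factor in [re_psiZ]. *)
Lemma expectation_laplace_psi x :
  \int[N]_z (2 * (dotv x z ^+ 2 / (1 + dotv x z ^+ 2))) <= 64 * psis (enorm x).
Proof.
pose N' : {sigma_finite_measure set (Rvec R d) -> \bar R} := levy_sigma_finite HN.
pose f (zu : Rvec R d * measurableTypeR R) := (1 - cos (zu.2 * dotv x zu.1)) * expR (- (1 * `|zu.2|)).
pose g z := 2 * (1 + enorm x ^+ 2) * truncated_sqr 1 z.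
pose k u := (1 + `|u|) ^+ 2 * expR (- (1 * `|u|)).
have mf : measurable_fun setT f.
  apply: measurable_funM; first exact: measurable_onemcos_scaled.
  by apply: (measurableT_comp (measurable_laplace 1)).
have ig : rintegrable N' g.
  by apply: rintegrableZ; exact: (rintegrable_truncated_sqr HN ltr01).
have ik : rintegrable mu k by exact: rintegrable_laplace_sqr.
have t0 := @truncated_sqr_ge0 R d 1.
have fgk z u : `|f (z, u)| <= g z * k u.
  rewrite /f /g /k/= normrM ger0_norm ?onemcos_ge0// ger0_norm ?expR_ge0// mulrA.
  rewrite ler_wpM2r ?expR_ge0//.
  have := @onemcos_dotv_le R d 1 (u *: x) z ltr01; rewrite dotvZl enormZ mulr1.
  have key : 2 * (1 + (`|u| * enorm x) ^+ 2) <= 2 * (1 + enorm x ^+ 2) * (1 + `|u|) ^+ 2.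
    have h2 := sqr_ge0 (enorm x); have h3 := normr_ge0 u.
    have h4 : 0 <= `|u| * enorm x ^+ 2 by rewrite mulr_ge0.
    by have h5 := sqr_ge0 `|u|; rewrite !expr2 in h2 h4 h5 *; lra.
  move=> /le_trans; apply; have := ler_wpM2r (t0 z) key.
  by rewrite [X in _ <= X -> _]mulrAC.
have -> : \int[N]_z (2 * (dotv x z ^+ 2 / (1 + dotv x z ^+ 2))) =
    \int[N']_z \int[mu]_u f (z, u).
  by apply: eq_Rintegral => z _; rewrite /f/= integral_laplace_onemcos.
rewrite (Rfubini mf ig ik fgk).
have E u : \int[N']_z f (z, u) = \int[N]_z (1 - cos (dotv (u *: x) z)) * expR (- (1 * `|u|)).
  rewrite -RintegralZr//; last exact: (rintegrable_onemcos_dotv HT (u *: x)).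
  by apply: eq_Rintegral => z _; rewrite /f dotvZl.
apply: (@le_trans _ _ (\int[mu]_u (psis (enorm x) * k u))).
  apply: le_Rintegral => //.
  - exact: rintegrable_inner2 mf ig ik fgk.
  - exact: rintegrableZ.
  - move=> u _; rewrite E /k mulrA ler_wpM2r ?expR_ge0// mulrC.
    by apply: le_trans (re_psiZ u x); rewrite /re_psi lerDr.
rewrite RintegralZl// mulrC ler_wpM2r ?psi_star_ge0 ?enorm_ge0//.
exact: Rintegral_laplace_sqr.
Qed.

Lemma rintegrable_laplace_psi x :
  rintegrable N (fun z => 2 * (dotv x z ^+ 2 / (1 + dotv x z ^+ 2))).
Proof.
have := rintegrableZ (2 * (1 + enorm x ^+ 2)) (rintegrable_truncated_sqr HN ltr01).
apply: le_rintegrable.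
  have c1 : continuous (fun v : R => 2 * (v ^+ 2 / (1 + v ^+ 2))).
    move=> v; have sq : (fun v : R => v ^+ 2) v @[v --> v] --> v ^+ 2 by exact: exprn_continuous.
    apply: cvgM; first exact: cvg_cst.
    apply: cvgM => //; apply: cvgV; first by rewrite gt_eqF// ltr_wpDr ?sqr_ge0.
    by apply: cvgD => //; exact: cvg_cst.
  exact: (measurableT_comp (continuous_measurable_fun c1) (measurable_dotv x)).
move=> z; set v := dotv x z ^+ 2.
have v0 : 0 <= v by exact: sqr_ge0.
have v1 : 0 < 1 + v by rewrite ltr_pwDl.
have F0 : 0 <= 2 * (v / (1 + v)) by apply: mulr_ge0 => //; apply: divr_ge0 => //; exact: ltW.
rewrite ger0_norm// -[leRHS]mulrA ler_pM2l//.
have e0 := sqr_ge0 (enorm x).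
rewrite truncated_sqrE//; case: ifPn => _; rewrite ler_pdivrMr//; last by nra.
rewrite expr1n divr1.
have : v <= enorm x ^+ 2 * enorm (z : 'rV[R]_d) ^+ 2.
  rewrite -exprMn /v -real_normK ?num_real// ler_pXn2r ?nnegrE ?mulr_ge0 ?enorm_ge0//.
  exact: dotv_le_enorm.
have z0 := sqr_ge0 (enorm (z : 'rV[R]_d)).
have h1 : 0 <= enorm x ^+ 2 * enorm (z : 'rV[R]_d) ^+ 2 by rewrite mulr_ge0.
have h2 : 0 <= enorm x ^+ 2 * enorm (z : 'rV[R]_d) ^+ 2 * v by rewrite mulr_ge0.
have h3 : 0 <= enorm (z : 'rV[R]_d) ^+ 2 * v by rewrite mulr_ge0.
by nra.
Qed.

(** The cube comes from the Gaussian part, d^2 from [opnorm_le_trace] and d from the trace; the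
    jumps cost 64 for each of the d coordinate directions. *)
Definition star_const : R := d%:R ^+ 3 + 64 * d%:R.

Lemma h_le_psi_star s : 0 < s -> h s^-1 <= star_const * psis s.
Proof.
move=> s0; rewrite levy_hE /star_const mulrDl.
have es i : enorm (s *: (delta_mx 0 i : 'rV[R]_d)) = s.
  rewrite enormZ (ger0_norm (ltW s0)) -[RHS]mulr1; congr (_ * _).
  by rewrite /enorm dotv_delta mxE !eqxx sqrtr1.
have ps0 := psi_star_ge0 (ltW s0).
apply: lerD.
  rewrite exprVn invrK.
  have h1 : s ^+ 2 * \tr A <= d%:R * psis s.
    rewrite /mxtrace mulr_sumr -[d in d%:R](card_ord d) -sum1_card natr_sum mulr_suml.
    apply: ler_sum => i _; rewrite mul1r -quadratic_form_delta.
    rewrite expr2 -mulrA -dotvZr -dotvZl -matvecZ.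
    apply: (@le_trans _ _ (psi (s *: delta_mx 0 i))).
      by rewrite /re_psi lerDl; apply: Rintegral_ge0 => z _; exact: onemcos_ge0.
    by apply: re_psi_le_star; rewrite es.
  have := ler_wpM2l (sqr_ge0 s) (opnorm_le_trace symA psdA) => h2.
  have := ler_wpM2l (sqr_ge0 (d%:R : R)) h1; rewrite !exprS expr0 => h3.
  move: h2; rewrite !expr2 in h3 *; lra.
pose F i z := 2 * (dotv (s *: delta_mx 0 i) z ^+ 2 / (1 + dotv (s *: delta_mx 0 i) z ^+ 2)).
have F0 i z : 0 <= F i z by rewrite mulr_ge0// divr_ge0 ?addr_ge0 ?sqr_ge0.
(* With v_i = s z_i: if some v_i^2 >= 1, then 2 v_i^2 / (1 + v_i^2) >= 1 already; otherwise each
   v_i^2 is at most 2 v_i^2 / (1 + v_i^2), and their sum is s^2 |z|^2. *)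
have q z : truncated_sqr s^-1 z <= \sum_i F i z.
  have [[i vi]|/forallNP nv] := pselect (exists i, 1 <= dotv (s *: delta_mx 0 i) z ^+ 2).
    apply: le_trans (truncated_sqr_le1 _ _) _; rewrite (bigD1 i)//=.
    apply: (@le_trans _ _ (F i z)); last by rewrite lerDl; apply: sumr_ge0.
    rewrite /F mulrA ler_pdivlMr; last by rewrite ltr_pwDl ?sqr_ge0.
    by rewrite mul1r; lra.
  apply: (@le_trans _ _ (enorm (z : 'rV[R]_d) ^+ 2 / s^-1 ^+ 2)); first by rewrite ge_min lexx orbT.
  rewrite exprVn invrK enorm_sqr /dotv mulr_suml; apply: ler_sum => i _.
  have {nv}/negP := nv i; rewrite -ltNge /F dotvZl dotv_delta => vi.
  rewrite mulrA ler_pdivlMr; last by rewrite ltr_pwDl ?sqr_ge0.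
  rewrite -expr2 -exprMn [_ * s]mulrC; have := sqr_ge0 (s * (z : 'rV[R]_d) 0 i); nra.
have iF i : rintegrable N (F i) by exact: rintegrable_laplace_psi.
have it : rintegrable N (truncated_sqr s^-1).
  by apply: rintegrable_truncated_sqr => //; rewrite invr_gt0.
rewrite -lee_fin EFin_Rintegral//.
apply: (@le_trans _ _ (\int[N]_z \sum_i (F i z)%:E)%E).
  apply: ge0_le_integral => //.
  - by move=> z _; rewrite lee_fin truncated_sqr_ge0.
  - by apply/measurable_EFinP; exact: rintegrable_measurable it.
  - apply: emeasurable_sum => i; apply/measurable_EFinP.
    exact: rintegrable_measurable (iF i).
  - by move=> z _; rewrite sumEFin lee_fin.
rewrite integral_sum//.
have -> : (64 * d%:R * psis s)%:E = (\sum_(i < d) (64 * psis s)%:E)%E.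
  by rewrite sumEFin sumr_const card_ord -mulr_natl; congr EFin; ring.
apply: lee_sum => i _; rewrite -EFin_Rintegral// lee_fin.
by have := expectation_laplace_psi (s *: delta_mx 0 i); rewrite es.
Qed.

End psi_star.

(** * Equivalence of the conditions *)

Section stretched_exponential.
Context {R : realType} {d : nat}.
Local Notation mu := (@lebesgue_measure R).
Local Notation tup n := (n.-tuple (measurableTypeR R)).
Local Notation lvec := (@lebesgue_vec R d).
Local Notation ltup := (@lebesgue_tuple R d).
Implicit Types (a al r v : R).

(** With n this order, al (n + 1) > 2 d + 1, the degree of the polynomial (1 + v) (1 + v^2)^d that
    has to be beaten. *)
Definition stretch_order al : nat := Num.truncn ((2 * d + 1)%N%:R / al : R).

Definition stretch_const a al : R :=
  2 ^+ d.+1 * (1 + (stretch_order al).+1`!%:R / a ^+ (stretch_order al).+1).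

Lemma stretch_const_ge a al : 0 < a -> 2 ^+ d.+1 <= stretch_const a al.
Proof.
by move=> a0; rewrite ler_peMr ?exprn_ge0// lerDl divr_ge0// exprn_ge0// ltW.
Qed.

Lemma stretched_exp_le a al v g : 0 < a -> 0 < al -> 0 <= v -> 0 <= g <= 1 ->
  (1 <= v -> g <= expR (- (a * v `^ al))) ->
  (1 + v) * (1 + v ^+ 2) ^+ d * g <= stretch_const a al.
Proof.
move=> a0 al0 v0 /andP[g0 g1] Hg.
have [v1|/ltW v1] := leP 1 v; last first.
  apply: le_trans (stretch_const_ge al a0).
  have h1 : 1 + v <= 2 by lra.
  have h2 : (1 + v ^+ 2) ^+ d <= 2 ^+ d.
    have : v ^+ 2 <= 1 by rewrite exprn_ile1.
    by move=> h; rewrite lerXn2r ?nnegrE ?addr_ge0 ?sqr_ge0//; lra.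
  rewrite [2 ^+ d.+1]exprS -[leRHS]mulr1 ler_pM// ?mulr_ge0 ?exprn_ge0 ?addr_ge0 ?sqr_ge0//.
  by rewrite ler_pM ?exprn_ge0 ?addr_ge0 ?sqr_ge0.
set n := stretch_order al; set y := a * v `^ al.
have va : 0 < v `^ al by rewrite powR_gt0// (lt_le_trans ltr01).
have y0 : 0 < y by rewrite mulr_gt0.
have fp : 0 < n.+1`!%:R :> R by rewrite ltr0n fact_gt0.
(* A single term of the exponential series: e^{-y} <= (n+1)! / y^{n+1}. *)
have hg : g <= n.+1`!%:R / y ^+ n.+1.
  apply: le_trans (Hg v1) _; rewrite expRN -invf_div lef_pV2 ?posrE ?expR_gt0 ?divr_gt0 ?exprn_gt0//.
  by apply: le_trans (expR_ge1Dxn n (ltW y0)); rewrite lerDr.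
have h1 : (1 + v) * (1 + v ^+ 2) ^+ d <= 2 ^+ d.+1 * v ^+ (2 * d + 1)%N.
  rewrite addn1 [2 ^+ d.+1]exprS [v ^+ (2 * d).+1]exprS exprM mulrACA -exprMn ler_pM ?exprn_ge0 ?addr_ge0 ?sqr_ge0//.
    lra.
  have : 1 <= v ^+ 2 by apply: exprn_ege1.
  by move=> h; rewrite lerXn2r ?nnegrE ?mulr_ge0 ?addr_ge0 ?sqr_ge0//; lra.
have h2 : v ^+ (2 * d + 1)%N <= (v `^ al) ^+ n.+1.
  rewrite -(powR_mulrn (2 * d + 1)%N) ?(le_trans ler01)// -(powR_mulrn n.+1) ?(ltW va)// -powRrM.
  apply: ler_powR => //; rewrite mulrC -ler_pdivrMr// ltW//.
  exact: truncnS_gt.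
have h3 : (1 + v) * (1 + v ^+ 2) ^+ d <= 2 ^+ d.+1 * (v `^ al) ^+ n.+1.
  by apply: le_trans h1 _; rewrite ler_wpM2l ?exprn_ge0.
apply: (@le_trans _ _ (2 ^+ d.+1 * (v `^ al) ^+ n.+1 * (n.+1`!%:R / y ^+ n.+1))).
  by rewrite ler_pM// ?mulr_ge0 ?exprn_ge0 ?addr_ge0 ?sqr_ge0.
rewrite /stretch_const -/n -mulrA ler_pM2l ?exprn_gt0// /y exprMn.
have -> : (v `^ al) ^+ n.+1 * (n.+1`!%:R / (a ^+ n.+1 * (v `^ al) ^+ n.+1)) = n.+1`!%:R / a ^+ n.+1.
  have ne1 : (v `^ al) ^+ n.+1 != 0 by rewrite gt_eqF ?exprn_gt0.
  have ne2 : a ^+ n.+1 != 0 by rewrite gt_eqF ?exprn_gt0.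
  by move: ne1 ne2; generalize ((v `^ al) ^+ n.+1) (a ^+ n.+1) (n.+1`!%:R : R) => p q f p0 q0; field; rewrite p0 q0.
by rewrite lerDr.
Qed.

(** The exponential also pays for a factor (1 + (r|z|)^2)^d, and this dominates the product of the 1
    + (r z_i)^2. The majorant is thus a product of Cauchy kernels of scale 1/r and integrates
    coordinatewise to (pi / r)^d. *)
Lemma integral_stretched_exp a al r (g : Rvec R d -> R) :
  0 < a -> 0 < al -> 0 < r -> measurable_fun setT g ->
  (forall z, 0 <= g z <= 1) ->
  (forall z : 'rV[R]_d, r^-1 <= enorm z -> g z <= expR (- (a * (r * enorm z) `^ al))) ->
  (\int[lvec]_z ((1 + r * enorm (z : 'rV[R]_d)) * g z)%:E <=
    (stretch_const a al * pi ^+ d * r ^- d)%:E)%E.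
Proof.
move=> a0 al0 r0 mg g01 Hg.
have e0 : 0 < r^-1 by rewrite invr_gt0.
have p0 := pi_gt0 R.
pose f (i : 'I_d) s := pi / r * cauchy r^-1 (s - 0).
have fE i s : f i s = (1 + (r * s) ^+ 2)^-1.
  rewrite /f subr0 /cauchy.
  have n1 : 1 + (r * s) ^+ 2 != 0 by rewrite gt_eqF// ltr_wpDr ?sqr_ge0.
  have n2 : r^-1 ^+ 2 + s ^+ 2 != 0 by rewrite gt_eqF// ltr_wpDr ?sqr_ge0// exprn_gt0.
  have r1 : r != 0 by rewrite gt_eqF.
  have p1 : pi != 0 :> R by rewrite gt_eqF.
  move: p1; generalize (pi : R) => p p1; apply: (mulIf n1); rewrite mulVf//; field.
  by rewrite r1 p1 [s * r]mulrC n1.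
have fi i : rintegrable mu (f i).
  apply: rintegrableZ; apply: ge0_rintegrable; first exact: measurable_cauchyB.
  - by move=> s; exact: cauchy_ge0.
  - by rewrite integral_cauchyB// ltry.
have If i : \int[mu]_s f i s = pi / r.
  rewrite RintegralZl//; first by rewrite /Rintegral integral_cauchyB// mulr1.
  apply: ge0_rintegrable; first exact: measurable_cauchyB.
  - by move=> s; exact: cauchy_ge0.
  - by rewrite integral_cauchyB// ltry.
have f0 i s : 0 <= f i s by rewrite fE invr_ge0 addr_ge0 ?sqr_ge0.
have C0 : 0 <= stretch_const a al by rewrite (le_trans _ (stretch_const_ge al a0))// exprn_ge0.
have mF : measurable_fun setT (fun z : Rvec R d => \prod_i f i ((z : 'rV[R]_d) 0 i)).
  apply: measurable_prod => i _.
  exact: (measurableT_comp (rintegrable_measurable (fi i)) (measurable_coord i)).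
have F0 (z : Rvec R d) : 0 <= \prod_i f i ((z : 'rV[R]_d) 0 i) by apply: prodr_ge0.
apply: (@le_trans _ _ (\int[lvec]_z ((stretch_const a al)%:E * (\prod_i f i ((z : 'rV[R]_d) 0 i))%:E))%E).
  apply: ge0_le_integral => //.
  - by move=> z _; rewrite lee_fin mulr_ge0 ?addr_ge0 ?mulr_ge0 ?enorm_ge0 ?(ltW r0)//; have /andP[] := g01 z.
  - apply/measurable_EFinP; apply: measurable_funM => //; apply: measurable_funD => //.
    by apply: measurable_funM => //; exact: measurable_enorm.
  - by apply/measurable_EFinP; apply: measurable_funM.
  - move=> z _; rewrite -EFinM lee_fin.
    set v := r * enorm (z : 'rV[R]_d).
    have v0 : 0 <= v by rewrite mulr_ge0 ?enorm_ge0 ?(ltW r0).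
    have K : 1 <= v -> g z <= expR (- (a * v `^ al)).
      by move=> v1; apply: Hg; rewrite -(ler_pM2l r0) divff ?gt_eqF.
    have := stretched_exp_le a0 al0 v0 (g01 z) K.
    have q0 : 0 < (1 + v ^+ 2) ^+ d by rewrite exprn_gt0// ltr_wpDr ?sqr_ge0.
    have /andP[gz0 _] := g01 z.
    move=> H; apply: (@le_trans _ _ (stretch_const a al * (1 + v ^+ 2) ^- d)).
      by rewrite ler_pdivlMr// mulrAC.
    rewrite ler_wpM2l// -exprVn -[in X in X <= _](card_ord d) -prodr_const.
    apply: ler_prod => i _; rewrite invr_ge0 addr_ge0 ?sqr_ge0//= fE.
    rewrite lef_pV2 ?posrE ?ltr_wpDr ?sqr_ge0// lerD2l.
    rewrite -[leLHS]real_normK ?num_real// ler_pXn2r ?nnegrE// normrM (ger0_norm (ltW r0)).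
    by rewrite ler_pM2l// coord_le_enorm.
rewrite ge0_integralZl_EFin//.
- have -> : (\int[lvec]_z (\prod_i f i ((z : 'rV[R]_d) 0 i))%:E = ((pi / r) ^+ d)%:E)%E.
    rewrite ge0_integral_vec//.
    transitivity (\int[ltup]_t (\prod_i f i (tnth t i))%:E)%E.
      by apply: eq_integral => t _; congr EFin; apply: eq_bigr => i _; rewrite mxE.
    rewrite -EFin_Rintegral ?Rintegral_prod//; last exact: rintegrable_prod.
    by under eq_bigr do rewrite If; rewrite prodr_const card_ord.
  by rewrite -EFinM expr_div_n mulrA.
- by move=> z _; rewrite lee_fin.
- exact/measurable_EFinP.
Qed.

End stretched_exponential.

(** * From doubling to power growth *)

Section doubling.
Context {R : realType}.
Variables (F : R -> R) (l q s : R).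
Hypotheses (l1 : 1 < l) (q1 : 1 < q) (s0 : 0 < s) (F0 : 0 <= F s).
Hypothesis F_mono : forall u v, s <= u -> u <= v -> F u <= F v.
Hypothesis F_doubling : forall u, s <= u -> q * F u <= F (l * u).

(** The doubling step is iterated floor(ln lam / ln l) times. The exponent solves l^k = q, and the
    factor q^{-1} pays for the incomplete last step. *)
Lemma doubling_power (lam : R) : 1 <= lam ->
  q^-1 * lam `^ (ln q / ln l) * F s <= F (lam * s).
Proof.
move=> lam1.
have l0 : 0 < l := lt_trans ltr01 l1.
have q0 : 0 < q := lt_trans ltr01 q1.
have lam0 : 0 < lam := lt_le_trans ltr01 lam1.
have L0 : 0 < ln l by rewrite ln_gt0.
have Q0 : 0 < ln q by rewrite ln_gt0.
pose n := Num.truncn (ln lam / ln l).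
have Llam0 : 0 <= ln lam / ln l by rewrite divr_ge0 ?ln_ge0// ltW.
have n1 : n%:R * ln l <= ln lam by rewrite -ler_pdivlMr// truncn_le.
have n2 : ln lam < n.+1%:R * ln l by rewrite -ltr_pdivrMr// truncnS_gt.
have ln1 : l ^+ n <= lam.
  by rewrite -[l]lnK ?posrE// -[leRHS]lnK ?posrE// -expRM_natl ler_expR.
have It k : q ^+ k * F s <= F (l ^+ k * s) /\ s <= l ^+ k * s.
  elim: k => [|k [ih sk]]; first by rewrite !expr0 !mul1r.
  split; last first.
    by rewrite ler_peMl ?(ltW s0)// exprn_ege1// ltW.
  rewrite !exprS -!mulrA; apply: le_trans (F_doubling sk).
  by rewrite ler_pM2l.
have [h1 h2] := It n.
apply: le_trans (F_mono h2 _); last by rewrite ler_pM2r.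
apply: le_trans h1; rewrite ler_wpM2r// -ler_pdivlMl ?invr_gt0// invrK -exprS.
rewrite -[lam]lnK ?posrE// -expRM -[in leRHS](lnK (x := q)) ?posrE// -expRM_natl ler_expR.
rewrite (_ : ln lam * (ln q / ln l) = ln lam / ln l * ln q); last by ring.
by rewrite ler_pM2r// ltW// truncnS_gt.
Qed.

Lemma doubling_exponent_gt0 : 0 < ln q / ln l.
Proof. by rewrite divr_gt0// ln_gt0. Qed.

(** Used with k = 2, to keep the exponent in the range (0, 2] that (C3) prescribes. *)
Lemma doubling_exponent_le (k : R) : 0 <= k -> q <= l `^ k -> ln q / ln l <= k.
Proof.
move=> k0 qk; have l0 : 0 < l := lt_trans ltr01 l1.
rewrite ler_pdivrMr ?ln_gt0// -ln_powR ler_ln// ?posrE ?powR_gt0//.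
exact: lt_trans ltr01 q1.
Qed.

End doubling.

(** * The moment bound under (C3) *)

Section conditions.
Context {R : realType} {d : nat}.
Variables (A : 'M[R]_d) (N : {measure set (Rvec R d) -> \bar R}) (b : 'rV[R]_d).
Hypothesis d_gt0 : (0 < d)%N.
Hypothesis HT : levy_triplet A N.
Hypothesis h_unbounded : levy_h_unbounded A N.
Local Notation h := (levy_h A N).
Local Notation mu := (@lebesgue_measure R).
Local Notation lvec := (@lebesgue_vec R d).
Local Notation psi := (re_psi A N).
Local Notation psis := (Psi_star A N b).
Local Notation rho t := (levy_h_inv A N t^-1).
Local Notation K := (@star_const R d).
Implicit Types (x y : 'rV[R]_d) (z : Rvec R d) (r s t u : R).

Let HN : levy_measure N. Proof. by case: HT. Qed.
Let dR : 1 <= d%:R :> R. Proof. by rewrite ler1n. Qed.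
Let dR0 : 0 < d%:R :> R. Proof. by rewrite ltr0n. Qed.

Lemma star_const_ge64 : 64 <= K.
Proof.
rewrite /star_const.
by have : 0 <= d%:R ^+ 3 :> R by []; have := dR; lra.
Qed.

Let K0 : 0 < K. Proof. exact: lt_le_trans star_const_ge64. Qed.

Lemma rho_gt0 t : 0 < t -> 0 < rho t.
Proof. by move=> t0; have [] := levy_h_invP HN h_unbounded (u := t^-1); rewrite ?invr_gt0. Qed.

Lemma h_rho t : 0 < t -> h (rho t) = t^-1.
Proof. by move=> t0; have [] := levy_h_invP HN h_unbounded (u := t^-1); rewrite ?invr_gt0. Qed.

Lemma ereal_inv_lt (T : \bar R) r : (0 < T)%E -> 0 < r -> (r%:E < T)%E ->
  (T^-1 < (r^-1)%:E)%E.
Proof.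
case: T => [T| |]//.
  rewrite !lte_fin => T0 r0 rT; rewrite inver gt_eqF// lte_fin.
  by rewrite ltf_pV2 ?posrE.
by move=> _ r0 _; rewrite invey lte_fin invr_gt0.
Qed.

(** Translates the time bound t < 1/h(T3) into the scale bound h^{-1}(1/t) < T3. For T3 = oo the
    conventions h(oo) = 0 and 1/0 = oo make both vacuous. *)
Lemma scale_lt (T3 : \bar R) t : (0 < T3)%E -> 0 < t ->
  (t%:E < (levy_h_ereal A N T3)^-1)%E -> ((rho t)%:E < T3)%E.
Proof.
move=> T30 t0; case: T3 T30 => [T| |]//; last by move=> _ _; rewrite ltry.
rewrite lte_fin /levy_h_ereal => T0.
have hT := levy_h_gt0 HN h_unbounded T0.
rewrite inver gt_eqF// !lte_fin => th.
rewrite -(levy_h_lt_iff HN h_unbounded T0 (rho_gt0 t0)) h_rho//.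
by rewrite -[h T]invrK ltf_pV2 ?posrE ?invr_gt0.
Qed.

Lemma scale_bound_gt0 (T3 : \bar R) : (0 < T3)%E -> (0 < (levy_h_ereal A N T3)^-1)%E.
Proof.
case: T3 => [T| |]//; last by move=> _; rewrite /= inve0 ltry.
rewrite lte_fin /levy_h_ereal => T0.
have hT := levy_h_gt0 HN h_unbounded T0.
by rewrite inver gt_eqF// lte_fin invr_gt0.
Qed.

Lemma measurable_re_psi_exp (k : R) : measurable_fun setT (psi : Rvec R d -> R) ->
  measurable_fun setT (fun z => expR (- k * psi z)).
Proof.
by move=> mp; apply: measurableT_comp => //; apply: measurable_funM.
Qed.

(** For r|z| >= 1 the two parts of (C3) give Re Psi z >= c3^2 (r|z|)^al Psi*(1/r), and K Psi*(1/r)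
    >= h r = 1/t. This is the origin of the rate c3^2 / K. *)
Lemma C3_bound (T3 : \bar R) (c3 al t : R) : measurable_fun setT (psi : Rvec R d -> R) ->
  cond_C3_with A N b T3 c3 al -> 0 < t -> ((rho t)%:E < T3)%E ->
  (\int[lvec]_z ((1 + rho t * enorm (z : 'rV[R]_d)) * expR (- t * psi z))%:E <=
   (@stretch_const R d (c3 ^+ 2 / K) al * pi ^+ d * rho t ^- d)%:E)%E.
Proof.
move=> mpsi [T0 /andP[c0 c1] /andP[al0 al2] H1 H2] t0 rT.
have r0 := rho_gt0 t0; set r := rho t in r0 rT *.
apply: integral_stretched_exp => //.
- by rewrite divr_gt0 ?exprn_gt0.
- exact: measurable_re_psi_exp.
- by move=> z; rewrite expR_ge0 expR_le1 mulNr oppr_le0 mulr_ge0 ?re_psi_ge0// ltW.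
move=> z rz; rewrite ler_expR mulNr lerN2.
have z0 : (T3^-1 < (enorm z)%:E)%E.
  by apply: lt_le_trans (ereal_inv_lt T0 r0 rT) _; rewrite lee_fin.
have ri0 : 0 < r^-1 by rewrite invr_gt0.
have := H1 z z0; rewrite Re_Psi// => h1.
have lam1 : 1 <= r * enorm z by rewrite -ler_pdivrMl ?mulr1.
have := H2 _ _ lam1 (ereal_inv_lt T0 r0 rT).
rewrite (_ : r * enorm z / r = enorm z); last by rewrite mulrAC divff ?mul1r// gt_eqF.
move=> h2.
have := h_le_psi_star b HT ri0; rewrite invrK /r h_rho// => h3.
have p0 : 0 <= (r * enorm z) `^ al by exact: powR_ge0.
have h4 : c3 * (c3 * (r * enorm z) `^ al * psis r^-1) <= psi z.
  by apply: le_trans h1; rewrite ler_pM2l.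
have h5 : K^-1 <= t * psis r^-1.
  have tn : t != 0 by rewrite gt_eqF.
  have Kn : K != 0 by rewrite gt_eqF.
  have -> : K^-1 = t / K * t^-1 by rewrite mulrAC divff// mul1r.
  have -> : t * psis r^-1 = t / K * (K * psis r^-1) by rewrite mulrA divfK.
  by rewrite ler_wpM2l// divr_ge0 ?ltW.
apply: le_trans (ler_wpM2l (ltW t0) h4).
have := ler_wpM2l (mulr_ge0 (mulr_ge0 (ltW c0) (ltW c0)) p0) h5.
by rewrite expr2; lra.
Qed.

End conditions.

Section equivalence.
Context {R : realType} {d : nat}.
Variables (A : 'M[R]_d) (N : {measure set (Rvec R d) -> \bar R}) (b : 'rV[R]_d).
Hypothesis d_gt0 : (0 < d)%N.
Hypothesis HT : levy_triplet A N.
Hypothesis h_unbounded : levy_h_unbounded A N.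
Local Notation h := (levy_h A N).
Local Notation mu := (@lebesgue_measure R).
Local Notation lvec := (@lebesgue_vec R d).
Local Notation psi := (re_psi A N).
Local Notation psis := (Psi_star A N b).
Local Notation rho t := (levy_h_inv A N t^-1).
Local Notation K := (@star_const R d).
Implicit Types (x y : 'rV[R]_d) (z : Rvec R d) (r s t u : R).

Let HN : levy_measure N. Proof. by case: HT. Qed.
Let dR : 1 <= d%:R :> R. Proof. by rewrite ler1n. Qed.
Let dR0 : 0 < d%:R :> R. Proof. by rewrite ltr0n. Qed.
Let K64 : 64 <= K. Proof. exact: star_const_ge64. Qed.
Let K0 : 0 < K. Proof. exact: lt_le_trans K64. Qed.

Lemma measurable_re_psi : measurable_fun setT (psi : Rvec R d -> R).
Proof.
have mdot : measurable_fun setT (fun xz : Rvec R d * Rvec R d => dotv (xz.1 : 'rV[R]_d) xz.2).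
  apply: measurable_sum => i; apply: measurable_funM.
    exact: (measurableT_comp (measurable_coord i) measurable_fst).
  exact: (measurableT_comp (measurable_coord i) measurable_snd).
apply: measurable_funD.
  apply: measurable_sum => i; apply: measurable_funM; first exact: measurable_coord.
  under eq_fun do rewrite matvecE; apply: measurable_sum => j.
  by apply: measurable_funM => //; exact: measurable_coord.
pose N' : {sigma_finite_measure set (Rvec R d) -> \bar R} := levy_sigma_finite HN.
pose f (xz : Rvec R d * Rvec R d) := (1 - cos (dotv (xz.1 : 'rV[R]_d) xz.2))%:E.
have H := @measurable_fun_fubini_tonelli_F _ _ _ _ _ N' f.
apply/measurable_EFinP.
apply: (eq_measurable_fun (fun x : Rvec R d => \int[N']_z f (x, z))%E).
  by move=> x _ /=; rewrite EFin_Rintegral//; exact: (rintegrable_onemcos_dotv HT x).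
apply: H => [|xz]; last by rewrite lee_fin onemcos_ge0.
apply/measurable_EFinP; apply: measurable_funB => //.
exact: (measurableT_comp (@measurable_cos R) mdot).
Qed.

(** Two centres differ by at least 2 eta in some coordinate, so the open cubes of half-side eta are
    disjoint and f dominates the sum of its restrictions to them. *)
Lemma cube_integral_ge (f : Rvec R d -> R) (c : nat -> 'rV[R]_d) (m : nat) (eta v : R) :
  measurable_fun setT f -> (forall z, 0 <= f z) -> 0 < eta -> 0 <= v ->
  (forall j k, (j < m)%N -> (k < m)%N -> j != k ->
     exists i, 2 * eta <= `|c j 0 i - c k 0 i|) ->
  (forall j (z : 'rV[R]_d), (j < m)%N -> (forall i, `|z 0 i - c j 0 i| < eta) -> v <= f z) ->
  ((m%:R * (v * (2 * eta) ^+ d))%:E <= \int[lvec]_z (f z)%:E)%E.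
Proof.
move=> mf f0 eta0 v0 sep fv.
pose Q j := box (fun i => c j 0 i - eta) (fun i => c j 0 i + eta).
have QP j z : Q j z <-> forall i, `|(z : 'rV[R]_d) 0 i - c j 0 i| < eta.
  by split => H i; have := H i; rewrite ltr_distl.
have mQ j : measurable (Q j) by exact: measurable_box.
have vQ j : (lvec (Q j) = ((2 * eta) ^+ d)%:E)%E.
  rewrite lebesgue_vec_box; last by move=> i; lra.
  congr EFin; under eq_bigr do rewrite opprB addrC addrA subrK -mulr2n -mulr_natl.
  by rewrite prodr_const card_ord.
have step j : (j < m)%N -> ((v * (2 * eta) ^+ d)%:E <= \int[lvec]_(z in Q j) (f z)%:E)%E.
  move=> jm; rewrite EFinM -(vQ j).
  apply: (@le_trans _ _ (\int[lvec]_(z in Q j) (cst v%:E z))%E); first by rewrite integral_cst.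
  apply: ge0_le_integral => //.
  - exact/measurable_EFinP/measurable_funTS.
  - by move=> z /QP Qz; rewrite lee_fin; exact: fv Qz.
pose f' z := (\sum_(j < m) (\1_(Q j) z * f z)%:E)%E.
have f'f z : (f' z <= (f z)%:E)%E.
  rewrite /f' sumEFin lee_fin -mulr_suml ler_piMl//.
  have [[j Qj]|/forallNP nQ] := pselect (exists j : 'I_m, Q j z); last first.
    by rewrite big1// => j _; rewrite indicE memNset.
  rewrite (bigD1 j)//= big1 ?addr0 ?indicE ?ler_natl//; last first.
    move=> k kj; rewrite indicE memNset// => Qk.
    have jk : (j : nat) != k by apply: contra_neq kj => /val_inj ->.
    have [i Hi] := sep j k (ltn_ord j) (ltn_ord k) jk; move: Hi.
    move/QP : Qj => /(_ i) h1; move/QP : Qk => /(_ i) h2.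
    rewrite leNgt => /negP; apply.
    have -> : c j 0 i - c k 0 i = ((z : 'rV[R]_d) 0 i - c k 0 i) - ((z : 'rV[R]_d) 0 i - c j 0 i) by ring.
    by rewrite (le_lt_trans (ler_normB _ _))// mulr_natl mulr2n ltrD.
  by rewrite mem_set.
have mf1 j : measurable_fun setT (fun z => (\1_(Q j) z * f z)%:E).
  by apply/measurable_EFinP; apply: measurable_funM => //; apply: measurable_indic.
apply: (@le_trans _ _ (\int[lvec]_z f' z)%E); last first.
  apply: ge0_le_integral => //.
  - by move=> z _; apply: sume_ge0 => j _; rewrite lee_fin mulr_ge0 ?f0// indicE ler0n.
  - exact: emeasurable_sum.
  - exact/measurable_EFinP.
rewrite ge0_integral_sum//; last by move=> j z _; rewrite lee_fin mulr_ge0.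
have -> : (m%:R * (v * (2 * eta) ^+ d))%:E = (\sum_(j < m) (v * (2 * eta) ^+ d)%:E)%E.
  by rewrite sumEFin sumr_const card_ord mulr_natl.
apply: lee_sum => j _; apply: le_trans (step j (ltn_ord j)) _.
rewrite [X in (X <= _)%E]integral_mkcond le_eqVlt; apply/orP; left; apply/eqP.
by apply: eq_integral => z _; rewrite /patch indicE; case: ifPn => _; rewrite ?mul1r ?mul0r.
Qed.

End equivalence.

(** * Nondegeneracy and doubling of Psi* from an integral bound *)

Section conditions_equivalence.
Context {R : realType} {d : nat}.
Variables (A : 'M[R]_d) (N : {measure set (Rvec R d) -> \bar R}) (b : 'rV[R]_d).
Hypothesis d_gt0 : (0 < d)%N.
Hypothesis HT : levy_triplet A N.
Hypothesis h_unbounded : levy_h_unbounded A N.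
Local Notation h := (levy_h A N).
Local Notation lvec := (@lebesgue_vec R d).
Local Notation psi := (re_psi A N).
Local Notation psis := (Psi_star A N b).
Local Notation rho t := (levy_h_inv A N t^-1).
Local Notation K := (@star_const R d).
Implicit Types (x y : 'rV[R]_d) (z : Rvec R d) (r s t u : R).

Let HN : levy_measure N. Proof. by case: HT. Qed.
Let dR : 1 <= d%:R :> R. Proof. by rewrite ler1n. Qed.
Let dR0 : 0 < d%:R :> R. Proof. by rewrite ltr0n. Qed.
Let K64 : 64 <= K. Proof. exact: star_const_ge64. Qed.
Let K0 : 0 < K. Proof. exact: lt_le_trans K64. Qed.
Let mpsi : measurable_fun setT (psi : Rvec R d -> R). Proof. exact: measurable_re_psi. Qed.

Lemma max_coord x : x != 0 -> exists i, enorm x / d%:R <= `|x 0 i|.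
Proof.
move=> x0; apply: contrapT => /forallNP H.
suff : enorm x < enorm x by rewrite ltxx.
have e0 : 0 < enorm x by rewrite enorm_gt0.
pose a := \big[Num.max/0]_i `|x 0 i|.
have xa i : `|x 0 i| <= a by apply: le_bigmax.
apply: le_lt_trans (enorm_le_coords xa) _.
rewrite mulrC -ltr_pdivlMr//; apply/bigmax_ltP; split; first by rewrite divr_gt0.
by move=> i _; have /negP := H i; rewrite -ltNge.
Qed.

(** At the time t = 1/h(1/s) the scale h^{-1}(1/t) is 1/s. The factor [kap] is 1 when the bound
    comes from (C2) and 2 when it comes from (C1), through the squared characteristic function. *)
Definition integral_bound (kap c2 s : R) : Prop :=
  (\int[lvec]_z (expR (- (kap / h s^-1) * psi z))%:E <= (c2 * s ^+ d)%:E)%E.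

(* If psi(x) < Psi*(|x|) / m^2, then psi is at most of order Psi*(|x|) on m
   disjoint cubes of side |x|/d centred at the multiples j x, j < m, which
   contradicts the integral bound for large m. *)
Lemma nondegenerate_of_integral_bound kap c2 : 0 < kap -> 0 < c2 ->
  exists2 c : R, 0 < c <= 1 & forall x, x != 0 -> integral_bound kap c2 (enorm x) ->
    c * psis (enorm x) <= psi x.
Proof.
move=> kap0 c20.
(* On each cube Re Psi <= 4 Psi*(s) <= 16 h(1/s), so the integrand is at least e^{-16 kap} on a
   volume m (s/d)^d; this m makes the product exceed c2 s^d. *)
pose m := (Num.truncn (c2 * expR (16 * kap) * d%:R ^+ d)).+1.
have mlt : c2 * expR (16 * kap) * d%:R ^+ d < m%:R by exact: truncnS_gt.
have m0 : 0 < m%:R :> R by rewrite ltr0n.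
have m1 : 1 <= m%:R :> R by rewrite ler1n.
exists (m%:R ^- 2).
  by rewrite invr_gt0 exprn_gt0//= invf_le1 ?exprn_gt0// exprn_ege1.
move=> x x0 H; rewrite leNgt; apply/negP => xlt.
have s0 : 0 < enorm x by rewrite enorm_gt0.
set s := enorm x in s0 H xlt.
have hs0 : 0 < h s^-1 by rewrite (levy_h_gt0 HN h_unbounded)// invr_gt0.
have eta0 : 0 < s / (2 * d%:R) by rewrite divr_gt0 ?mulr_gt0.
have [i0 Hi0] := max_coord x0.
have ps0 : 0 <= psis s by apply: psi_star_ge0 => //; exact: ltW.
have dist1 (j k : nat) : j != k -> 1 <= `|j%:R - k%:R| :> R.
  wlog jk : j k / (j < k)%N => [W jk|_].
    by move: (jk); rewrite neq_ltn => /orP[/W|/W]; [exact|rewrite distrC eq_sym; exact].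
  rewrite distrC -natrB ?(ltnW jk)// normr_nat ler1n subn_gt0//.
have sep j k : (j < m)%N -> (k < m)%N -> j != k ->
    exists i, 2 * (s / (2 * d%:R)) <= `|(j%:R *: x) 0 i - (k%:R *: x) 0 i|.
  move=> _ _ jk; exists i0; rewrite !mxE -mulrBl normrM.
  have -> : 2 * (s / (2 * d%:R)) = s / d%:R by field; rewrite gt_eqF.
  by apply: le_trans Hi0 _; rewrite ler_peMl// dist1.
have fv j (z : 'rV[R]_d) : (j < m)%N -> (forall i, `|z 0 i - (j%:R *: x) 0 i| < s / (2 * d%:R)) ->
    expR (- (16 * kap)) <= expR (- (kap / h s^-1) * psi z).
  move=> jm Hz; rewrite ler_expR mulNr lerN2 mulrAC ler_pdivrMr// [16 * kap]mulrC -mulrA ler_pM2l//.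
  have -> : z = j%:R *: x + (z - j%:R *: x) by rewrite addrC subrK.
  apply: le_trans (re_psiD HT _ _) _.
  have h1 : psi (z - j%:R *: x) <= psis s.
    apply: re_psi_le_star => //; apply: (@le_trans _ _ (d%:R * (s / (2 * d%:R)))).
      by apply: enorm_le_coords => i; have := Hz i; rewrite !mxE => /ltW.
    have -> : d%:R * (s / (2 * d%:R)) = s / 2 by field; rewrite gt_eqF.
    lra.
  have h2 : psi (j%:R *: x) <= psis s.
    apply: le_trans (re_psiMn HT _ _) _.
    apply: (@le_trans _ _ (m%:R ^+ 2 * psi x)).
      rewrite ler_wpM2r ?re_psi_ge0// ler_pXn2r ?nnegrE// ler_nat; exact: ltnW.
    by rewrite -ler_pdivlMl ?exprn_gt0// ltW.
  have := psi_star_le_h b HT s0; lra.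
have := cube_integral_ge (measurable_re_psi_exp _ mpsi) (fun z => expR_ge0 _) eta0 (expR_ge0 _) sep fv.
move=> /le_trans /(_ H); rewrite lee_fin.
have -> : 2 * (s / (2 * d%:R)) = s / d%:R by field; rewrite gt_eqF.
rewrite expr_div_n mulrA [m%:R * _]mulrC; apply/negP; rewrite -ltNge.
have sd0 : 0 < s ^+ d by rewrite exprn_gt0.
rewrite expRN -(ltr_pM2l (expR_gt0 (16 * kap))).
have dd0 : 0 < (d%:R : R) ^+ d by rewrite exprn_gt0.
rewrite -(ltr_pM2r dd0).
have -> : expR (16 * kap) * ((expR (16 * kap))^-1 * m%:R * (s ^+ d / d%:R ^+ d)) * d%:R ^+ d = m%:R * s ^+ d.
  have en : expR (16 * kap) != 0 by rewrite gt_eqF ?expR_gt0.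
  have ddn : (d%:R : R) ^+ d != 0 by rewrite gt_eqF.
  by rewrite -[_ * m%:R * _]mulrA mulVKf// -mulrA divfK.
have -> : expR (16 * kap) * (c2 * s ^+ d) * d%:R ^+ d = c2 * expR (16 * kap) * d%:R ^+ d * s ^+ d by ring.
by rewrite ltr_pM2r.
Qed.

(** Without doubling, Re Psi <= 2 Psi*(s) <= 8 h(1/s) on the cube of half-side l s / d, which lies
    in the ball of radius l s. Its volume (4 (1 + B) s)^d is too large for the integral bound by the
    choice of l. *)
Lemma doubling_of_integral_bound kap c2 : 0 < kap -> 0 < c2 ->
  exists2 l : R, 2 <= l & forall s, 0 < s -> integral_bound kap c2 s ->
    2 * psis s <= psis (l * s).
Proof.
move=> kap0 c20.
pose B := c2 * expR (8 * kap).
have B0 : 0 < B by rewrite mulr_gt0 ?expR_gt0.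
pose l := 2 * d%:R * (1 + B).
have l2 : 2 <= l by rewrite /l -mulrA ler_peMr// mulr_ege1// lerDl ltW.
have l0 : 0 < l by exact: lt_le_trans l2.
exists l => // s s0 H; rewrite leNgt; apply/negP => xlt.
have hs0 : 0 < h s^-1 by rewrite (levy_h_gt0 HN h_unbounded)// invr_gt0.
have ls0 : 0 < l * s by exact: mulr_gt0.
have eta0 : 0 < l * s / d%:R by exact: divr_gt0.
have sep j k : (j < 1)%N -> (k < 1)%N -> j != k ->
    exists i, 2 * (l * s / d%:R) <= `|(0 : 'rV[R]_d) 0 i - (0 : 'rV[R]_d) 0 i|.
  by case: j; case: k.
have fv (j : nat) (z : 'rV[R]_d) : (j < 1)%N -> (forall i, `|z 0 i - (0 : 'rV[R]_d) 0 i| < l * s / d%:R) ->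
    expR (- (8 * kap)) <= expR (- (kap / h s^-1) * psi z).
  move=> jm Hz; rewrite ler_expR mulNr lerN2 mulrAC ler_pdivrMr// [8 * kap]mulrC -mulrA ler_pM2l//.
  have h1 : psi z <= psis (l * s).
    apply: re_psi_le_star => //; apply: (@le_trans _ _ (d%:R * (l * s / d%:R))).
      by apply: enorm_le_coords => i; have := Hz i; rewrite !mxE subr0 => /ltW.
    by rewrite mulrC divfK ?gt_eqF.
  have := psi_star_le_h b HT s0; lra.
have := cube_integral_ge (measurable_re_psi_exp _ mpsi) (fun z => expR_ge0 _) eta0 (expR_ge0 _) sep fv.
move=> /le_trans /(_ H); rewrite lee_fin mul1r.
apply/negP; rewrite -ltNge.
have sd0 : 0 < s ^+ d by rewrite exprn_gt0.
have -> : 2 * (l * s / d%:R) = 4 * (1 + B) * s by rewrite /l; field; rewrite gt_eqF.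
rewrite exprMn mulrA ltr_pM2r// expRN -(ltr_pM2l (expR_gt0 (8 * kap))).
rewrite mulVKf ?gt_eqF ?expR_gt0// mulrC -/B.
have B1 : 1 <= 4 * (1 + B) by lra.
have : 4 * (1 + B) <= (4 * (1 + B)) ^+ d.
  by rewrite -[leLHS]expr1 ler_weXn2l.
lra.
Qed.

End conditions_equivalence.

(** * (C3) from an integral bound; moments of the jumps in one direction *)

Section conditions_cycle.
Context {R : realType} {d : nat}.
Variables (A : 'M[R]_d) (N : {measure set (Rvec R d) -> \bar R}) (b : 'rV[R]_d).
Hypothesis d_gt0 : (0 < d)%N.
Hypothesis HT : levy_triplet A N.
Hypothesis h_unbounded : levy_h_unbounded A N.
Local Notation h := (levy_h A N).
Local Notation lvec := (@lebesgue_vec R d).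
Local Notation psi := (re_psi A N).
Local Notation psis := (Psi_star A N b).
Local Notation rho t := (levy_h_inv A N t^-1).
Local Notation K := (@star_const R d).
Implicit Types (x y : 'rV[R]_d) (z : Rvec R d) (r s t u : R).

Let HN : levy_measure N. Proof. by case: HT. Qed.
Let psdA x : 0 <= dotv x (matvec A x). Proof. by case: HT. Qed.
Let K64 : 64 <= K. Proof. exact: star_const_ge64. Qed.
Let K0 : 0 < K. Proof. exact: lt_le_trans K64. Qed.

Definition exp_integral_bound (kap : R) : Prop :=
  exists (T2 : \bar R) (c2 : R), [/\ (0 < T2)%E, 0 < c2 &
    forall t : R, 0 < t -> (t%:E < T2)%E ->
      (\int[lvec]_z (expR (- (kap * t) * psi z))%:E <= (c2 * rho t ^- d)%:E)%E].

Lemma ereal_inv_lt_gt0 (T : \bar R) s : (0 < T)%E -> (T^-1 < s%:E)%E -> 0 < s.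
Proof.
case: T => [T| |]//.
rewrite lte_fin => T0; rewrite inver gt_eqF// lte_fin; apply: lt_trans.
by rewrite invr_gt0.
Qed.

Lemma C3_of_integral_bound kap : 0 < kap -> exp_integral_bound kap -> cond_C3 A N b.
Proof.
move=> kap0 [T2 [c2 [T20 c20 H]]].
(* T3 = h^{-1}(1/T2): then s > 1/T3 puts the time 1/h(1/s) below T2. *)
have [T3 T30 T3P] : exists2 T3 : \bar R, (0 < T3)%E & forall s, (T3^-1 < s%:E)%E ->
    (((h s^-1)^-1)%:E < T2)%E.
  case: T2 T20 {H} => [T2| |]//; last first.
    by move=> _; exists +oo%E => [|s _]; rewrite ltry.
  rewrite lte_fin => T20; have r0 := rho_gt0 HT h_unbounded T20.
  exists (rho T2)%:E => [|s]; first by rewrite lte_fin.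
  move=> sT; have s0 := ereal_inv_lt_gt0 (T := (rho T2)%:E) r0 sT; move: sT.
  have si0 : 0 < s^-1 by rewrite invr_gt0.
  have hs0 := levy_h_gt0 HN h_unbounded si0.
  rewrite inver gt_eqF// !lte_fin => rs.
  rewrite -[ltRHS]invrK ltf_pV2 ?posrE ?invr_gt0// -(h_rho HT h_unbounded T20).
  rewrite (levy_h_lt_iff HN h_unbounded)//.
  by rewrite -[ltRHS]invrK ltf_pV2 ?posrE ?invr_gt0.
have good s : (T3^-1 < s%:E)%E -> 0 < s /\ integral_bound A N kap c2 s.
  move=> sT; have s0 := ereal_inv_lt_gt0 T30 sT; split => //.
  have si0 : 0 < s^-1 by rewrite invr_gt0.
  have hs0 := levy_h_gt0 HN h_unbounded si0.
  have t0 : 0 < (h s^-1)^-1 by rewrite invr_gt0.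
  have := H _ t0 (T3P _ sT); rewrite /integral_bound invrK.
  by rewrite (levy_h_invK HN h_unbounded)// exprVn invrK.
have [c /andP[c0 c1] Hc] := nondegenerate_of_integral_bound b d_gt0 HT h_unbounded kap0 c20.
have [l l2 Hl] := doubling_of_integral_bound b d_gt0 HT h_unbounded kap0 c20.
have l1 : 1 < l by apply: lt_le_trans l2; rewrite ltr1n.
have q1 : 1 < 2 :> R by rewrite ltr1n.
(* Halving c <= 1 makes the constant also at most 1/2, the factor lost in [doubling_power] with q =
   2. *)
exists T3, (c / 2), (ln 2 / ln l); split => //.
- by apply/andP; split; lra.
- rewrite doubling_exponent_gt0//=; apply: doubling_exponent_le => //.
  by rewrite (le_trans l2)// powR_mulrn ?(le_trans _ l2)// expr2; nra.
- move=> x xT; have [s0 Hs] := good _ xT; rewrite Re_Psi//.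
  have x0 : x != 0 by rewrite -enorm_gt0.
  have := Hc x x0 Hs; have := psi_star_ge0 b HT (ltW s0) => p0 h1.
  have : c / 2 * psis (enorm x) <= c * psis (enorm x) by rewrite ler_wpM2r//; lra.
  lra.
move=> lam r lam1 rT; have [r0 Hr] := good _ rT.
have := @doubling_power R psis l 2 r l1 q1 r0 (psi_star_ge0 b HT (ltW r0)).
move=> D; apply: le_trans (D _ _ lam lam1).
- have p0 : 0 <= lam `^ (ln 2 / ln l) by exact: powR_ge0.
  rewrite ler_wpM2r ?psi_star_ge0 ?(ltW r0)// ler_wpM2r//; lra.
- move=> u v ru uv; apply: psi_star_mono => //; exact: le_trans (ltW r0) ru.
- move=> u ru; have [u0 Hu] : 0 < u /\ integral_bound A N kap c2 u.
    by apply: good; apply: lt_le_trans rT _; rewrite lee_fin.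
  exact: Hl.
Qed.

(* [full_moment x] compares the second moment of the one-dimensional jumps <x,
   z> truncated at 1 with its part [small_moment x] coming from |<x, z>| < 1.
   *)
Definition small_moment x : R := dotv x (matvec A x)
  + \int[N]_(z in [set z : Rvec R d | `|dotv x z| < 1]) (`|dotv x z| ^+ 2).

Definition full_moment x : R :=
  dotv x (matvec A x) + \int[N]_z Num.min 1 (dotv x z ^+ 2).

Let small x z : R := dotv x z ^+ 2 * (`|dotv x z| < 1)%R%:R.

Let small_ge0 x z : 0 <= small x z.
Proof. by rewrite mulr_ge0 ?sqr_ge0. Qed.

Lemma min1_dotv_le x z : 0 < enorm x ->
  Num.min 1 (dotv x z ^+ 2) <= truncated_sqr (enorm x)^-1 z.
Proof.
move=> x0; rewrite /truncated_sqr le_min !ge_min lexx/=; apply/orP; right.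
rewrite exprVn invrK -exprMn -real_normK ?num_real//.
by rewrite ler_pXn2r ?nnegrE ?mulr_ge0 ?enorm_ge0// mulrC dotv_le_enorm.
Qed.

Let measurable_min1 x : measurable_fun setT (fun z => Num.min 1 (dotv x z ^+ 2)).
Proof.
apply: measurable_minr => //; apply: measurable_funX; exact: measurable_dotv.
Qed.

Let rintegrable_min1 x : 0 < enorm x -> rintegrable N (fun z => Num.min 1 (dotv x z ^+ 2)).
Proof.
move=> x0; have xi0 : 0 < (enorm x)^-1 by rewrite invr_gt0.
apply: le_rintegrable (rintegrable_truncated_sqr HN xi0) => // z.
by rewrite ger0_norm ?min1_dotv_le// le_min ler01 sqr_ge0.
Qed.

Let measurable_small x : measurable_fun setT (small x).
Proof.
apply: measurable_funM; first by apply: measurable_funX; exact: measurable_dotv.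
have m1 : measurable_fun setT (fun z : Rvec R d => `|dotv x z|).
  by apply: measurableT_comp; [exact: normr_measurable|exact: measurable_dotv].
have mB : measurable ([set z | `|dotv x z| < 1] : set (Rvec R d)).
  have := m1 measurableT `]-oo, 1[%classic.
  rewrite setTI (_ : _ @^-1` _ = [set z | `|dotv x z| < 1]); first by apply.
  by apply/seteqP; split => z /=; rewrite in_itv.
rewrite (_ : (fun z => _) = \1_[set z : Rvec R d | `|dotv x z| < 1]).
  exact: measurable_indic.
apply/funext => z; rewrite indicE.
by have [zr|/negP zr] := boolP (`|dotv x z| < 1); [rewrite mem_set|rewrite memNset].
Qed.

Let small_le x z : small x z <= Num.min 1 (dotv x z ^+ 2).
Proof.
rewrite /small; case: (boolP (`|dotv x z| < 1)) => [x1|_]; last by rewrite mulr0 le_min ler01 sqr_ge0.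
rewrite mulr1 le_min lexx andbT -real_normK ?num_real//.
by rewrite exprn_ile1// ltW.
Qed.

Let rintegrable_small x : 0 < enorm x -> rintegrable N (small x).
Proof.
move=> x0; apply: le_rintegrable (rintegrable_min1 x0) => // z.
by rewrite ger0_norm.
Qed.

Lemma small_momentE x : small_moment x = dotv x (matvec A x) + \int[N]_z small x z.
Proof.
rewrite /small_moment Rintegral_mkcond; congr (_ + _); apply: eq_Rintegral => z _.
rewrite /patch /small; case: ifPn => [|/negP]; rewrite inE/= => h.
  by rewrite h mulr1 real_normK ?num_real.
by move/negP/negbTE : h => ->; rewrite mulr0.
Qed.

Lemma small_moment_ge0 x : 0 <= small_moment x.
Proof. by rewrite small_momentE addr_ge0//; apply: Rintegral_ge0 => z _. Qed.

Lemma full_moment_le_h x : 0 < enorm x -> full_moment x <= h (enorm x)^-1.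
Proof.
move=> x0; rewrite /full_moment levy_hE lerD//.
  by rewrite exprVn invrK mulrC quadratic_form_le.
apply: le_Rintegral => //; first exact: rintegrable_min1.
  by apply: rintegrable_truncated_sqr => //; rewrite invr_gt0.
by move=> z _; exact: min1_dotv_le.
Qed.

Lemma re_psi_le_full_moment x : 0 < enorm x -> psi x <= 2 * full_moment x.
Proof.
move=> x0; rewrite /re_psi /full_moment mulrDr lerD//.
  by have := psdA x; lra.
rewrite -RintegralZl//; last exact: rintegrable_min1.
apply: le_Rintegral => //; first exact: (rintegrable_onemcos_dotv HT).
  by apply: rintegrableZ; exact: rintegrable_min1.
move=> z _; have h1 := onemcos_le2 (dotv x z); have h2 := onemcos_le_sqr (dotv x z).
have h3 := sqr_ge0 (dotv x z).
by have [h|/ltW h] := leP (dotv x z ^+ 2) 1; lra.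
Qed.

Lemma re_psi_ge_small_moment x : 0 < enorm x -> small_moment x / 8 <= psi x.
Proof.
move=> x0; rewrite /re_psi small_momentE mulrDl lerD//.
  by have := psdA x; lra.
rewrite -RintegralZr//; last exact: rintegrable_small.
apply: le_Rintegral => //.
- under eq_fun do rewrite mulrC; apply: rintegrableZ; exact: rintegrable_small.
- exact: (rintegrable_onemcos_dotv HT).
move=> z _; rewrite /small; case: (boolP (`|dotv x z| < 1)) => h1.
  by rewrite mulr1; apply: onemcos_ge_sqr; exact: ltW.
by rewrite mulr0 mul0r onemcos_ge0.
Qed.

(** Jumps with |<x, z>| >= 1 are saturated and contribute nothing more under scaling, so all growth
    is charged to the small moment. Growth of Psi* as in (C3) therefore forces the small moment to
    be large. *)
Lemma full_moment_scale_le (lam : R) x : 0 < enorm x -> 1 <= lam ->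
  full_moment (lam *: x) <= full_moment x + (lam ^+ 2 - 1) * small_moment x.
Proof.
move=> x0 lam1; have lam0 : 0 < lam by exact: lt_le_trans lam1.
have lx0 : 0 < enorm (lam *: x) by rewrite enormZ mulr_gt0// normr_gt0 gt_eqF.
have l2 : 1 <= lam ^+ 2 by exact: exprn_ege1.
rewrite /full_moment small_momentE matvecZ dotvZl dotvZr mulrA -expr2.
suff : \int[N]_z Num.min 1 (dotv (lam *: x) z ^+ 2) <=
   \int[N]_z Num.min 1 (dotv x z ^+ 2) + (lam ^+ 2 - 1) * \int[N]_z small x z by lra.
have i1 := rintegrable_min1 x0; have i2 := rintegrable_small x0.
rewrite -RintegralZl// -RintegralD//; last exact: rintegrableZ.
apply: le_Rintegral => //; first exact: rintegrable_min1.
  by apply: rintegrableD => //; exact: rintegrableZ.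
move=> z _; rewrite dotvZl exprMn /small.
have v0 := sqr_ge0 (dotv x z).
have [x1|x1] := ltP `|dotv x z| 1.
  have vle : dotv x z ^+ 2 <= 1 by rewrite -real_normK ?num_real// exprn_ile1// ltW.
  rewrite mulr1 (min_r vle); set m := Num.min _ _.
  have : m <= lam ^+ 2 * dotv x z ^+ 2 by rewrite ge_min lexx orbT.
  lra.
have vge : 1 <= dotv x z ^+ 2 by rewrite -real_normK ?num_real// exprn_ege1.
by rewrite !mulr0 addr0 (min_l vge) ge_min lexx.
Qed.

(** The converse effect: a jump with |2 v| < 1, where v = <x, z>, gains 4 v^2 - v^2 = (3/4) (2 v)^2
    on doubling, and so does the Gaussian form. *)
Lemma full_moment_double_ge x : 0 < enorm x ->
  full_moment x + 3 / 4 * small_moment (2 *: x) <= full_moment (2 *: x).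
Proof.
move=> x0.
have lx0 : 0 < enorm (2 *: x) by rewrite enormZ mulr_gt0// normr_gt0 pnatr_eq0.
rewrite /full_moment small_momentE matvecZ dotvZl dotvZr mulrA.
have qx := psdA x.
suff : \int[N]_z Num.min 1 (dotv x z ^+ 2) + 3 / 4 * \int[N]_z small (2 *: x) z <=
   \int[N]_z Num.min 1 (dotv (2 *: x) z ^+ 2) by lra.
have i1 := rintegrable_min1 x0; have i2 := rintegrable_small lx0.
rewrite -RintegralZl// -RintegralD//; last exact: rintegrableZ.
apply: le_Rintegral => //; [|exact: rintegrable_min1|].
  by apply: rintegrableD => //; exact: rintegrableZ.
move=> z _; rewrite /small dotvZl exprMn.
have v0 := sqr_ge0 (dotv x z).
have [x1|x1] := ltP `|2 * dotv x z| 1.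
  have vle : 2 ^+ 2 * dotv x z ^+ 2 <= 1.
    by rewrite -exprMn -real_normK ?num_real// exprn_ile1// ltW.
  rewrite mulr1 (min_r vle); set m := Num.min _ _.
  have : m <= dotv x z ^+ 2 by rewrite ge_min lexx orbT.
  lra.
have vge : 1 <= 2 ^+ 2 * dotv x z ^+ 2 by rewrite -exprMn -real_normK ?num_real// exprn_ege1.
by rewrite !mulr0 addr0 (min_l vge) ge_min lexx.
Qed.

Lemma full_moment_mono x u v : 0 < u -> u <= v -> 0 < enorm x ->
  full_moment (u *: x) <= full_moment (v *: x).
Proof.
move=> u0 uv x0; have v0 : 0 < v by exact: lt_le_trans uv.
have ux0 : 0 < enorm (u *: x) by rewrite enormZ mulr_gt0// normr_gt0 gt_eqF.
have vx0 : 0 < enorm (v *: x) by rewrite enormZ mulr_gt0// normr_gt0 gt_eqF.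
have uv2 : u ^+ 2 <= v ^+ 2 by rewrite ler_pXn2r ?nnegrE ?(ltW u0) ?(ltW v0).
rewrite /full_moment lerD//.
  by rewrite !matvecZ !dotvZl !dotvZr !mulrA -!expr2 ler_wpM2r.
apply: le_Rintegral => //; [exact: rintegrable_min1|exact: rintegrable_min1|].
move=> z _; rewrite !dotvZl !exprMn le_min !ge_min lexx/=; apply/orP; right.
by rewrite ler_wpM2r// sqr_ge0.
Qed.

End conditions_cycle.

(** * Equivalence of (C3) and (C4); change of T3 *)

Section growth_conditions.
Context {R : realType} {d : nat}.
Variables (A : 'M[R]_d) (N : {measure set (Rvec R d) -> \bar R}) (b : 'rV[R]_d).
Hypothesis d_gt0 : (0 < d)%N.
Hypothesis HT : levy_triplet A N.
Local Notation h := (levy_h A N).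
Local Notation psi := (re_psi A N).
Local Notation psis := (Psi_star A N b).
Local Notation K := (@star_const R d).
Implicit Types (x y : 'rV[R]_d) (z : Rvec R d) (r s t u : R).

Let K64 : 64 <= K. Proof. exact: star_const_ge64. Qed.
Let K0 : 0 < K. Proof. exact: lt_le_trans K64. Qed.

Let full_le_star x : 0 < enorm x -> full_moment A N x <= K * psis (enorm x).
Proof.
move=> x0; apply: le_trans (full_moment_le_h HT x0) _.
exact: h_le_psi_star.
Qed.

(** Choose lam with c3^2 lam^al = 2 (K + 1). Then Re Psi (lam x) is at least 2 (K + 1) Psi*(|x|) by
    (C3), and at most 2 K Psi*(|x|) + 2 (lam^2 - 1) times the small moment at x. Subtracting leaves
    (C4). *)
Lemma C4_of_C3 : cond_C3 A N b -> cond_C4 A N b.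
Proof.
move=> [T3 [c3 [al [T30 /andP[c0 c1] /andP[al0 al2] H1 H2]]]].
pose q := 2 * (K + 1) / c3 ^+ 2.
have c2 : 0 < c3 ^+ 2 by rewrite exprn_gt0.
have q1 : 1 <= q.
  rewrite /q ler_pdivlMr// mul1r; have : c3 ^+ 2 <= 1 by rewrite exprn_ile1// ltW.
  by have := K64; lra.
pose lam := q `^ al^-1.
have lam1 : 1 <= lam by rewrite -(powRr0 q); apply: ler_powR => //; rewrite invr_ge0 ltW.
have lamal : lam `^ al = q by rewrite /lam -powRrM mulVf ?gt_eqF// powRr1// (le_trans ler01).
have lam0 : 0 < lam by exact: lt_le_trans lam1.
exists T3, (lam ^+ 2); split => //; first exact: exprn_ege1.
move=> x xT; have x0 := ereal_inv_lt_gt0 T30 xT; rewrite -/(small_moment A N x).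
have lx : enorm (lam *: x) = lam * enorm x by rewrite enormZ gtr0_norm.
have lx0 : 0 < enorm (lam *: x) by rewrite lx mulr_gt0.
have lxT : (T3^-1 < (enorm (lam *: x))%:E)%E.
  by apply: lt_le_trans xT _; rewrite lee_fin lx ler_peMl// ltW.
have h1 := H1 _ lxT; rewrite Re_Psi// in h1.
have h2 := H2 _ _ lam1 xT; rewrite lamal in h2.
have h3 := re_psi_le_full_moment HT lx0.
have h4 := full_moment_scale_le HT x0 lam1.
have h5 := full_le_star x0.
have h6 := small_moment_ge0 HT x.
have h7 : c3 * (c3 * q * psis (enorm x)) <= psi (lam *: x).
  by apply: le_trans h1; rewrite lx ler_pM2l.
have h8 : c3 * (c3 * q * psis (enorm x)) = 2 * (K + 1) * psis (enorm x).
  by rewrite /q expr2; field; rewrite gt_eqF.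
rewrite -/(re_psi A N (lam *: x)) in h3.
lra.
Qed.

(** Doubling is not visible on Psi* itself but on the full moment: under (C4) the small moment is a
    fixed fraction of it, so [full_moment_double_ge] makes it grow by a factor q > 1. *)
Lemma C3_of_C4 : cond_C4 A N b -> cond_C3 A N b.
Proof.
move=> [T4 [c4 [T40 c41 H]]].
have c40 : 0 < c4 by exact: lt_le_trans c41.
have Hs x : (T4^-1 < (enorm x)%:E)%E -> psis (enorm x) <= c4 * small_moment A N x.
  exact: H.
(* The gain 3/4 from [full_moment_double_ge], divided by the constant c4 K in the bound of the full
   moment by the small one. *)
pose th := 3 / (4 * c4 * K).
have cK : 64 <= c4 * K by rewrite -[leLHS]mul1r ler_pM.
have th0 : 0 < th by rewrite /th divr_gt0// -mulrA mulr_gt0//; lra.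
have th1 : th <= 1 by rewrite /th ler_pdivrMr; lra.
pose q := 1 + th.
have q1 : 1 < q by rewrite /q; lra.
have q2 : q <= 2 by rewrite /q; lra.
have l1 : 1 < 2 :> R by rewrite ltr1n.
have q0 : 0 < q by lra.
have psi_ge x : (T4^-1 < (enorm x)%:E)%E -> psis (enorm x) <= 8 * c4 * psi x.
  move=> xT; have x0 := ereal_inv_lt_gt0 T40 xT.
  have h1 := re_psi_ge_small_moment HT x0; have h2 := Hs _ xT.
  have : c4 * (small_moment A N x / 8) <= c4 * psi x by rewrite ler_pM2l.
  lra.
have al0 := doubling_exponent_gt0 l1 q1.
exists T4, (16 * c4 * K * q)^-1, (ln q / ln 2); split => //.
- rewrite invr_gt0; apply/andP; split; first by rewrite !mulr_gt0.
  rewrite invf_le1; last by rewrite !mulr_gt0.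
  rewrite -[leLHS]mul1r -[leLHS]mulr1 -[16 * c4 * K]mulrA ler_pM ?mulr_ge0 ?(ltW q1)//.
  lra.
- rewrite al0/=; apply: doubling_exponent_le => //.
  by rewrite (le_trans q2)// powR_mulrn// expr2; lra.
- move=> x xT; have x0 := ereal_inv_lt_gt0 T40 xT; rewrite Re_Psi//.
  have h1 := psi_ge _ xT.
  rewrite ler_pdivrMl ?mulr_gt0//.
  have p0 := re_psi_ge0 HT x.
  apply: le_trans h1 _; apply: ler_wpM2r => //.
  rewrite (_ : 16 * c4 * K * q = 8 * c4 * (2 * K * q)); last by ring.
  rewrite ler_peMr ?mulr_ge0 ?(ltW c40)// -[leLHS]mul1r ler_pM ?(ltW q1)//.
  by have := K64; lra.
move=> lam r lam1 rT; have r0 := ereal_inv_lt_gt0 T40 rT.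
(* Psi* depends on the radius only, so a single direction e suffices: along it the full moment F
   satisfies F <= K Psi* and Psi* <= 16 c4 F, and the growth of F is transferred to Psi*. *)
pose e : 'rV[R]_d := delta_mx 0 (Ordinal d_gt0).
have e1 : enorm e = 1 by rewrite /enorm dotv_delta mxE !eqxx sqrtr1.
have ue u : 0 < u -> enorm (u *: e) = u by move=> u0; rewrite enormZ e1 mulr1 gtr0_norm.
have lam0 : 0 < lam by exact: lt_le_trans lam1.
pose F u := full_moment A N (u *: e).
have F0 u : 0 < u -> 0 <= F u.
  move=> u0; have h1 := re_psi_le_full_moment HT (x := u *: e).
  rewrite ue// in h1; have := h1 u0; have := re_psi_ge0 HT (u *: e); rewrite /F; lra.
have good u : r <= u -> (T4^-1 < (enorm (u *: e))%:E)%E.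
  move=> ru; rewrite ue ?(lt_le_trans r0)//.
  by apply: lt_le_trans rT _; rewrite lee_fin.
have dbl u : r <= u -> q * F u <= F (2 * u).
  move=> ru; have u0 : 0 < u by exact: lt_le_trans ru.
  have ux0 : 0 < enorm (u *: e) by rewrite ue.
  have u20 : 0 < 2 * u by rewrite mulr_gt0.
  have h1 := full_moment_double_ge HT ux0; rewrite scalerA in h1.
  have ru2 : r <= 2 * u by lra.
  have h2 := Hs ((2 * u) *: e) (good (2 * u) ru2); rewrite ue// in h2.
  have h3 : F (2 * u) <= K * psis (2 * u) by rewrite -[X in psis X](ue (2 * u))// full_le_star ?ue.
  have h4 : F u <= F (2 * u) by apply: full_moment_mono; rewrite ?e1//; lra.
  have h5 : F (2 * u) <= c4 * K * small_moment A N ((2 * u) *: e).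
    by apply: le_trans h3 _; rewrite [c4 * K]mulrC -mulrA ler_pM2l.
  have h6 : th * F (2 * u) <= 3 / 4 * small_moment A N ((2 * u) *: e).
    apply: le_trans (ler_wpM2l (ltW th0) h5) _; rewrite le_eqVlt; apply/orP; left; apply/eqP.
    by rewrite /th; field; rewrite !gt_eqF.
  have h7 : th * F u <= th * F (2 * u) by rewrite ler_pM2l.
  rewrite -/(F u) -/(F (2 * u)) in h1.
  rewrite /q mulrDl mul1r; lra.
have mono u v : r <= u -> u <= v -> F u <= F v.
  move=> ru uv; apply: full_moment_mono => //; last by rewrite e1.
  exact: lt_le_trans ru.
have D := doubling_power l1 q1 r0 (F0 r r0) mono dbl lam1.
have lr0 : 0 < lam * r by rewrite mulr_gt0.
have h1 : F (lam * r) <= K * psis (lam * r).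
  by rewrite -[X in psis X](ue (lam * r))// full_le_star ?ue.
have h2 : psis r <= 16 * c4 * F r.
  have := psi_ge _ (good r (lexx r)); rewrite ue// => h3.
  have := re_psi_le_full_moment HT (x := r *: e); rewrite ue// => /(_ r0) h4.
  have : 8 * c4 * psi (r *: e) <= 8 * c4 * (2 * F r) by rewrite ler_pM2l ?mulr_gt0.
  lra.
have p0 : 0 <= lam `^ (ln q / ln 2) by exact: powR_ge0.
rewrite -(ler_pM2l K0); apply: le_trans h1; apply: le_trans D.
have k1 : 0 <= K * ((16 * c4 * K * q)^-1 * lam `^ (ln q / ln 2)).
  by rewrite !mulr_ge0// ?invr_ge0 ?mulr_ge0// ltW.
apply: (@le_trans _ _ (K * ((16 * c4 * K * q)^-1 * lam `^ (ln q / ln 2)) * (16 * c4 * F r))).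
  by rewrite [leLHS]mulrA; exact: ler_wpM2l.
rewrite le_eqVlt; apply/orP; left; apply/eqP; field.
by rewrite !gt_eqF.
Qed.

(* Since Re Psi (k x) <= k^2 Re Psi x, (C3) propagates from |x| > 1/T3 to |x|
   > 1/(k T3). *)
Lemma C3_with_scale (T3 c3 al : R) (k : nat) : (0 < k)%N ->
  cond_C3_with A N b T3%:E c3 al ->
  cond_C3_with A N b (k%:R * T3)%:E (c3 / k%:R ^+ 2) al.
Proof.
move=> k0 [T30 /andP[c0 c1] /andP[al0 al2] H1 H2].
rewrite lte_fin in T30.
have k1 : 1 <= k%:R :> R by rewrite ler1n.
have kR : 0 < k%:R :> R by rewrite ltr0n.
have k21 : 1 <= k%:R ^+ 2 :> R by exact: exprn_ege1.
have k20 : 0 < k%:R ^+ 2 :> R by rewrite exprn_gt0.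
have TkE s : (((k%:R * T3)%:E)^-1 < s%:E)%E -> 0 < s /\ ((T3%:E)^-1 < (k%:R * s)%:E)%E.
  have kT : 0 < k%:R * T3 by rewrite mulr_gt0.
  rewrite !inver !gt_eqF// !lte_fin => sT; split.
    by apply: lt_trans sT; rewrite invr_gt0.
  by rewrite -ltr_pdivrMl// -invfM.
have ck : c3 / k%:R ^+ 2 <= c3 by rewrite ler_pdivrMr// ler_peMr// ltW.
split.
- by rewrite lte_fin mulr_gt0.
- by rewrite divr_gt0//= (le_trans ck).
- by rewrite al0.
- move=> x /TkE[x0 xk].
  have ek : enorm (k%:R *: x) = k%:R * enorm x by rewrite enormZ gtr0_norm.
  have := H1 (k%:R *: x); rewrite ek Re_Psi// => /(_ xk) h1.
  have h2 := re_psiMn HT k x.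
  have h3 : psis (enorm x) <= psis (k%:R * enorm x).
    by apply: psi_star_mono => //; [exact: ltW|rewrite ler_peMl// ltW].
  rewrite Re_Psi// mulrAC ler_pdivrMr// mulrC [leRHS]mulrC.
  apply: le_trans h2; apply: le_trans h1; rewrite mulrC ler_pM2l//.
move=> lam r lam1 /TkE[r0 rk].
have p0 := psi_star_ge0 b HT (ltW r0).
have lam0 : 0 < lam by exact: lt_le_trans lam1.
have lr0 : 0 < lam * r by rewrite mulr_gt0.
have kal0 : 0 < (k%:R : R) `^ al by rewrite powR_gt0.
have kal : (k%:R : R) `^ al <= k%:R ^+ 2.
  by rewrite -powR_mulrn ?(ltW kR)//; apply: ler_powR.
have lamal : 0 <= lam `^ al by exact: powR_ge0.
(* For lam <= k monotonicity suffices, since lam^al <= k^2; for lam > k, (C3) applies at the radius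
   k r with ratio lam / k. *)
have [lk|kl] := leP lam k%:R.
  have h1 : lam `^ al <= k%:R ^+ 2.
    apply: le_trans kal; apply: ge0_ler_powR => //; rewrite ?nnegrE ?(ltW al0) ?(ltW lam0)//.
  apply: (@le_trans _ _ (psis r)); last first.
    by apply: psi_star_mono => //; [exact: ltW|rewrite ler_peMl// ltW].
  rewrite ler_piMl// mulrAC ler_pdivrMr// mul1r.
  by rewrite -[leRHS]mul1r ler_pM// ltW.
have lk1 : 1 <= lam / k%:R by rewrite ler_pdivlMr// mul1r ltW.
have := H2 _ _ lk1 rk; rewrite (_ : lam / k%:R * (k%:R * r) = lam * r); last first.
  by rewrite mulrA divfK// gt_eqF.
apply: le_trans.
have h3 : psis r <= psis (k%:R * r).
  by apply: psi_star_mono => //; [exact: ltW|rewrite ler_peMl// ltW].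
have h4 : lam `^ al / k%:R ^+ 2 <= (lam / k%:R) `^ al.
  have q0 : 0 <= lam / k%:R by rewrite divr_ge0// ltW.
  have -> : lam `^ al = (lam / k%:R) `^ al * k%:R `^ al.
    by rewrite -powRM ?(ltW kR)// divfK// gt_eqF.
  by rewrite ler_pdivrMr// ler_wpM2l// powR_ge0.
rewrite [c3 / _ * _]mulrAC -mulrA ler_pM ?mulr_ge0 ?divr_ge0 ?(ltW c0) ?(ltW k20)//.
by rewrite ler_pM2l.
Qed.

End growth_conditions.

(** * The law of the process *)

Section process_law.
Context {R : realType} {d : nat} {disp : measure_display}.
Context {Omega : measurableType disp} (P : probability Omega R).
Variable Y : R -> {RV P >-> Rvec R d}.
Variables (A : 'M[R]_d) (N : {measure set (Rvec R d) -> \bar R}) (b : 'rV[R]_d).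
Hypothesis HY : generating_triplet Y A N b.
Local Notation h := (levy_h A N).
Local Notation mu := (@lebesgue_measure R).
Local Notation tup n := (n.-tuple (measurableTypeR R)).
Local Notation lvec := (@lebesgue_vec R d).
Local Notation ltup := (@lebesgue_tuple R d).
Local Notation row := (@row_of_tuple R d).
Local Notation psi := (re_psi A N).
Local Notation im x := (complex.Im (Psi A N b x)).
Implicit Types (x y u : 'rV[R]_d) (z : Rvec R d) (r s al : R) (w : Omega).

Let HT : levy_triplet A N. Proof. by case: HY. Qed.
Let HN : levy_measure N. Proof. by case: HT. Qed.
Let mpsi : measurable_fun setT (psi : Rvec R d -> R). Proof. exact: measurable_re_psi. Qed.

Let Re_exp (t : R) x : complex.Re (cexp (- (t%:C * Psi A N b x))%C) =
  expR (- t * psi x) * cos (t * im x).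
Proof.
rewrite -(Re_Psi b HT) /cexp; case: (Psi A N b x) => a c /=.
by rewrite !mul0r subr0 addr0 cosN mulNr.
Qed.

Let Im_exp (t : R) x : complex.Im (cexp (- (t%:C * Psi A N b x))%C) =
  - (expR (- t * psi x) * sin (t * im x)).
Proof.
rewrite -(Re_Psi b HT) /cexp; case: (Psi A N b x) => a c /=.
by rewrite !mul0r subr0 addr0 sinN mulNr mulrN.
Qed.

Let fourier_kernelE (u : R) (w : R[i]) : (cexp (- ('i * u%:C)) * w)%C =
  Complex (cos u * complex.Re w + sin u * complex.Im w) (cos u * complex.Im w - sin u * complex.Re w).
Proof.
rewrite (_ : cexp _ = Complex (cos u) (- sin u)).
  case: w => a c; apply/eqP; rewrite eq_complex /=; apply/andP; split; apply/eqP; ring.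
apply/eqP; rewrite eq_complex /cexp /=.
by rewrite !(mul0r, mulr0, mul1r, add0r, subr0, oppr0, expR0) cosN sinN !eqxx.
Qed.

Let Re_fourier_kernel (u : R) (w : R[i]) : complex.Re (cexp (- ('i * u%:C)) * w)%C =
  cos u * complex.Re w + sin u * complex.Im w.
Proof. by rewrite fourier_kernelE. Qed.

Let Im_fourier_kernel (u : R) (w : R[i]) : complex.Im (cexp (- ('i * u%:C)) * w)%C =
  cos u * complex.Im w - sin u * complex.Re w.
Proof. by rewrite fourier_kernelE. Qed.

Lemma expectation_cos (t : R) u : 0 <= t ->
  \int[P]_w cos (dotv u (Y t w)) = expR (- t * psi u) * cos (t * im u).
Proof.
move=> t0; have [_ /(_ t u t0) /(congr1 (@complex.Re R))] := HY.
by rewrite Re_exp => <-; apply: eq_Rintegral => w _; rewrite -Re_cexpi.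
Qed.

Lemma expectation_sin (t : R) u : 0 <= t ->
  \int[P]_w sin (dotv u (Y t w)) = - (expR (- t * psi u) * sin (t * im u)).
Proof.
move=> t0; have [_ /(_ t u t0) /(congr1 (@complex.Im R))] := HY.
by rewrite Im_exp => <-; apply: eq_Rintegral => w _; rewrite -Im_cexpi.
Qed.

Let rintegrable_trig (f : R -> R) (t : R) u : measurable_fun setT f -> (forall v, `|f v| <= 1) ->
  rintegrable P (fun w => f (dotv u (Y t w))).
Proof.
move=> mf f1; have : rintegrable P (fun=> 1) by exact: finite_measure_integrable_cst.
apply: le_rintegrable => // .
apply: (measurableT_comp mf).
exact: (measurableT_comp (measurable_dotv u) (measurable_funPT (Y t))).
Qed.

Lemma expectation_cos_affine (t : R) u al : 0 <= t ->
  \int[P]_w cos (al + dotv u (Y t w)) = expR (- t * psi u) * cos (al - t * im u).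
Proof.
move=> t0.
have ic : rintegrable P (fun w => cos (dotv u (Y t w))).
  by apply: rintegrable_trig; [exact: measurable_cos|exact: cos_max].
have is_ : rintegrable P (fun w => sin (dotv u (Y t w))).
  by apply: rintegrable_trig; [exact: measurable_sin|exact: sin_max].
under eq_Rintegral do rewrite cosD.
rewrite RintegralB//; [|exact: rintegrableZ|exact: rintegrableZ].
by rewrite !RintegralZl// expectation_cos// expectation_sin// cosB; ring.
Qed.

Lemma cosE_process (t : R) al (x : Rvec R d) (tau : tup d) : 0 <= t ->
  cosE (Y t) al x tau = expR (- t * psi (row tau)) *
    cos (al - dotv (x : 'rV[R]_d) (row tau) - t * im (row tau)).
Proof.
move=> t0; rewrite -expectation_cos_affine//.
apply: eq_Rintegral => w _; congr cos.
by rewrite /shift_dot dotvC dotvBr dotvC (dotvC _ (x : 'rV[R]_d)) (dotvC _ (row tau)); ring.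
Qed.

Lemma cosE_process_le (t : R) al (x : Rvec R d) (tau : tup d) : 0 <= t ->
  `|cosE (Y t) al x tau| <= expR (- t * psi (row tau)).
Proof.
move=> t0; rewrite cosE_process// normrM ger0_norm ?expR_ge0//.
by rewrite ler_piMr ?expR_ge0// cos_max.
Qed.

Lemma charfun_sqr_process (t : R) (tau : tup d) : 0 <= t ->
  charfun_sqr (Y t) tau = expR (- (2 * t) * psi (row tau)).
Proof.
move=> t0; rewrite /charfun_sqr !cosE_process// dotv0l !subr0 sub0r cosN.
rewrite -opprD [- (_ + _)]opprD [- (pi / 2) - _]addrC cosBpihalf sinN !exprMn sqrrN -mulrDr cos2Dsin2 mulr1.
by rewrite -expRM_natl; congr expR; ring.
Qed.

Lemma density_law_bound (t K : R) (p : Rvec R d -> R) : 0 <= t ->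
  measurable_fun setT p -> (forall x, 0 <= p x) -> (forall x, p x <= K) ->
  (forall B : set (Rvec R d), measurable B ->
    (P (Y t @^-1` B) = \int[lvec]_(x in B) (p x)%:E)%E) ->
  (\int[lvec]_z (expR (- (2 * t) * psi z))%:E <= ((2 * pi) ^+ d * K)%:E)%E.
Proof.
move=> t0 mp p0 pK pl.
rewrite ge0_integral_vec; last 2 first.
- exact: measurable_re_psi_exp.
- by move=> z; exact: expR_ge0.
have := integral_charfun_sqr_le mp p0 pK pl.
by under eq_integral do rewrite charfun_sqr_process//.
Qed.

Definition tuple_of_row z : tup d := [tuple (z : 'rV[R]_d) 0 i | i < d].

Lemma measurable_tuple_of_row : measurable_fun setT tuple_of_row.
Proof.
apply/measurable_fun_tnthP => i.
rewrite (_ : _ \o _ = fun z : Rvec R d => (z : 'rV[R]_d) 0 i); first exact: measurable_coord.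
by apply/funext => z /=; rewrite tnth_mktuple.
Qed.

Lemma tuple_of_rowK z : row (tuple_of_row z) = z.
Proof. by apply/rowP => i; rewrite !mxE tnth_mktuple. Qed.

Section fixed_time.
Variable t : R.
Hypothesis t0 : 0 <= t.
Let m (tau : tup d) := expR (- t * psi (row tau)).
Hypothesis m_integrable : rintegrable ltup m.
Let cosE_m al x tau : `|cosE (Y t) al x tau| <= m tau.
Proof. exact: cosE_process_le. Qed.

Let fourier_integral al (x : Rvec R d) :
  \int[lvec]_z (expR (- t * psi z) * cos (al - dotv (x : 'rV[R]_d) z - t * im z)) =
  \int[ltup]_tau cosE (Y t) al x tau.
Proof.
have E z : expR (- t * psi z) * cos (al - dotv (x : 'rV[R]_d) z - t * im z) =
    cosE (Y t) al x (tuple_of_row z).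
  by rewrite cosE_process// tuple_of_rowK.
under eq_Rintegral do rewrite E.
have K tau : tuple_of_row (row tau) = tau.
  by apply: eq_from_tnth => i; rewrite tnth_mktuple mxE.
rewrite Rintegral_vec.
- by apply: eq_Rintegral => tau _; rewrite K.
- exact: (measurableT_comp (measurable_cosE (Y t) al x) measurable_tuple_of_row).
- have := rintegrable_cosE m_integrable cosE_m al x.
  by apply: eq_integrable => // tau _; rewrite /= K.
Qed.

Lemma is_density_pdens : is_density Y A N b t (pdens (Y t)).
Proof.
split.
- exact: (measurable_pdens m_integrable cosE_m).
- exact: (pdens_ge0 m_integrable cosE_m).
- exact: (pdens_law m_integrable cosE_m).
move=> _ x; rewrite /pdens -fourier_integral.
apply/eqP; rewrite eq_complex; apply/andP; split; apply/eqP.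
  set v := cintegral _ _; rewrite (_ : complex.Re (_ * v)%C = (2 * pi) ^- d * complex.Re v).
    rewrite /v; congr (_ * _); apply: eq_Rintegral => z _.
    by rewrite Re_fourier_kernel Re_exp Im_exp add0r -opprD cosN cosD; ring.
  by case: v => a c /=; rewrite mul0r subr0.
(* The imaginary part is the integral of [cosE] with phase -pi/2, which vanishes. *)
set v := cintegral _ _; rewrite (_ : complex.Im (_ * v)%C = (2 * pi) ^- d * complex.Im v).
  rewrite (_ : complex.Im v = 0) ?mulr0//.
  rewrite -(Rintegral_sinE_eq0 m_integrable cosE_m x) /v -fourier_integral.
  apply: eq_Rintegral => z _; rewrite Im_fourier_kernel Re_exp Im_exp.
  rewrite (_ : - (pi / 2) - _ - _ = - (dotv x z + t * im z) - pi / 2); last by ring.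
  by rewrite cosBpihalf sinN sinD; ring.
by case: v => a c /=; rewrite mul0r addr0.
Qed.

End fixed_time.

(** * Concentration of Y_t around t b_r *)

Section concentration.
Variables (t r : R) (i : 'I_d).
Hypotheses (t0 : 0 <= t) (r0 : 0 < r).
Let V w := ((Y t w : 'rV[R]_d) 0 i - t * drift N b r 0 i) / r.

Lemma measurable_centered : measurable_fun setT V.
Proof.
apply: measurable_funM => //; apply: measurable_funB => //.
exact: (measurableT_comp (measurable_coord i) (measurable_funPT (Y t))).
Qed.

Let mW (s : R) : measurable_fun setT (fun w => 1 - cos (s * V w)).
Proof.
apply: measurable_funB => //; apply: (measurableT_comp measurable_cos).
by apply: measurable_funM => //; exact: measurable_centered.
Qed.

(** Centring at t b_r turns the phase into t [im_psi], and 1 - e^{-a} cos v <= a + |v|. Here a and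
    |v| are at most 2 and 1 times (1 + s^2) t h(r), whence the factor 3. *)
Let expectation_onemcos_le (s : R) :
  \int[P]_w (1 - cos (s * V w)) <= 3 * (t * h r) * (1 + `|s|) ^+ 2.
Proof.
pose x : 'rV[R]_d := (s / r) *: delta_mx 0 i.
have xr : enorm x * r = `|s|.
  rewrite enormZ (_ : enorm _ = 1) ?mulr1; last first.
    by rewrite /enorm dotv_delta mxE !eqxx sqrtr1.
  by rewrite normrM normfV (gtr0_norm r0) divfK// gt_eqF.
have dx : dotv x (drift N b r) = s / r * drift N b r 0 i by rewrite dotvZl dotv_delta.
have E w : s * V w = - (t * dotv x (drift N b r)) + dotv x (Y t w).
  by rewrite dx dotvZl dotv_delta /V; field; rewrite gt_eqF.
have ic : rintegrable P (fun w => cos (s * V w)).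
  have : rintegrable P (fun=> 1) by exact: finite_measure_integrable_cst.
  apply: le_rintegrable; last by move=> w; exact: cos_max.
  apply: (measurableT_comp measurable_cos).
  by apply: measurable_funM => //; exact: measurable_centered.
rewrite RintegralB//; last by exact: finite_measure_integrable_cst.
rewrite Rintegral_cst_probability.
under eq_Rintegral do rewrite E.
rewrite expectation_cos_affine//.
rewrite (_ : _ - t * im x = - (t * im_psi N r x)); last by rewrite -(Im_Psi_drift b HT x r0); ring.
rewrite cosN.
have p0 := re_psi_ge0 HT x.
have p1 := re_psi_le HT x r0; have i1 := im_psi_le HT x r0; rewrite xr real_normK ?num_real// in p1 i1.
have h0 : 0 <= t * h r by rewrite mulr_ge0// levy_h_ge0.
have e1 : expR (- t * psi x) <= 1 by rewrite -expR0 ler_expR mulNr oppr_le0 mulr_ge0.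
have e2 : 1 - t * psi x <= expR (- t * psi x) by rewrite mulNr; exact: expR_ge1Dx.
have c1 := onemcos_le_norm (t * im_psi N r x).
rewrite normrM (ger0_norm t0) in c1.
have c2 : t * `|im_psi N r x| <= (1 + s ^+ 2) * (t * h r) by rewrite mulrCA ler_wpM2l.
have c3 : t * psi x <= 2 * (1 + s ^+ 2) * (t * h r) by rewrite mulrCA ler_wpM2l.
have c4 : expR (- t * psi x) * (1 - cos (t * im_psi N r x)) <= 1 - cos (t * im_psi N r x).
  by rewrite ler_piMl// onemcos_ge0.
have c5 : (1 + s ^+ 2) * (t * h r) <= (1 + `|s|) ^+ 2 * (t * h r).
  rewrite ler_wpM2r// -[s ^+ 2]real_normK ?num_real//.
  by have := normr_ge0 s; rewrite !expr2; nra.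
rewrite mulrBr mulr1 in c4; lra.
Qed.

(* 2 v^2/(1 + v^2) is the weighted average of 1 - cos(s v) over s, and
   dominates the indicator of |v| >= 1. *)
Lemma expectation_centered_le : rintegrable P (fun w => 2 * (V w ^+ 2 / (1 + V w ^+ 2))) /\
  \int[P]_w (2 * (V w ^+ 2 / (1 + V w ^+ 2))) <= 192 * (t * h r).
Proof.
pose f (z : Omega * measurableTypeR R) := (1 - cos (z.2 * V z.1)) * expR (- (1 * `|z.2|)).
pose k (s : measurableTypeR R) := expR (- (1 * `|s|)).
have mf : measurable_fun setT f.
  apply: measurable_funM; last first.
    by apply: (measurableT_comp (measurable_laplace 1)); exact: measurable_snd.
  apply: measurable_funB => //; apply: (measurableT_comp measurable_cos).
  apply: measurable_funM; first exact: measurable_snd.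
  by apply: (measurableT_comp measurable_centered); exact: measurable_fst.
have ig : rintegrable P (fun=> 2) by exact: finite_measure_integrable_cst.
have ik : rintegrable mu k by exact: rintegrable_laplace.
have fgk w s : `|f (w, s)| <= 2 * k s.
  rewrite /f /k/= normrM ger0_norm ?onemcos_ge0// ger0_norm ?expR_ge0//.
  by rewrite ler_wpM2r ?expR_ge0// onemcos_le2.
have E w : 2 * (V w ^+ 2 / (1 + V w ^+ 2)) = \int[mu]_s f (w, s).
  by rewrite -integral_laplace_onemcos.
have I : rintegrable P (fun w => 2 * (V w ^+ 2 / (1 + V w ^+ 2))).
  by under eq_fun do rewrite E; exact: rintegrable_inner1 mf ig ik fgk.
split=> //; under eq_Rintegral do rewrite E.
rewrite (Rfubini mf ig ik fgk).
apply: (@le_trans _ _ (\int[mu]_s (3 * (t * h r) * ((1 + `|s|) ^+ 2 * expR (- (1 * `|s|)))))).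
  apply: le_Rintegral => //.
  - exact: rintegrable_inner2 mf ig ik fgk.
  - by apply: rintegrableZ; exact: rintegrable_laplace_sqr.
  - move=> s _; rewrite /f/= RintegralZr//; last first.
      by apply: le_rintegrable ig => // w; rewrite ger0_norm ?onemcos_ge0// onemcos_le2.
    by rewrite [leRHS]mulrA ler_wpM2r ?expR_ge0//; exact: expectation_onemcos_le.
rewrite RintegralZl//; last exact: rintegrable_laplace_sqr.
rewrite (_ : 192 * (t * h r) = 3 * (t * h r) * 64); last by ring.
by rewrite ler_wpM2l ?mulr_ge0 ?levy_h_ge0//; exact: Rintegral_laplace_sqr.
Qed.

End concentration.

Definition drift_box (t r : R) : set (Rvec R d) :=
  box (fun i => t * drift N b r 0 i - r) (fun i => t * drift N b r 0 i + r).

Lemma drift_box_prob (t r : R) : 0 <= t -> 0 < r -> t * h r <= (384 * d%:R)^-1 ->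
  ((1 / 2)%:E <= P (Y t @^-1` drift_box t r))%E.
Proof.
move=> t0 r0 thr.
pose F i w := let v := ((Y t w : 'rV[R]_d) 0 i - t * drift N b r 0 i) / r in
  2 * (v ^+ 2 / (1 + v ^+ 2)).
have F0 i w : 0 <= F i w by rewrite mulr_ge0// divr_ge0 ?addr_ge0 ?sqr_ge0.
have mS : measurable (Y t @^-1` drift_box t r).
  by rewrite -[X in measurable X]setTI; apply: measurable_funPT => //; exact: measurable_box.
pose G w : R := 1 - \1_(Y t @^-1` drift_box t r) w.
have mG : measurable_fun setT G by apply: measurable_funB => //; exact: measurable_indic.
have i1 : rintegrable P (\1_(Y t @^-1` drift_box t r) : Omega -> R).
  have : rintegrable P (fun=> 1) by exact: finite_measure_integrable_cst.
  apply: le_rintegrable; first exact: measurable_indic.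
  by move=> w; rewrite indicE; case: (_ \in _); rewrite ?normr1 ?normr0.
have G0 w : 0 <= G w by rewrite /G indicE; case: (_ \in _); rewrite ?subrr// subr0.
(* A union bound: outside the box some coordinate is off by at least r. *)
have GF w : G w <= \sum_i F i w.
  rewrite /G indicE; have [wb|wb] := boolP (w \in _); first by rewrite subrr sumr_ge0.
  have [i wi] : exists i, 1 <= (((Y t w : 'rV[R]_d) 0 i - t * drift N b r 0 i) / r) ^+ 2.
    apply: contrapT => /forallNP H; case/negP: wb; rewrite inE => i.
    have {H}/negP := H i; rewrite -ltNge -[1](expr1n _ 2) => H.
    have : `|((Y t w : 'rV[R]_d) 0 i - t * drift N b r 0 i) / r| < 1.
      by rewrite -(ltr_pXn2r (n := 2)) ?nnegrE// real_normK ?num_real.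
    rewrite normrM normfV (gtr0_norm r0) ltr_pdivrMr// mul1r ltr_norml => /andP[h1 h2].
    by apply/andP; split; lra.
  rewrite subr0 (bigD1 i)//=.
  apply: (@le_trans _ _ (F i w)); last by rewrite lerDl; apply: sumr_ge0.
  rewrite /F mulrA ler_pdivlMr; last by rewrite ltr_pwDl ?sqr_ge0.
  by rewrite mul1r; lra.
have iF i : rintegrable P (F i) by case: (expectation_centered_le i t0 r0).
have : \int[P]_w G w <= 1 / 2.
  rewrite -lee_fin EFin_Rintegral; last first.
    by apply: rintegrableB => //; exact: finite_measure_integrable_cst.
  apply: (@le_trans _ _ (\int[P]_w \sum_i (F i w)%:E)%E).
    apply: ge0_le_integral => //.
    - by move=> w _; rewrite lee_fin.
    - exact/measurable_EFinP.
    - apply: emeasurable_sum => i; apply/measurable_EFinP.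
      exact: rintegrable_measurable (iF i).
    - by move=> w _; rewrite sumEFin lee_fin.
  rewrite integral_sum//.
  apply: (@le_trans _ _ (\sum_(i < d) (192 * (t * h r))%:E)%E).
    apply: lee_sum => i _; rewrite -EFin_Rintegral// lee_fin.
    by case: (expectation_centered_le i t0 r0).
  rewrite sumEFin lee_fin sumr_const card_ord -[leLHS]mulr_natl.
  have [/eqP->|d0] := boolP (d%:R == 0 :> R); first by rewrite mul0r.
  apply: (@le_trans _ _ (d%:R * (192 * (384 * d%:R)^-1))).
    by rewrite ler_wpM2l// ler_wpM2l.
  by rewrite (_ : d%:R * _ = 1 / 2)//; field.
rewrite RintegralB//; last exact: finite_measure_integrable_cst.
rewrite Rintegral_cst_probability => H.
have <- : (\int[P]_w (\1_(Y t @^-1` drift_box t r) w)%:E = P (Y t @^-1` drift_box t r))%E.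
  by rewrite integral_indic// setIT.
rewrite -EFin_Rintegral// lee_fin; move: H; lra.
Qed.

End process_law.

(** * Regularity and localization of the density *)

Section localization.
Context {R : realType} {d : nat} {disp : measure_display}.
Context {Omega : measurableType disp} (P : probability Omega R).
Variable Y : R -> {RV P >-> Rvec R d}.
Variables (A : 'M[R]_d) (N : {measure set (Rvec R d) -> \bar R}) (b : 'rV[R]_d).
Hypothesis HY : generating_triplet Y A N b.

Hypothesis h_unbounded : levy_h_unbounded A N.
Local Notation h := (levy_h A N).
Local Notation mu := (@lebesgue_measure R).
Local Notation tup n := (n.-tuple (measurableTypeR R)).
Local Notation lvec := (@lebesgue_vec R d).
Local Notation ltup := (@lebesgue_tuple R d).
Local Notation row := (@row_of_tuple R d).
Local Notation psi := (re_psi A N).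
Local Notation im x := (complex.Im (Psi A N b x)).
Local Notation rho t := (levy_h_inv A N t^-1).
Implicit Types (x y u : 'rV[R]_d) (z : Rvec R d) (r s al : R) (w : Omega).

Let HT : levy_triplet A N. Proof. by case: HY. Qed.
Let HN : levy_measure N. Proof. by case: HT. Qed.
Let mpsi : measurable_fun setT (psi : Rvec R d -> R). Proof. exact: measurable_re_psi. Qed.

Section density.
Variables (t B : R).
Hypotheses (t0 : 0 < t).
Hypothesis moment : (\int[lvec]_z ((1 + rho t * enorm (z : 'rV[R]_d)) * expR (- t * psi z))%:E
  <= (B * rho t ^- d)%:E)%E.
Let m (tau : tup d) := expR (- t * psi (row tau)).
Let g (tau : tup d) := (1 + rho t * enorm (row tau : 'rV[R]_d)) * m tau.

Let r0 : 0 < rho t. Proof. exact: rho_gt0. Qed.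

Let mm : measurable_fun setT m.
Proof.
exact: (measurableT_comp (measurable_re_psi_exp t mpsi) (@measurable_row_of_tuple R d)).
Qed.

Let m_enorm : measurable_fun setT (fun tau => enorm (row tau : 'rV[R]_d)).
Proof. exact: (measurableT_comp (@measurable_enorm R d) (@measurable_row_of_tuple R d)). Qed.

Let mg : measurable_fun setT g.
Proof. by apply: measurable_funM => //; apply: measurable_funD => //; apply: measurable_funM. Qed.

Let g0 tau : 0 <= g tau.
Proof. by rewrite mulr_ge0 ?expR_ge0// addr_ge0// mulr_ge0 ?enorm_ge0// ltW. Qed.

Let integral_g : (\int[ltup]_tau (g tau)%:E <= (B * rho t ^- d)%:E)%E.
Proof.
move: moment; rewrite ge0_integral_vec//.
- apply: measurable_funM; last exact: (measurable_re_psi_exp t mpsi).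
  by apply: measurable_funD => //; apply: measurable_funM => //; exact: measurable_enorm.
- by move=> z; rewrite mulr_ge0 ?expR_ge0// addr_ge0// mulr_ge0 ?enorm_ge0// ltW.
Qed.

Let ig : rintegrable ltup g.
Proof. by apply: ge0_rintegrable => //; rewrite (le_lt_trans integral_g)// ltry. Qed.

Lemma rintegrable_charfun_norm : rintegrable ltup m.
Proof.
apply: le_rintegrable ig => // tau.
rewrite ger0_norm ?expR_ge0// ler_peMl ?expR_ge0// lerDl.
by rewrite mulr_ge0 ?enorm_ge0// ltW.
Qed.

Let cosE_m al z tau : `|cosE (Y t) al z tau| <= m tau.
Proof. by apply: (cosE_process_le HY); exact: ltW. Qed.

Let B0 : 0 <= B * rho t ^- d.
Proof.
by rewrite -lee_fin (le_trans _ integral_g)// integral_ge0// => tau _; rewrite lee_fin.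
Qed.

Let q_le1 : (2 * pi) ^- d <= 1 :> R.
Proof.
have p2 := pi_ge2 R.
by rewrite invf_le1 ?exprn_gt0// ?exprn_ege1//; lra.
Qed.

(** Moving x costs a factor |z| under the inversion integral, the cosine being 1-Lipschitz, and |z|
    <= (1 + r|z|) / r trades this factor for the moment bound. *)
Lemma pdens_lipschitz (x y : Rvec R d) :
  `|pdens (Y t) x - pdens (Y t) y| <= enorm ((x : 'rV[R]_d) - y) * (B * rho t ^- d / rho t).
Proof.
have tge0 := ltW t0.
have ic z : rintegrable ltup (cosE (Y t) 0 z).
  exact: (rintegrable_cosE rintegrable_charfun_norm cosE_m).
rewrite /pdens -mulrBr normrM ger0_norm; last first.
  by rewrite invr_ge0 exprn_ge0// mulr_ge0// pi_ge0.
apply: (@le_trans _ _ (`|\int[ltup]_tau cosE (Y t) 0 x tau - \int[ltup]_tau cosE (Y t) 0 y tau|)).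
  by rewrite ler_piMl.
rewrite -RintegralB//.
apply: le_trans (le_normr_Rintegral _ (rintegrableB (ic x) (ic y))) _ => //.
apply: (@le_trans _ _ (\int[ltup]_tau (enorm ((x : 'rV[R]_d) - y) / rho t * g tau))).
  apply: le_Rintegral => //.
  - by apply: integrable_norm; exact: rintegrableB.
  - exact: rintegrableZ.
  move=> tau _; rewrite !(cosE_process HY)// -mulrBr normrM ger0_norm ?expR_ge0//.
  rewrite mulrC /g mulrA ler_wpM2r ?expR_ge0//.
  apply: le_trans (normr_cosB_le _ _) _.
  rewrite (_ : _ - _ - _ - _ = - dotv ((x : 'rV[R]_d) - y) (row tau)); last first.
    by rewrite [dotv (_ - _) _]dotvC dotvBr !(dotvC (row tau)); ring.
  rewrite normrN; apply: le_trans (dotv_le_enorm _ _) _.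
  rewrite -mulrA ler_wpM2l ?enorm_ge0// ler_pdivlMl// lerDr//.
rewrite RintegralZl// -mulrA ler_wpM2l ?enorm_ge0// mulrC ler_wpM2r ?invr_ge0 ?(ltW r0)//.
by rewrite -lee_fin EFin_Rintegral.
Qed.

Lemma pdens_le_scale (x : Rvec R d) : pdens (Y t) x <= B * rho t ^- d.
Proof.
have im := rintegrable_charfun_norm.
apply: le_trans (pdens_le im cosE_m x) _.
apply: (@le_trans _ _ (\int[ltup]_tau m tau)).
  by rewrite ler_piMl// Rintegral_ge0// => tau _; exact: expR_ge0.
rewrite -lee_fin EFin_Rintegral//; apply: le_trans integral_g.
rewrite -!EFin_Rintegral// lee_fin le_Rintegral// => tau _.
by rewrite ler_peMl ?expR_ge0// lerDl mulr_ge0 ?enorm_ge0// ltW.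
Qed.

Lemma integral_charfun_norm_le :
  (\int[lvec]_z (expR (- t * psi z))%:E <= (B * rho t ^- d)%:E)%E.
Proof.
apply: le_trans moment; apply: ge0_le_integral => //.
- by apply/measurable_EFinP; exact: (measurable_re_psi_exp t mpsi).
- apply/measurable_EFinP; apply: measurable_funM; last exact: (measurable_re_psi_exp t mpsi).
  by apply: measurable_funD => //; apply: measurable_funM => //; exact: measurable_enorm.
- move=> z _; rewrite lee_fin ler_peMl ?expR_ge0// lerDl mulr_ge0 ?enorm_ge0// ltW//.
Qed.

(** A density below (2 r)^{-d} / 4 on the whole box, of volume (2 r)^d, would leave it a mass of at
    most 1/4, against the 1/2 of [drift_box_prob]. *)
Lemma pdens_box_large (r : R) : 0 < r -> t * h r <= (384 * d%:R)^-1 ->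
  exists2 x : Rvec R d, drift_box N b t r x & (2 * r) ^- d / 4 <= pdens (Y t) x.
Proof.
move=> rpos thr; apply: contrapT => H.
have mb : measurable (drift_box N b t r) by exact: measurable_box.
have := drift_box_prob HY (ltW t0) rpos thr.
rewrite (pdens_law rintegrable_charfun_norm cosE_m mb); apply/negP; rewrite -ltNge.
have mp := measurable_pdens rintegrable_charfun_norm cosE_m.
have p0 := pdens_ge0 rintegrable_charfun_norm cosE_m.
apply: (@le_lt_trans _ _ (\int[lvec]_(x in drift_box N b t r) ((2 * r) ^- d / 4)%:E)%E).
  apply: ge0_le_integral => //.
  - by move=> z _; rewrite lee_fin.
  - exact/measurable_EFinP/measurable_funTS.
  - move=> z zb; rewrite lee_fin leNgt; apply/negP => /ltW zp; apply: H; by exists z.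
have Eb : lvec (drift_box N b t r) = ((2 * r) ^+ d)%:E.
  rewrite lebesgue_vec_box => [|i]; last by lra.
  rewrite (eq_bigr (fun=> 2 * r)) => [|i _]; last by ring.
  by rewrite prodr_const card_ord.
rewrite integral_cst//; have -> : (((2 * r) ^- d / 4)%:E * lvec (drift_box N b t r) = (1 / 4)%:E)%E.
  rewrite Eb -EFinM mulrAC mulVf// expf_neq0// gt_eqF// mulr_gt0//.
by rewrite lte_fin; lra.
Qed.

(** The first summand makes (B + 1) / c at most (2 M)^{-d} / 4, so that 1 / c survives a Lipschitz
    loss of B / c; the second bounds |x_t| / r; the last makes the constant positive. *)
Definition localization_const (B' M : R) : R := 4 * (2 * M) ^+ d * (B' + 1) + 2 * d%:R * M + 1.

Lemma localization (M c : R) : 1 <= M -> t * h (M * rho t) <= (384 * d%:R)^-1 ->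
  localization_const B M <= c ->
  exists2 xt : 'rV[R]_d, enorm xt <= c * rho t &
    forall y, enorm y <= c^-1 * rho t ->
      c^-1 * rho t ^- d <= pdens (Y t) (y + xt + t *: drift N b (rho t)).
Proof.
move=> M1 thM cM.
have M0 : 0 < M := lt_le_trans ltr01 M1.
have Mr0 : 0 < M * rho t by rewrite mulr_gt0.
have rd0 : 0 < rho t ^+ d by rewrite exprn_gt0.
have B0' : 0 <= B by move: B0; rewrite pmulr_lge0// invr_gt0.
have M2 : 0 < (2 * M) ^+ d by rewrite exprn_gt0// mulr_gt0.
have k1 : 0 <= 4 * (2 * M) ^+ d * (B + 1) by rewrite mulr_ge0 ?addr_ge0// mulr_ge0// ltW.
have k2 : 0 <= 2 * d%:R * M by rewrite mulr_ge0 ?mulr_ge0// ltW.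
rewrite /localization_const in cM.
have c0 : 0 < c by lra.
have [x1 x1b px1] := pdens_box_large Mr0 thM.
(* In each coordinate x1 is within M r of t b_{Mr}, which in turn is within t M r h(r) = M r of t
   b_r. *)
exists ((x1 : 'rV[R]_d) - t *: drift N b (rho t)).
  apply: (@le_trans _ _ (d%:R * (2 * M * rho t))); last first.
    by rewrite mulrA ler_wpM2r ?(ltW r0)// mulrA [_ * 2]mulrC; lra.
  apply: enorm_le_coords => i; rewrite mxE [X in _ + X]mxE [X in _ - X]mxE.
  have := x1b i => /andP[h1 h2].
  have rM : rho t <= M * rho t by rewrite ler_peMl// ltW.
  have := drift_diff_le b HT i r0 rM; rewrite (h_rho HT)// => /(ler_wpM2l (ltW t0)).
  rewrite (_ : t * (_ * t^-1) = M * rho t); last by field; rewrite gt_eqF.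
  rewrite -{1}(gtr0_norm t0) -normrM ler_norml mulrBr => /andP[h3 h4].
  by rewrite ler_norml; apply/andP; split; lra.
move=> y yc.
rewrite -addrA subrK.
have L := pdens_lipschitz (y + (x1 : 'rV[R]_d)) x1.
rewrite addrK in L.
have L2 : enorm y * (B * rho t ^- d / rho t) <= c^-1 * (B * rho t ^- d).
  apply: (@le_trans _ _ (c^-1 * rho t * (B * rho t ^- d / rho t))).
    by rewrite ler_wpM2r// mulr_ge0// invr_ge0 ltW.
  by rewrite le_eqVlt; apply/orP; left; apply/eqP; field; rewrite !gt_eqF.
have L3 : c^-1 * (B + 1) * rho t ^- d <= (2 * (M * rho t)) ^- d / 4.
  rewrite [in leRHS]mulrA exprMn invfM [leRHS]mulrAC ler_wpM2r ?invr_ge0 ?(ltW rd0)//.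
  rewrite -invfM ler_pdivrMl// ler_pdivlMr ?mulr_gt0// mulrC [_ * 4]mulrC.
  by lra.
have := le_trans L L2; rewrite ler_norml => /andP[h1 _].
rewrite mulrDr mulr1 mulrDl -mulrA in L3; have := le_trans L3 px1.
move: h1; move: (pdens _ _) (pdens _ _) (c^-1 * _) (c^-1 * _) => p q u v.
by rewrite lerBrDr => qup uvq; apply: le_trans qup; rewrite addrC lerBrDr addrC.
Qed.

End density.

End localization.

(** * Proof of the lemma *)

Section transition_density.
Context {R : realType} {d : nat} {disp : measure_display}.
Context {Omega : measurableType disp} (P : probability Omega R).
Variable Y : R -> {RV P >-> Rvec R d}.
Variables (A : 'M[R]_d) (N : {measure set (Rvec R d) -> \bar R}) (b : 'rV[R]_d).
Hypothesis HY : generating_triplet Y A N b.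
Hypothesis d_gt0 : (0 < d)%N.
Hypothesis h_unbounded : levy_h_unbounded A N.
Local Notation h := (levy_h A N).
Local Notation lvec := (@lebesgue_vec R d).
Local Notation ltup := (@lebesgue_tuple R d).
Local Notation row := (@row_of_tuple R d).
Local Notation psi := (re_psi A N).
Local Notation rho t := (levy_h_inv A N t^-1).
Implicit Types (t c al M : R) (T : \bar R).

Let HT : levy_triplet A N. Proof. by case: HY. Qed.
Let HN : levy_measure N. Proof. by case: HT. Qed.
Let mpsi : measurable_fun setT (psi : Rvec R d -> R). Proof. exact: measurable_re_psi. Qed.

Definition moment_const c al : R := @stretch_const R d (c ^+ 2 / @star_const R d) al * pi ^+ d.

Lemma moment_const_gt0 c al : 0 < c -> 0 < moment_const c al.
Proof.
move=> c0; have p0 := pi_gt0 R.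
have k0 : 0 < @star_const R d by have := @star_const_ge64 R d d_gt0; lra.
rewrite mulr_gt0 ?exprn_gt0//.
have a0 : 0 < c ^+ 2 / @star_const R d by rewrite divr_gt0// exprn_gt0.
by apply: lt_le_trans (@stretch_const_ge R d _ al a0); rewrite exprn_gt0.
Qed.

Lemma C3_transition_density T3 c3 al : cond_C3_with A N b T3 c3 al ->
  is_transition_density Y A N b (fun t => pdens (Y t)).
Proof.
move=> C3 t t0; apply: (is_density_pdens HY (ltW t0)).
have [T30 _ _ _ _] := C3.
(* The moment bound gives integrability only at times whose scale is below T3. It is taken at such a
   time u <= t and extends to t because Re Psi >= 0. *)
have [u u0 [ut uT]] : exists2 u, 0 < u & u <= t /\ ((rho u)%:E < T3)%E.
  have := scale_bound_gt0 HT h_unbounded T30.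
  case E : (levy_h_ereal A N T3)^-1%E => [v| |]// => [v0|_].
    exists (Num.min t (v / 2)); first by rewrite lt_min t0/= divr_gt0.
    split; first by rewrite ge_min lexx.
    apply: scale_lt => //; first by rewrite lt_min t0/= divr_gt0.
    rewrite E lte_fin gt_min; apply/orP; right; rewrite lte_fin in v0; lra.
  by exists t => //; split=> //; apply: scale_lt => //; rewrite E ltry.
have := rintegrable_charfun_norm HY h_unbounded u0 (C3_bound d_gt0 HT h_unbounded mpsi C3 u0 uT).
apply: le_rintegrable.
  exact: (measurableT_comp (measurable_re_psi_exp t mpsi) (@measurable_row_of_tuple R d)).
move=> tau; rewrite ger0_norm ?expR_ge0// ler_expR !mulNr lerN2 ler_wpM2r//.
exact: re_psi_ge0.
Qed.

Lemma C2_of_C3 : cond_C3 A N b -> cond_C2 A N b.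
Proof.
move=> [T3 [c3 [al C3]]]; have [T30 /andP[c0 _] _ _ _] := C3.
exists (levy_h_ereal A N T3)^-1%E, (moment_const c3 al); split.
- exact: scale_bound_gt0.
- exact: moment_const_gt0.
move=> t t0 tT; under eq_integral do rewrite (Re_Psi b HT).
apply: (integral_charfun_norm_le HY h_unbounded t0).
by apply: (C3_bound d_gt0 HT h_unbounded mpsi C3 t0); exact: scale_lt.
Qed.

Lemma C1_of_C3 : cond_C3 A N b -> cond_C1 Y A N b.
Proof.
move=> [T3 [c3 [al C3]]]; have [T30 /andP[c0 _] _ _ _] := C3.
exists (fun t => pdens (Y t)); first exact: C3_transition_density C3.
exists (levy_h_ereal A N T3)^-1%E, (moment_const c3 al); split.
- exact: scale_bound_gt0.
- exact: moment_const_gt0.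
move=> t t0 tT; apply: ge_ereal_sup => _ [x _ <-]; rewrite lee_fin.
apply: (pdens_le_scale HY h_unbounded t0).
by apply: (C3_bound d_gt0 HT h_unbounded mpsi C3 t0); exact: scale_lt.
Qed.

Lemma C3_of_C2 : cond_C2 A N b -> cond_C3 A N b.
Proof.
move=> [T2 [c2 [T20 c20 H]]].
apply: (C3_of_integral_bound b d_gt0 HT h_unbounded ltr01).
exists T2, c2; split=> // t t0 tT; have := H t t0 tT.
by under eq_integral do rewrite (Re_Psi b HT); rewrite mul1r.
Qed.

Lemma C3_of_C1 : cond_C1 Y A N b -> cond_C3 A N b.
Proof.
move=> [p Hp [T1 [c1 [T10 c10 H]]]].
apply: (C3_of_integral_bound b d_gt0 HT h_unbounded (kap := 2)) => //.
exists T1, ((2 * pi) ^+ d * c1); split=> //.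
  by rewrite mulr_gt0// exprn_gt0// mulr_gt0// pi_gt0.
move=> t t0 tT; have [mp p0 pl _] := Hp t t0; rewrite -mulrA.
apply: (density_law_bound HY (ltW t0) mp p0 _ pl) => x.
rewrite -lee_fin; apply: le_trans (H t t0 tT).
by apply: ereal_sup_ubound; exists x.
Qed.

(* At t h(r) = (384 d)^-1 the d coordinate tails, each at most 192 t h(r), sum
   to 1/2. *)
Definition tail_level : R := (384 * d%:R)^-1.

Lemma tail_level_gt0 : 0 < tail_level.
Proof. by rewrite /tail_level invr_gt0 mulr_gt0 ?ltr0n. Qed.

(** With q the tail level, (C3) between 1/(Mr) and 1/r gives c M^al Psi*(1/(Mr)) <= Psi*(1/r) <=
    4/t. As h(Mr) <= K Psi*(1/(Mr)), the bound t h(Mr) <= q follows from M^al >= 4 K / (c q). The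
    added 1 ensures M >= 1. *)
Definition spread_const c al : R := (1 + 4 * @star_const R d / (c * tail_level)) `^ al^-1.

Let spread_base c : 0 < c -> 0 <= 4 * @star_const R d / (c * tail_level).
Proof.
move=> c0; have k0 := @star_const_ge64 R d d_gt0; have q0 := mulr_gt0 c0 tail_level_gt0.
by apply: divr_ge0 (ltW q0); apply: mulr_ge0; lra.
Qed.

Lemma spread_const_ge1 c al : 0 < c -> 0 < al -> 1 <= spread_const c al.
Proof.
move=> c0 al0; rewrite /spread_const; move: (_ / _) (spread_base c0) => q q0.
apply: (@le_trans _ _ (1 `^ al^-1)); first by rewrite powR1.
by apply: ge0_ler_powR; rewrite ?nnegrE ?invr_ge0 ?(ltW al0)// ?lerDl// addr_ge0.
Qed.

Let spread_constK c al : 0 < c -> 0 < al ->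
  spread_const c al `^ al = 1 + 4 * @star_const R d / (c * tail_level).
Proof.
move=> c0 al0; rewrite /spread_const; move: (_ / _) (spread_base c0) => q q0.
by rewrite -powRrM mulVf ?gt_eqF// powRr1// addr_ge0.
Qed.

Lemma C3_spread T3 c3 al t : cond_C3_with A N b T3 c3 al -> 0 < t ->
  ((spread_const c3 al * rho t)%:E < T3)%E ->
  t * h (spread_const c3 al * rho t) <= tail_level.
Proof.
move=> [T30 /andP[c0 _] /andP[al0 _] _ dbl] t0 MT.
have M1 := spread_const_ge1 c0 al0; have Mal := spread_constK c0 al0.
have k0 := @star_const_ge64 R d d_gt0.
move: MT M1 Mal; move: (spread_const c3 al) tail_level tail_level_gt0 => M q q0 MT M1 Mal.
have r0 : 0 < rho t by exact: rho_gt0.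
have M0 : 0 < M := lt_le_trans ltr01 M1.
have Mr0 : 0 < M * rho t by rewrite mulr_gt0.
have := dbl M (M * rho t)^-1 M1 (ereal_inv_lt T30 Mr0 MT).
have MM : M * (M * rho t)^-1 = (rho t)^-1 by rewrite invfM mulVKf// gt_eqF.
rewrite Mal MM.
have ir0 : 0 < (rho t)^-1 by rewrite invr_gt0.
have iMr0 : 0 < (M * rho t)^-1 by rewrite invr_gt0.
have := psi_star_le_h b HT ir0; rewrite invrK (h_rho HT)//.
have := h_le_psi_star b HT iMr0; rewrite invrK.
have := psi_star_ge0 b HT (ltW iMr0).
move: (Psi_star _ _ _ _) (Psi_star _ _ _ _) (star_const) k0 => p' p K k0 p0 h1 h2 h3.
have h4 : 4 * K / q * p <= 4 * t^-1.
  apply: le_trans h2; apply: le_trans h3; rewrite ler_wpM2r//.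
  rewrite mulrDr mulr1 (_ : c3 * (_ / _) = 4 * K / q) ?lerDr ?(ltW c0)//.
  by field; rewrite !gt_eqF.
apply: (@le_trans _ _ (t * (K * p))); first by rewrite ler_wpM2l// ltW.
move: h4; rewrite -!mulrA ler_pM2l// => h4.
rewrite -(ler_pM2l (x := q^-1)) ?invr_gt0// mulVf ?gt_eqF//.
rewrite (_ : q^-1 * (t * (K * p)) = t * (K * (q^-1 * p))); last by ring.
by apply: le_trans (ler_wpM2l (ltW t0) h4) _; rewrite divff// gt_eqF.
Qed.

Lemma localization_const_ge1 B M : 0 <= B -> 1 <= M -> 1 <= @localization_const R d B M.
Proof.
move=> B0 M1; rewrite /localization_const lerDr addr_ge0 ?mulr_ge0 ?addr_ge0 ?exprn_ge0 ?mulr_ge0//; lra.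
Qed.

(** M is added to the constant so that c >= M: the restriction t < 1/h(T3/c) means c r < T3, which
    places both r and M r below T3, as the moment bound and [C3_spread] require. *)
Lemma CIm_of_C3_with T3 c3 al : cond_C3_with A N b T3 c3 al ->
  let M := spread_const c3 al in
  let c := @localization_const R d (moment_const c3 al) M + M in
  cond_CIm_with Y A N b (levy_h_ereal A N (T3 / c%:E))^-1%E c.
Proof.
move=> C3 M c; have [T30 /andP[c0 _] /andP[al0 _] _ _] := C3.
have M1 : 1 <= M by exact: spread_const_ge1.
have m0 := moment_const_gt0 al c0.
have lc1 : 1 <= @localization_const R d (moment_const c3 al) M.
  by apply: localization_const_ge1 => //; exact: ltW.
have cge1 : 1 <= c by rewrite /c; lra.
have cM : M <= c by rewrite /c; lra.
have cgt0 : 0 < c by lra.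
have Tc0 : (0 < T3 / c%:E)%E.
  by rewrite inver gt_eqF// mule_gt0// lte_fin invr_gt0.
exists (fun t => pdens (Y t)); first exact: C3_transition_density C3.
split=> //; first exact: scale_bound_gt0.
move=> t t0 tT.
have r0 : 0 < rho t by exact: rho_gt0.
have crT : ((c * rho t)%:E < T3)%E.
  have := scale_lt HT h_unbounded Tc0 t0 tT.
  by rewrite inver gt_eqF// lte_pdivlMr// -EFinM mulrC.
have lt_crT u : u <= c -> ((u * rho t)%:E < T3)%E.
  by move=> uc; apply: le_lt_trans crT; rewrite lee_fin ler_wpM2r// ltW.
apply: (localization HY h_unbounded t0 _ M1).
- apply: (C3_bound d_gt0 HT h_unbounded mpsi C3 t0).
  by rewrite -[rho t]mul1r; exact: lt_crT.
- by apply: (C3_spread C3 t0); exact: lt_crT.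
- by rewrite -/(moment_const c3 al) /c; lra.
Qed.

Lemma CIm_of_C3 : cond_C3 A N b -> cond_CIm Y A N b.
Proof. by move=> [T3 [c3 [al /CIm_of_C3_with C]]]; do 2!eexists; exact: C. Qed.

(** The integer k is so large that every t < T has scale below k T3; (C3), propagated to that range
    at the price of c3 / k^2, then gives the moment bound. The tail bound instead keeps the original
    (C3) at small scales. *)
Lemma CIm_of_C3_with_real (T3 c3 al T M : R) (k : nat) : (0 < k)%N -> 0 < T ->
  let M1 := spread_const c3 al in M1 <= M ->
  h (k%:R * T3) < T^-1 -> T * h (M * (T3 / M1)) <= tail_level ->
  cond_C3_with A N b T3%:E c3 al ->
  cond_CIm_with Y A N b T%:E (@localization_const R d (moment_const (c3 / k%:R ^+ 2) al) M).
Proof.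
move=> k0 T0 M1 M1M hk hM C3; have [T30 /andP[c0 _] /andP[al0 _] _ _] := C3.
rewrite lte_fin in T30.
have C3k := C3_with_scale HT k0 C3.
have k0' : 0 < k%:R :> R by rewrite ltr0n.
have kT0 : 0 < k%:R * T3 by rewrite mulr_gt0.
have M1_ge1 : 1 <= M1 by exact: spread_const_ge1.
have M_ge1 : 1 <= M by exact: le_trans M1M.
have M1_gt0 : 0 < M1 := lt_le_trans ltr01 M1_ge1.
have M_gt0 : 0 < M := lt_le_trans ltr01 M_ge1.
have ck0 : 0 < c3 / k%:R ^+ 2 by rewrite divr_gt0// exprn_gt0.
exists (fun t => pdens (Y t)); first exact: C3_transition_density C3.
split=> //.
  by apply: localization_const_ge1 => //; rewrite ltW// moment_const_gt0.
move=> t t0; rewrite lte_fin => tT.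
have r0 : 0 < rho t by exact: rho_gt0.
have rk : rho t < k%:R * T3.
  rewrite -(levy_h_lt_iff HN h_unbounded)// (h_rho HT)// (lt_trans hk)//.
  by rewrite ltf_pV2.
apply: (localization HY h_unbounded t0 _ M_ge1) (lexx _).
  exact: (C3_bound d_gt0 HT h_unbounded mpsi C3k t0).
(* While M1 r < T3 the spread constant works and M >= M1 only helps; otherwise r >= T3 / M1, and the
   choice of M makes T h(M r) small by monotonicity of h. *)
have [rT|Tr] := ltP (M1 * rho t) T3.
  apply: le_trans (C3_spread C3 t0 _); last by rewrite lte_fin.
  apply: ler_wpM2l; first exact: ltW.
  by apply: levy_h_anti => //; [exact: mulr_gt0|rewrite ler_wpM2r// ltW].
apply: le_trans hM; apply: ler_pM; rewrite ?(ltW t0) ?(ltW tT) ?levy_h_ge0//.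
apply: levy_h_anti => //; first by rewrite mulr_gt0// divr_gt0.
by rewrite ler_wpM2l ?(ltW M_gt0)// ler_pdivrMr// mulrC.
Qed.

Lemma levy_h_small_multiple (u e : R) : 0 < u -> 0 < e ->
  exists2 n : nat, (0 < n)%N & forall v, n%:R * u <= v -> h v < e.
Proof.
move=> u0 e0; have [r rpos hr] := levy_h_cvg0 A HN (divr_gt0 e0 (ltr0n R 2)).
have [n rn] : exists n : nat, r / u <= n%:R.
  by exists (Num.bound (r / u)); rewrite ltW// archi_boundP// divr_ge0// ltW.
exists n.+1 => // v nv.
apply: (@le_lt_trans _ _ (h r)); last by lra.
apply: levy_h_anti => //; apply: le_trans nv.
rewrite ler_pdivrMr// in rn; apply: le_trans rn _.
by rewrite ler_wpM2r ?(ltW u0)// ler_nat.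
Qed.

End transition_density.

Theorem lemma3p5 (R : realType) (d : nat) (d_gt0 : (0 < d)%N) :
  [/\ forall (disp : measure_display) (Omega : measurableType disp)
        (P : probability Omega R) (Y : R -> {RV P >-> Rvec R d})
        (A : 'M[R]_d) (N : {measure set (Rvec R d) -> \bar R}) (b : 'rV[R]_d),
        levy_process Y -> generating_triplet Y A N b -> levy_h_unbounded A N ->
        [/\ [<-> cond_C1 Y A N b; cond_C2 A N b; cond_C3 A N b; cond_C4 A N b],
            cond_C1 Y A N b -> cond_CIm Y A N b,
            cond_C2 A N b -> cond_CIm Y A N b,
            cond_C3 A N b -> cond_CIm Y A N b &
            cond_C4 A N b -> cond_CIm Y A N b],
      forall c3 alpha3 : R,
        exists c : R,
        forall (disp : measure_display) (Omega : measurableType disp)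
          (P : probability Omega R) (Y : R -> {RV P >-> Rvec R d})
          (A : 'M[R]_d) (N : {measure set (Rvec R d) -> \bar R})
          (b : 'rV[R]_d) (T3 : \bar R),
          levy_process Y -> generating_triplet Y A N b -> levy_h_unbounded A N ->
          cond_C3_with A N b T3 c3 alpha3 ->
          cond_CIm_with Y A N b ((levy_h_ereal A N (T3 / c%:E))^-1)%E c &
      forall (c3 alpha3 T3 T : R) (h : R -> R), 0 < T ->
        exists c : R,
        forall (disp : measure_display) (Omega : measurableType disp)
          (P : probability Omega R) (Y : R -> {RV P >-> Rvec R d})
          (A : 'M[R]_d) (N : {measure set (Rvec R d) -> \bar R})
          (b : 'rV[R]_d),
          levy_process Y -> generating_triplet Y A N b -> levy_h_unbounded A N ->
          (forall r : R, 0 < r -> levy_h A N r = h r) ->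
          cond_C3_with A N b T3%:E c3 alpha3 ->
          cond_CIm_with Y A N b T%:E c].
Proof.
split.
- move=> disp Omega P Y A N b _ HY hu; have [HT _] := HY.
  have C13 := C3_of_C1 HY d_gt0 hu; have C23 := C3_of_C2 HY d_gt0 hu.
  have C43 := @C3_of_C4 _ _ _ _ b d_gt0 HT; have C3m := CIm_of_C3 HY d_gt0 hu.
  split=> [||/C23/C3m|//|/C43/C3m]//; last by move=> /C13/C3m.
  split; first by move=> /C13; exact: (C2_of_C3 HY).
  split; first exact: C23.
  split; first exact: C4_of_C3.
  by move=> /C43; exact: (C1_of_C3 HY).
(* The witness left open here is resolved to the closed term of [CIm_of_C3_with], which mentions
   only d, c3 and alpha3. *)
- move=> c3 al; eexists => disp Omega P Y A N b T3 _ HY hu C3.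
  exact: (CIm_of_C3_with HY d_gt0 hu C3).
- move=> c3 al T3 T h T0; pose M1 : R := @spread_const R d c3 al.
  (* k and M must be chosen from the function h alone, before any triplet is given. If no pair is
     suitable, then h does not come from a triplet satisfying the hypotheses, since h vanishes at
     infinity for those; the value 0 then serves vacuously. *)
  have [[k [M [k0 M1M hk hM]]]|none] := pselect (exists (k : nat) (M : R),
      [/\ (0 < k)%N, M1 <= M, h (k%:R * T3) < T^-1 &
          T * h (M * (T3 / M1)) <= @tail_level R d]).
    eexists => disp Omega P Y A N b _ HY hu hE C3.
    have [T30 /andP[c0 _] /andP[al0 _] _ _] := C3; rewrite lte_fin in T30.
    have M1_ge1 : 1 <= M1 by exact: spread_const_ge1.
    apply: (CIm_of_C3_with_real HY d_gt0 hu k0 T0 M1M _ _ C3).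
      by rewrite hE// mulr_gt0// ltr0n.
    have M1_gt0 := lt_le_trans ltr01 M1_ge1.
    by rewrite hE// mulr_gt0 ?divr_gt0// (lt_le_trans M1_gt0).
  exists 0 => disp Omega P Y A N b _ HY hu hE C3; exfalso; apply: none.
  have [T30 /andP[c0 _] /andP[al0 _] _ _] := C3; rewrite lte_fin in T30.
  have M1_ge1 : 1 <= M1 by exact: spread_const_ge1.
  have [k k0 hk] := levy_h_small_multiple HY T30 (etrans (invr_gt0 T) T0).
  have e0 : 0 < @tail_level R d / T by rewrite divr_gt0// tail_level_gt0.
  have T3M1 : 0 < T3 / M1 by rewrite divr_gt0//; lra.
  have [n n0 hn] := levy_h_small_multiple HY T3M1 e0.
  have n0' : 0 < n%:R :> R by rewrite ltr0n.
  exists k, (M1 + n%:R); split=> //.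
  + by rewrite lerDl.
  + by rewrite -hE ?mulr_gt0 ?ltr0n//; exact: hk.
  + rewrite -hE; last by rewrite mulr_gt0//; lra.
    rewrite mulrC -ler_pdivlMr// ltW//; apply: hn.
    by rewrite ler_wpM2r ?(ltW T3M1)// lerDr; lra.
Qed.
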